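(* Let $l$ be a prime, $L$ a number field, and let $(V_{\mathbb Z},s,\rho)$ be an $(\infty,l)$-integral structure such that $U_l:=\rho(\mathrm{Gal}(\overline L/L))\subset\mathrm{GL}(V_{\mathbb Z_l})$ is an open subgroup of $M(\mathbb Q_l)$, where $M\subset\mathrm{GL}(V_{\mathbb Q})$ is the Mumford–Tate group of $s$. Let $$T=\{\alpha U_l\alpha^{-1}\ :\ \alpha\in\mathrm{GL}(V_{\mathbb Q_l}),\ \alpha U_l\alpha^{-1}\subset\mathrm{GL}(V_{\mathbb Z_l})\},$$ a set of subgroups of $\mathrm{GL}(V_{\mathbb Z_l})$ on which $\mathrm{GL}(V_{\mathbb Z_l})$ acts by conjugation. Then $T$ is a finite union of $\mathrm{GL}(V_{\mathbb Z_l})$-orbits.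
   Context: $\mathbb S=\mathrm{Res}_{\mathbb C/\mathbb R}\mathbb G_{m,\mathbb C}$. An $(\infty,l)$-integral structure $(V_{\mathbb Z},s,\rho)$ on a finite-dimensional $\mathbb Q$-vector space $V_{\mathbb Q}$ consists of a lattice $V_{\mathbb Z}\subset V_{\mathbb Q}$, a polarised $\mathbb Z$-Hodge structure $s:\mathbb S\to\mathrm{GL}(V_{\mathbb R})$, and a continuous representation $\rho:\mathrm{Gal}(\overline L/L)\to\mathrm{GL}(V_{\mathbb Z_l})$, such that $\mathrm{End}_{\mathbb Z\text{-}HS}(V_{\mathbb Z})\otimes\mathbb Z_l\subset\mathrm{End}_{\mathrm{Gal}(\overline L/L)}(V_{\mathbb Z_l})$. The Mumford–Tate group of $s$ is the smallest $\mathbb Q$-subgroup $M$ of $\mathrm{GL}(V_{\mathbb Q})$ such that $s$ factors through $M_{\mathbb R}$; it is connected reductive. Notation: $V_{\mathbb Z_l}=V_{\mathbb Z}\otimes\mathbb Z_l$, $V_{\mathbb Q_l}=V_{\mathbb Q}\otimes\mathbb Q_l$. *)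

(* Defs.v *)
From HB Require Import structures.
From mathcomp Require Import all_boot all_order all_algebra all_field.
From mathcomp Require Import mpoly.
From mathcomp Require Import boolp classical_sets cardinality filter.
From mathcomp Require Import reals topology.

Set Implicit Arguments.
Unset Strict Implicit.
Unset Printing Implicit Defensive.

Import Order.TTheory GRing.Theory Num.Theory.
Import passmx.

Local Open Scope classical_set_scope.
Local Open Scope ring_scope.

(* l-adic integers: [Zadic l_prime] is the inverse limit of the Z/l^n, each   *)
(* residue class being represented by its representative in [0, l^n[.         *)

Definition Zadic_coherent (l : nat) (x : nat -> int) : Prop :=
  forall n, x n = (x n.+1 %% (l%:Z ^+ n))%Z.

(* The proof of primality is a parameter of the type because its ring and     *)
(* field structures depend on it.                                             *)
Record Zadic (l : nat) (l_prime : prime l) : Type := MkZadic {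
  Zadic_seq :> nat -> int;
  Zadic_seqP : Zadic_coherent l Zadic_seq
}.

Section ZadicDef.
Variables (l : nat) (l_prime : prime l).
Local Notation Zadic := (Zadic l_prime).

HB.instance Definition _ := gen_eqMixin Zadic.
HB.instance Definition _ := gen_choiceMixin Zadic.

Local Notation "l^ n" := (l%:Z ^+ n) (at level 30).

Lemma Zadic_eqP (x y : Zadic) : (forall n, x n = y n) -> x = y.
Proof.
case: x y => [x xP] [y yP] /= xy; have {}xy : x = y by exact: funext.
by subst y; congr (MkZadic _); exact: Prop_irrelevance.
Qed.

Lemma Zadic_modz (x : Zadic) n : (x n %% l^ n)%Z = x n.
Proof. by rewrite [in LHS](Zadic_seqP x) modz_mod -(Zadic_seqP x). Qed.

Lemma Zadic_modzS (x : Zadic) n : (x n.+1 = x n %[mod l^ n])%Z.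
Proof. by rewrite Zadic_modz -(Zadic_seqP x). Qed.

Lemma modz_expS (m : int) n : ((m %% l^ n.+1)%Z = m %[mod l^ n])%Z.
Proof.
apply/eqP; rewrite eqz_mod_dvd -opprB rpredN {1}(divz_eq m (l^ n.+1)) addrK.
by apply: dvdz_mull; rewrite exprSr dvdz_mulr.
Qed.

Lemma Zadic_of_subproof (u : nat -> int) :
  (forall n, (u n.+1 = u n %[mod l^ n])%Z) ->
  Zadic_coherent l (fun n => (u n %% l^ n)%Z).
Proof. by move=> uP n; rewrite modz_expS uP. Qed.

Definition Zadic_of u uP := MkZadic l_prime (@Zadic_of_subproof u uP).

Lemma Zadic_zeroP n : ((0 : int) = 0 %[mod l^ n])%Z. Proof. by []. Qed.
Lemma Zadic_oneP n : ((1 : int) = 1 %[mod l^ n])%Z. Proof. by []. Qed.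
Lemma Zadic_oppP (x : Zadic) n : (- x n.+1 = - x n %[mod l^ n])%Z.
Proof. by rewrite -modzNm Zadic_modzS modzNm. Qed.
Lemma Zadic_addP (x y : Zadic) n :
  (x n.+1 + y n.+1 = x n + y n %[mod l^ n])%Z.
Proof. by rewrite -modzDm !Zadic_modzS modzDm. Qed.
Lemma Zadic_mulP (x y : Zadic) n :
  (x n.+1 * y n.+1 = x n * y n %[mod l^ n])%Z.
Proof. by rewrite -modzMm !Zadic_modzS modzMm. Qed.

Definition Zadic_zero := Zadic_of Zadic_zeroP.
Definition Zadic_one := Zadic_of Zadic_oneP.
Definition Zadic_opp x := Zadic_of (Zadic_oppP x).
Definition Zadic_add x y := Zadic_of (Zadic_addP x y).
Definition Zadic_mul x y := Zadic_of (Zadic_mulP x y).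

Lemma Zadic_addA : associative Zadic_add.
Proof. by move=> x y z; apply: Zadic_eqP => n /=; rewrite modzDmr modzDml addrA. Qed.
Lemma Zadic_addC : commutative Zadic_add.
Proof. by move=> x y; apply: Zadic_eqP => n /=; rewrite addrC. Qed.
Lemma Zadic_add0 : left_id Zadic_zero Zadic_add.
Proof. by move=> x; apply: Zadic_eqP => n /=; rewrite modzDml add0r Zadic_modz. Qed.
Lemma Zadic_addN : left_inverse Zadic_zero Zadic_opp Zadic_add.
Proof. by move=> x; apply: Zadic_eqP => n /=; rewrite modzDml addNr. Qed.

HB.instance Definition _ := GRing.isZmodule.Build Zadic
  Zadic_addA Zadic_addC Zadic_add0 Zadic_addN.

Lemma Zadic_mulA : associative Zadic_mul.
Proof. by move=> x y z; apply: Zadic_eqP => n /=; rewrite modzMmr modzMml mulrA. Qed.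
Lemma Zadic_mulC : commutative Zadic_mul.
Proof. by move=> x y; apply: Zadic_eqP => n /=; rewrite mulrC. Qed.
Lemma Zadic_mul1 : left_id Zadic_one Zadic_mul.
Proof. by move=> x; apply: Zadic_eqP => n /=; rewrite modzMml mul1r Zadic_modz. Qed.
Lemma Zadic_mulD : left_distributive Zadic_mul Zadic_add.
Proof. by move=> x y z; apply: Zadic_eqP => n /=; rewrite modzMml modzDm mulrDl. Qed.
Lemma Zadic_one_neq0 : Zadic_one != Zadic_zero.
Proof.
have l_gt1 := prime_gt1 l_prime.
apply/eqP => /(congr1 (fun x : Zadic => x 1%N)) /=.
by rewrite expr1 mod0z modz_small// ler01 /= ltz_nat.
Qed.

HB.instance Definition _ := GRing.Zmodule_isComNzRing.Build Zadic
  Zadic_mulA Zadic_mulC Zadic_mul1 Zadic_mulD Zadic_one_neq0.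

Definition Zadic_unit : {pred Zadic} := fun x => `[< exists y, y * x = 1 >].

Definition Zadic_inv (x : Zadic) : Zadic :=
  if pselect (exists y, y * x = 1) is left ex then projT1 (cid ex) else x.

Lemma Zadic_mulVx : {in Zadic_unit, left_inverse 1 Zadic_inv *%R}.
Proof.
move=> x /asboolP ex; rewrite /Zadic_inv; case: pselect => // ex'.
exact: projT2 (cid ex').
Qed.
Lemma Zadic_unitPl (x y : Zadic) : y * x = 1 -> Zadic_unit x.
Proof. by move=> yx; apply/asboolP; exists y. Qed.
Lemma Zadic_inv_out : {in [predC Zadic_unit], Zadic_inv =1 id}.
Proof.
move=> x; rewrite inE => /asboolPn nex; rewrite /Zadic_inv.
by case: pselect.
Qed.

HB.instance Definition _ := GRing.ComNzRing_hasMulInverse.Build Zadic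
  Zadic_mulVx Zadic_unitPl Zadic_inv_out.

Lemma Zadic_modz_add (x : Zadic) n k : (x (n + k)%N = x n %[mod l^ n])%Z.
Proof.
elim: k => [|k IHk]; first by rewrite addn0.
rewrite -IHk addnS; apply/eqP; rewrite eqz_mod_dvd.
apply: (@dvdz_trans (l^ (n + k))); first by rewrite exprD dvdz_mulr.
by rewrite -eqz_mod_dvd Zadic_modzS.
Qed.

Lemma Zadic_neq0 (x : Zadic) : x != 0 -> exists n, ~~ (l^ n %| x n)%Z.
Proof.
move=> x0; apply: contrapT => /forallNP dvd_x; move/eqP: x0; apply.
apply: Zadic_eqP => n /=; rewrite mod0z.
by move/negP: (dvd_x n); rewrite negbK => /dvdz_mod0P; rewrite Zadic_modz.
Qed.

Lemma dvdz_expM_prime (a b : int) m n :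
  (l^ (m + n) %| a * b)%Z -> (l^ m %| a)%Z || (l^ n %| b)%Z.
Proof.
rewrite !dvdzE abszM !abszX /=.
have [->|a0] := eqVneq `|a|%N 0%N; first by rewrite dvdn0.
have [->|b0] := eqVneq `|b|%N 0%N; first by rewrite !dvdn0 orbT.
rewrite !pfactor_dvdn ?muln_gt0 ?lt0n ?a0 ?b0// lognM ?lt0n//.
move=> mn; apply: contraLR mn; rewrite negb_or -!ltnNge => /andP[am bn].
by rewrite -addSn leq_add// ltnW.
Qed.

Lemma Zadic_mulf_eq0 (x y : Zadic) : x * y = 0 -> (x == 0) || (y == 0).
Proof.
move=> xy0; apply: contraPT xy0; rewrite negb_or => /andP[/Zadic_neq0[m xm]].
move=> /Zadic_neq0[n yn] /(congr1 (fun z : Zadic => z (m + n)%N)) /=.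
rewrite mod0z => /dvdz_mod0P /dvdz_expM_prime /orP[].
- by apply/negP; apply: contra xm => /dvdz_mod0P;
     rewrite Zadic_modz_add => /dvdz_mod0P.
- by apply/negP; apply: contra yn => /dvdz_mod0P;
     rewrite addnC Zadic_modz_add => /dvdz_mod0P.
Qed.

HB.instance Definition _ :=
  GRing.ComUnitRing_isIntegral.Build Zadic Zadic_mulf_eq0.

End ZadicDef.

Section QadicDef.
Variables (l : nat) (l_prime : prime l).

Definition Qadic : Type := {fraction (Zadic l_prime)}.

HB.instance Definition _ := GRing.Field.on Qadic.

Definition Zadic_val (c : Zadic l_prime) : Qadic := tofrac c.

Definition Qadic_close (n : nat) (xy : Qadic * Qadic) : Prop :=
  exists c : Zadic l_prime, xy.1 - xy.2 = l%:R ^+ n * Zadic_val c.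

Definition Qadic_ent : set_system (Qadic * Qadic) :=
  filter_from [set: nat] (fun n => [set xy | Qadic_close n xy]).

Lemma Qadic_close_le m n xy : (m <= n)%N -> Qadic_close n xy -> Qadic_close m xy.
Proof.
move=> mn [c xyE]; exists (l%:R ^+ (n - m) * c); rewrite xyE.
rewrite /Zadic_val rmorphM rmorphXn /= rmorph_nat mulrA -exprD.
by rewrite addnC subnK.
Qed.

Lemma Qadic_ent_filter : Filter Qadic_ent.
Proof.
apply: filter_from_filter; first by exists 0%N.
move=> m n _ _; exists (maxn m n) => // xy /= h; split.
- exact: Qadic_close_le (leq_maxl m n) h.
- exact: Qadic_close_le (leq_maxr m n) h.
Qed.

Lemma Qadic_ent_refl A : Qadic_ent A -> diagonal `<=` A.
Proof.
move=> [n _ nA] [x y]; rewrite /diagonal /= => xy; apply: nA; exists 0.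
by rewrite xy /Zadic_val rmorph0 mulr0 subrr.
Qed.

Lemma Qadic_ent_inv A : Qadic_ent A -> Qadic_ent A^-1%relation.
Proof.
move=> [n _ nA]; exists n => // -[x y] [c /= xy]; apply: nA; exists (- c).
by rewrite /Zadic_val rmorphN mulrN -xy opprB.
Qed.

Lemma Qadic_ent_split A :
  Qadic_ent A -> exists2 B, Qadic_ent B & (B \; B `<=` A)%relation.
Proof.
move=> [n _ nA]; exists [set xy | Qadic_close n xy]; first by exists n.
move=> [x y] [z [c /= xz] [d /= zy]]; apply: nA; exists (c + d).
by rewrite /Zadic_val rmorphD mulrDr -xz -zy addrA subrK.
Qed.

HB.instance Definition _ := isUniform.Build Qadic
  Qadic_ent_filter Qadic_ent_refl Qadic_ent_inv Qadic_ent_split.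

End QadicDef.

(* Gal(Lbar/L) with its Krull topology. Two automorphisms are close when they *)
(* agree on a given finite list of elements, i.e. on the finite extension of  *)
(* L they generate.                                                           *)

Section GaloisGroup.
Variables (L Lbar : fieldType) (iota : {rmorphism L -> Lbar}).

Definition is_absGal (s : Lbar -> Lbar) : Prop :=
  [/\ zmod_morphism s, monoid_morphism s, bijective s
    & forall x, s (iota x) = iota x].

Record absGal : Type := MkAbsGal { absGal_fun :> Lbar -> Lbar; absGalP : is_absGal absGal_fun }.

HB.instance Definition _ := gen_eqMixin absGal.
HB.instance Definition _ := gen_choiceMixin absGal.

Lemma absGal_eqP (s t : absGal) : s =1 t -> s = t.
Proof.
case: s t => [s sP] [t tP] /= st; have {}st : s = t by exact: funext.
by subst t; congr MkAbsGal; exact: Prop_irrelevance.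
Qed.

Lemma is_absGal_id : is_absGal id.
Proof. by split=> //; exists id. Qed.

Lemma is_absGal_comp (s t : absGal) : is_absGal (s \o t).
Proof.
case: s t => [s [sB [s1 sM] sb sL]] [t [tB [t1 tM] tb tL]] /=; split.
- by move=> x y; rewrite /= tB sB.
- by split=> [|x y]; rewrite /= ?t1 ?s1// tM sM.
- exact: bij_comp.
- by move=> x; rewrite /= tL sL.
Qed.

Lemma absGal_inv_ex (s : absGal) : exists t : Lbar -> Lbar, cancel s t /\ cancel t s.
Proof. by have [_ _ [t st ts] _] := absGalP s; exists t. Qed.

Definition absGal_inv_fun (s : absGal) : Lbar -> Lbar := projT1 (cid (absGal_inv_ex s)).

Lemma absGal_inv_funK (s : absGal) : cancel s (absGal_inv_fun s).
Proof. exact: (projT2 (cid (absGal_inv_ex s))).1. Qed.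
Lemma absGal_funVK (s : absGal) : cancel (absGal_inv_fun s) s.
Proof. exact: (projT2 (cid (absGal_inv_ex s))).2. Qed.

Lemma is_absGal_inv (s : absGal) : is_absGal (absGal_inv_fun s).
Proof.
have [sB [s1 sM] sb sL] := absGalP s.
have sK := absGal_inv_funK s; have Ks := absGal_funVK s; split.
- by move=> x y; apply: (can_inj sK); rewrite sB !Ks.
- split=> [|x y]; first by rewrite -[in LHS]s1 sK.
  by apply: (can_inj sK); rewrite sM !Ks.
- by exists s.
- by move=> x; rewrite -[in LHS]sL sK.
Qed.

Definition absGal_one := MkAbsGal is_absGal_id.
Definition absGal_mul s t := MkAbsGal (is_absGal_comp s t).
Definition absGal_inv s := MkAbsGal (is_absGal_inv s).

Lemma absGal_mulA : associative absGal_mul.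
Proof. by move=> s t u; apply: absGal_eqP. Qed.
Lemma absGal_mul1 : left_id absGal_one absGal_mul.
Proof. by move=> s; apply: absGal_eqP. Qed.
Lemma absGal_mulr1 : right_id absGal_one absGal_mul.
Proof. by move=> s; apply: absGal_eqP. Qed.
Lemma absGal_mulV : left_inverse absGal_one absGal_inv absGal_mul.
Proof. by move=> s; apply: absGal_eqP => x /=; rewrite absGal_inv_funK. Qed.
Lemma absGal_mulrV : right_inverse absGal_one absGal_inv absGal_mul.
Proof. by move=> s; apply: absGal_eqP => x /=; rewrite absGal_funVK. Qed.

HB.instance Definition _ := isGroup.Build absGal
  absGal_mulA absGal_mul1 absGal_mulr1 absGal_mulV absGal_mulrV.

Definition absGal_ent : set_system (absGal * absGal) :=
  filter_from [set: seq Lbar]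
    (fun xs => [set st : absGal * absGal | forall x, x \in xs -> st.1 x = st.2 x]).

Lemma absGal_ent_filter : Filter absGal_ent.
Proof.
apply: filter_from_filter; first by exists [::].
move=> xs ys _ _; exists (xs ++ ys) => // -[s t] /= h.
by split=> x hx; apply: h; rewrite mem_cat hx ?orbT.
Qed.

Lemma absGal_ent_refl A : absGal_ent A -> diagonal `<=` A.
Proof.
move=> [xs _ xsA] [s t]; rewrite /diagonal /= => st; apply: xsA => x _ /=.
by rewrite st.
Qed.

Lemma absGal_ent_inv A : absGal_ent A -> absGal_ent A^-1%relation.
Proof.
move=> [xs _ xsA]; exists xs => // -[s t] /= h; apply: xsA => x hx /=.
by rewrite h.
Qed.

Lemma absGal_ent_split A : absGal_ent A -> exists2 B, absGal_ent B & (B \; B `<=` A)%relation.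
Proof.
move=> [xs _ xsA].
exists [set st : absGal * absGal | forall x, x \in xs -> st.1 x = st.2 x]; first by exists xs.
move=> [s t] [u /= su ut]; apply: xsA => x hx /=.
by rewrite su// ut.
Qed.

HB.instance Definition _ := isUniform.Build absGal
  absGal_ent_filter absGal_ent_refl absGal_ent_inv absGal_ent_split.

End GaloisGroup.

(* Extension of scalars. Fixing the basis [vbasis fullv] of V, the module     *)
(* V_A is A^n, n = dim V, seen as column vectors, so that GL(V_A) and         *)
(* End(V_A) are matrices acting on the left. The structure map Q -> A is      *)
(* [ratr], which is the unique one when A is a Q-algebra.                     *)

Notation vdim V := (\dim (fullv : {vspace V})).

Section BaseChange.
Variable V : vectType rat.
Local Notation e := (vbasis (fullv : {vspace V})).
Local Notation n := (vdim V).

Definition bc_vec (A : comUnitRingType) (v : V) : 'cV[A]_n :=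
  (map_mx ratr (rVof e v))^T.

(* [mxof] describes the action on row vectors, whence the transpose.          *)
Definition bc_end (A : comUnitRingType) (f : 'End(V)) : 'M[A]_n :=
  (map_mx ratr (mxof e e f))^T.

Definition bc_form (A : comUnitRingType) (psi : V -> V -> rat) : 'M[A]_n :=
  \matrix_(i, j) ratr (psi e`_i e`_j).

Definition is_lattice (VZ : set V) : Prop :=
  exists b : n.-tuple V, basis_of fullv b /\
    VZ = [set v : V | exists c : 'I_n -> int, v = \sum_(i < n) b`_i *~ c i].

End BaseChange.

(* Q-subgroups of GL_n: closed subschemes of GL_n, cut out by polynomials in  *)
(* the n^2 matrix entries, whose A-points form a subgroup of GL_n(A) for      *)
(* every Q-algebra A.                                                         *)

Definition is_Q_algebra (A : comUnitRingType) : Prop :=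
  forall k : nat, (k.+1%:R : A) \is a GRing.unit.

Definition GLn_zeros n (E : set {mpoly rat[n * n]}) (A : comUnitRingType) :
    set 'M[A]_n :=
  [set g : 'M_n | g \in unitmx /\
           forall P, E P -> mmap ratr (fun k => mxvec g 0 k) P = 0].

Arguments GLn_zeros {n} E A _.

Record Q_subgroup (n : nat) : Type := MkQSubgroup {
  Q_subgroup_eqs : set {mpoly rat[n * n]};
  Q_subgroup1 : forall A, is_Q_algebra A -> GLn_zeros Q_subgroup_eqs A (1%:M : 'M[A]_n);
  Q_subgroupM : forall (A : comUnitRingType) (g h : 'M[A]_n), is_Q_algebra A ->
    GLn_zeros Q_subgroup_eqs A g -> GLn_zeros Q_subgroup_eqs A h ->
    GLn_zeros Q_subgroup_eqs A (g *m h);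
  Q_subgroupV : forall (A : comUnitRingType) (g : 'M[A]_n), is_Q_algebra A ->
    GLn_zeros Q_subgroup_eqs A g -> GLn_zeros Q_subgroup_eqs A (invmx g)
}.

Definition Q_subgroup_pts n (M : Q_subgroup n) (A : comUnitRingType) :
  set 'M[A]_n := GLn_zeros (Q_subgroup_eqs M) A.

Arguments Q_subgroup_pts {n} M A _.

Definition Q_subgroup_le n (M N : Q_subgroup n) : Prop :=
  forall A, is_Q_algebra A -> Q_subgroup_pts M A `<=` Q_subgroup_pts N A.

(* The Deligne torus S = Res_{C/R} G_m and its algebraic representations. For *)
(* an R-algebra A, S(A) is the group of units of A (x)_R C = A + A i, the     *)
(* pair (a, b) standing for a + b i; its norm is a^2 + b^2. A morphism of     *)
(* R-schemes S -> M_n is a matrix over R[x, y, 1/(x^2 + y^2)].                *)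

Section DeligneTorus.
Variable A : comUnitRingType.
Implicit Types z w : A * A.

Definition Snorm z : A := z.1 ^+ 2 + z.2 ^+ 2.
Definition Spoint : set (A * A) := [set z | Snorm z \is a GRing.unit].
Definition Sone : A * A := (1, 0).
Definition Smul z w : A * A :=
  (z.1 * w.1 - z.2 * w.2, z.1 * w.2 + z.2 * w.1).

End DeligneTorus.

Section DeligneRep.
Variables (R : realType) (n : nat).

Definition Seval (num : 'M[{mpoly R[2]}]_n) (den : nat)
    (A : comUnitRingType) (phi : {rmorphism R -> A}) (z : A * A) : 'M[A]_n :=
  Snorm z ^- den *: map_mx (mmap phi (tnth [tuple z.1; z.2])) num.

Record S_rep : Type := MkSRep {
  S_rep_num : 'M[{mpoly R[2]}]_n;
  S_rep_den : nat;
  S_rep1 : forall (A : comUnitRingType) (phi : {rmorphism R -> A}),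
    Seval S_rep_num S_rep_den phi (Sone A) = 1%:M;
  S_repM : forall (A : comUnitRingType) (phi : {rmorphism R -> A}) z w,
    Spoint z -> Spoint w ->
    Seval S_rep_num S_rep_den phi (Smul z w) =
      Seval S_rep_num S_rep_den phi z *m Seval S_rep_num S_rep_den phi w
}.

Definition S_act (s : S_rep) (A : comUnitRingType)
    (phi : {rmorphism R -> A}) (z : A * A) : 'M[A]_n :=
  Seval (S_rep_num s) (S_rep_den s) phi z.

Definition S_factors_through (s : S_rep) (M : Q_subgroup n) : Prop :=
  forall (A : comUnitRingType) (phi : {rmorphism R -> A}) z,
    Spoint z -> Q_subgroup_pts M A (S_act s phi z).

Definition is_Mumford_Tate (s : S_rep) (M : Q_subgroup n) : Prop :=
  S_factors_through s M /\
  forall N, S_factors_through s N -> Q_subgroup_le M N.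

End DeligneRep.

(* Polarised Z-Hodge structures, pure of weight m. Deligne's convention: z    *)
(* acts on V^{p,q} as z^-p zbar^-q, so t in G_m acts as t^-m and S acts on    *)
(* Z(-m) through Snorm^-m; the factor (2 i pi)^-m of Z(-m) is dropped from    *)
(* the values of the polarisation psi. The Weil operator is s(i).             *)

Section Hodge.
Variables (R : realType) (V : vectType rat).

Record polarised_HS (VZ : set V) : Type := MkPolarisedHS {
  HS_rep : S_rep R (vdim V);
  HS_weight : int;
  HS_pure : forall (A : comUnitRingType) (phi : {rmorphism R -> A}) (t : A),
    t \is a GRing.unit -> S_act HS_rep phi (t, 0) = (t ^ (- HS_weight))%:M;
  HS_form : {biscalar V};
  HS_form_int : forall v w, VZ v -> VZ w -> HS_form v w \is a Num.int;
  HS_form_equivariant :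
    forall (A : comUnitRingType) (phi : {rmorphism R -> A}) z, Spoint z ->
      (S_act HS_rep phi z)^T *m bc_form A HS_form *m S_act HS_rep phi z =
        Snorm z ^ (- HS_weight) *: bc_form A HS_form;
  HS_form_sym : let Q := bc_form R HS_form *m S_act HS_rep idfun (0, 1) in
    Q^T = Q;
  HS_form_pos : let Q := bc_form R HS_form *m S_act HS_rep idfun (0, 1) in
    forall x : 'cV[R]_(vdim V), x != 0 -> 0 < (x^T *m Q *m x) 0 0
}.

Definition End_HS (VZ : set V) (s : S_rep R (vdim V)) : set 'End(V) :=
  [set f : 'End(V) | (forall v, VZ v -> VZ (f v)) /\
     forall (A : comUnitRingType) (phi : {rmorphism R -> A}) z, Spoint z ->
       bc_end A f *m S_act s phi z = S_act s phi z *m bc_end A f].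

End Hodge.

Section Ladic.
Variables (l : nat) (l_prime : prime l).
Local Notation Ql := (Qadic l_prime).
Local Notation Zl := (Zadic l_prime).

Definition Zl_span (W : lmodType Ql) (X : set W) : set W :=
  [set w : W | exists k (c : 'I_k -> Zl) (x : 'I_k -> W),
     (forall i, X (x i)) /\ w = \sum_i Zadic_val (c i) *: x i].

Variable V : vectType rat.
Local Notation n := (vdim V).

(* V_Z (x) Z_l, as a submodule of V (x) Q_l *)
Definition lattice_l (VZ : set V) : set 'cV[Ql]_n :=
  Zl_span [set bc_vec Ql v | v in VZ].

Definition GL_lattice_l (VZ : set V) : set 'M[Ql]_n :=
  [set g : 'M_n | g \in unitmx /\
           [set g *m x | x in lattice_l VZ] = lattice_l VZ].

Definition End_rep_l (VZ : set V) (G : Type) (rho : G -> 'M[Ql]_n) :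
    set 'M[Ql]_n :=
  [set f : 'M[Ql]_n | (forall x, lattice_l VZ x -> lattice_l VZ (f *m x)) /\
           forall g, f *m rho g = rho g *m f].

End Ladic.

Arguments GL_lattice_l {l} l_prime {V} VZ _.

Record integral_structure (R : realType) (l : nat) (l_prime : prime l)
    (L Lbar : fieldType) (iota : {rmorphism L -> Lbar}) (V : vectType rat) :
    Type := MkIntegralStructure {
  ILS_lattice : set V;
  ILS_latticeP : is_lattice ILS_lattice;
  ILS_HS : polarised_HS R ILS_lattice;
  ILS_rho : absGal iota -> 'M[Qadic l_prime]_(vdim V);
  ILS_rho_GL : forall g, GL_lattice_l l_prime ILS_lattice (ILS_rho g);
  ILS_rho1 : ILS_rho 1%g = 1%:M;
  ILS_rhoM : forall g h, ILS_rho (g * h)%g = ILS_rho g *m ILS_rho h;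
  ILS_rho_continuous : continuous ILS_rho;
  ILS_compat :
    Zl_span [set bc_end (Qadic l_prime) f | f in End_HS ILS_lattice (HS_rep ILS_HS)]
      `<=` End_rep_l ILS_lattice ILS_rho
}.

Definition relatively_open (X : topologicalType) (U Y : set X) : Prop :=
  exists2 O : set X, open O & U = O `&` Y.

Section Conjugation.
Variables (F : fieldType) (n : nat).

Definition conj_set (a : 'M[F]_n) (U : set 'M[F]_n) : set 'M[F]_n :=
  [set a *m g *m invmx a | g in U].

Definition conj_orbit (G U : set 'M[F]_n) : set (set 'M[F]_n) :=
  [set conj_set a U | a in G].

Definition conjugates_in (G U : set 'M[F]_n) : set (set 'M[F]_n) :=
  [set H | (exists2 a, a \in unitmx & H = conj_set a U) /\ H `<=` G].

End Conjugation.

(* Main.v *)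
(* Idea. Conjugates [alpha U alpha^-1] inside GL(V_Zl) correspond to U-stable
   lattices [alpha^-1 V_Zl], and two lattices that differ by an element of the
   centralizer of U give the same orbit. So it suffices to bound the U-stable
   lattices modulo this centralizer, in the manner of Jordan and Zassenhaus.

   - Bound. Suppose [Ql[U]] has a separability idempotent [sum a_i (x) b_i].
     Among the translates by the centralizer that contain the standard lattice
     L0, choose a lattice L minimizing the valuation of the index. If [x]
     commutes with U and maps L0 into L, then so does [t - x] for every l-adic
     integer t, hence [det (t - x)] is an l-adic integer, and by interpolation
     the trace of x has a bounded denominator. Applied to
     [x = sum a_i (e (x) lambda) b_i], of trace [lambda e], this bounds every
     [e] in L.
   - Separability. A matrix X in the Lie algebra of M has exp(l^k X) in M(Ql),
     so in U for large k, and therefore X lies in Ql[U]. Let B be the algebra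
     of rational matrices that lie in Ql[U]. It contains Lie(M) and it is stable
     under the adjoint for the polarisation, as M consists of similitudes. Over
     the reals, B contains the Weil operator J, because [s(1 + t i)] solves a
     linear differential equation with coefficients in R[Lie(s)]. Hence B is
     stable under a positive involution, its regular trace form is
     nondegenerate, and the Casimir element of this form is the idempotent,
     already defined over Q.
   - A rational matrix that commutes with B commutes with Lie(s), hence with s,
     hence with M by minimality, hence with U. *)

Require Import Defs.
From HB Require Import structures.
From mathcomp Require Import all_boot all_order all_algebra all_field.
From mathcomp Require Import mpoly.
From mathcomp Require Import boolp classical_sets cardinality filter.
From mathcomp Require Import reals topology.
From mathcomp Require Import ring zify.
Import Order.TTheory GRing.Theory Num.Theory.
Import passmx.
Local Open Scope classical_set_scope.
Local Open Scope ring_scope.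

Set Implicit Arguments.
Unset Strict Implicit.
Unset Printing Implicit Defensive.

(** * The l-adic integers *)

Section ZadicTheory.
Variables (l : nat) (l_prime : prime l).
Local Notation Zl := (Zadic l_prime).
Local Notation lz n := (l%:Z ^+ n).

Lemma ZadicDE (x y : Zl) n : (x + y) n = ((x n + y n) %% lz n)%Z.
Proof. by []. Qed.

Lemma ZadicME (x y : Zl) n : (x * y) n = ((x n * y n) %% lz n)%Z.
Proof. by []. Qed.

Lemma Zadic_natE (m n : nat) : (m%:R : Zl) n = (m%:Z %% lz n)%Z.
Proof.
elim: m => [|m IHm]; first by [].
rewrite -natr1 /= IHm modzDm; congr (_ %% _)%Z.
by rewrite intS addrC.
Qed.

Lemma Zadic_natXE (k n : nat) : ((l%:R : Zl) ^+ k) n = (lz k %% lz n)%Z.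
Proof. by rewrite -natrX Zadic_natE; congr (_ %% _)%Z; rewrite -natz natrX natz. Qed.

Lemma lz_gt0 n : 0 < lz n.
Proof. by rewrite exprn_gt0// ltz_nat prime_gt0. Qed.

(** The residue of the quotient modulo [l^n] is that of [x] modulo [l^(n + N)], divided by [l^N];
    the division is exact because [x N = 0]. *)
Lemma Zadic_dvd (x : Zl) N : x N = 0 -> exists r : Zl, x = l%:R ^+ N * r.
Proof.
move=> xN0.
have xE n : exists q, x (n + N)%N = q * lz N.
  have : (x (n + N)%N = 0 %[mod lz N])%Z.
    by rewrite addnC Zadic_modz_add xN0.
  by rewrite mod0z => /dvdz_mod0P/dvdzP.
pose u n := (x (n + N)%N %/ lz N)%Z.
have uE n : x (n + N)%N = u n * lz N.
  by rewrite /u; have [q ->] := xE n; rewrite mulzK// gt_eqF// lz_gt0.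
have uP n : (u n.+1 = u n %[mod lz n])%Z.
  apply/eqP; rewrite eqz_mod_dvd -(@dvdz_mul2r (lz N)) ?gt_eqF ?lz_gt0//.
  rewrite mulrBl -!uE addSn -exprD -eqz_mod_dvd; apply/eqP; exact: Zadic_modzS.
exists (Zadic_of l_prime uP); apply: Zadic_eqP => n.
rewrite ZadicME Zadic_natXE modzMm mulrC -uE.
by rewrite Zadic_modz_add Zadic_modz.
Qed.

(** Completeness: [S n.+1] and [S n] differ by [l^n * c n], so the residues of the partial sums are
    coherent and define the limit. *)
Lemma Zadic_series (c : nat -> Zl) :
  exists s : Zl, forall N, exists r : Zl,
    s = \sum_(i < N) l%:R ^+ i * c i + l%:R ^+ N * r.
Proof.
pose S n := \sum_(i < n) l%:R ^+ i * c i.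
have S0 n : (S n.+1 : Zl) n = (S n : Zl) n.
  rewrite /S big_ord_recr -/(S n) ZadicDE ZadicME Zadic_natXE modzz mul0r mod0z.
  by rewrite addr0 Zadic_modz.
have Sco n : ((S n.+1 : Zl) n.+1 = (S n : Zl) n %[mod lz n])%Z.
  by rewrite Zadic_modzS S0.
exists (Zadic_of l_prime Sco) => N.
set s := Zadic_of _ _.
have /Zadic_dvd[r rE] : (s - S N) N = 0.
  by rewrite /= Zadic_modz modzDmr subrr mod0z.
by exists r; rewrite -rE addrC subrK.
Qed.

(** Bezout gives an inverse modulo every [l^n], and uniqueness of inverses makes these residues
    coherent. *)
Lemma Zadic_unit1 (x : Zl) : x 1%N != 0 -> x \is a GRing.unit.
Proof.
move=> x1.
have cop n : coprimez (x n) (lz n).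
  case: n => [|n]; first by rewrite expr0 coprimezE coprimen1.
  rewrite coprimezE abszX coprimeXr// coprime_sym prime_coprime//.
  apply: contra x1 => lx.
  apply/eqP; rewrite -Zadic_modz -(Zadic_modz_add x 1 n) expr1 add1n.
  exact/dvdz_mod0P.
have ex n : exists v, (x n * v = 1 %[mod lz n])%Z.
  have /coprimezP[[a b] /= ab] := cop n.
  exists a; apply/eqP; rewrite eqz_mod_dvd -ab.
  by rewrite mulrC opprD addrA subrr sub0r -mulNr dvdz_mull.
have [v vP] := choice ex.
have vco n : (v n.+1 = v n %[mod lz n])%Z.
  have e : (x n * v n.+1 = 1 %[mod lz n])%Z.
    rewrite -modzMml -[in LHS](Zadic_modzS x n) modzMml.
    by have := congr1 (fun z => (z %% lz n)%Z) (vP n.+1); rewrite /= !modz_expS.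
  rewrite -[in LHS](mulr1 (v n.+1)) -modzMmr -(vP n) modzMmr mulrA.
  by rewrite [v n.+1 * _]mulrC -modzMml e modzMml mul1r.
apply/unitrPr; exists (Zadic_of l_prime vco); apply: Zadic_eqP => n /=.
by rewrite modzMmr vP.
Qed.

Lemma Zadic_factor (x : Zl) : x != 0 ->
  exists k, exists2 u : Zl, u \is a GRing.unit & x = l%:R ^+ k * u.
Proof.
move=> /Zadic_neq0 ex.
have {}ex : exists n, x n != 0.
  by case: ex => n xn; exists n; apply: contra xn => /eqP ->; exact: dvdz0.
(* The first index with a nonzero residue has the form [k.+1], since the residue of index 0 is
   always zero; [k] is then the valuation. *)
have := ex_minnP ex; case=> [] [|k] xk kmin.
  by move: xk; rewrite -Zadic_modz expr0 modz1 eqxx.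
have /Zadic_dvd[u uE] : x k = 0.
  by apply: contraTeq (leqnn k.+1) => /kmin; rewrite -ltnNge.
exists k, u => //; apply: Zadic_unit1; apply: contra xk => /eqP/Zadic_dvd[r rE].
by rewrite uE rE mulrA -exprD addn1 ZadicME Zadic_natXE modzz mul0r mod0z.
Qed.

Lemma Zadic_nat_eq0 (m : nat) : ((m%:R : Zl) == 0) = (m == 0%N).
Proof.
apply/idP/idP => [/eqP m0|/eqP->]; last by rewrite eqxx.
have := congr1 (fun z : Zl => z m) m0.
rewrite /= Zadic_natE mod0z modz_small => [[->]//|].
by rewrite lez_nat leq0n /= -[l%:Z]natz -natrX natz ltz_nat ltn_expl ?prime_gt1.
Qed.

End ZadicTheory.

(** * The l-adic numbers *)

Section RatAlgebra.
Variables (A : comUnitRingType) (A_Q : is_Q_algebra A).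

Lemma Q_algebra_int_unit (d : int) : d != 0 -> (d%:~R : A) \is a GRing.unit.
Proof.
case: d => [[|d]|d] // _; first exact: A_Q.
by rewrite NegzE rmorphN unitrN; exact: A_Q.
Qed.

(** Any fraction [a / d] representing [x] determines [ratr x], so the morphism laws can be checked
    on unreduced fractions. *)
Lemma ratr_Q_algebraP (x : rat) (y : A) (a d : int) : d != 0 ->
  x * d%:~R = a%:~R -> y * d%:~R = a%:~R -> @ratr A x = y.
Proof.
move=> d0 xE yE.
have ud := Q_algebra_int_unit d0; have ux := Q_algebra_int_unit (denq_neq0 x).
have e : numq x * d = a * denq x.
  by apply: (@intr_inj rat); rewrite !rmorphM /= numqE -xE mulrAC.
apply: (mulIr ud); apply: (mulIr ux).
by rewrite yE mulrAC {1}/ratr divrK// -!rmorphM e.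
Qed.

(** A copy of [ratr] carrying the proof that [A] is a Q-algebra, so that a ring morphism structure
    can be attached to it. *)
Definition Qalg_in of is_Q_algebra A : rat -> A := @ratr A.
Local Notation f := (Qalg_in A_Q).

Lemma Qalg_in_denq x : f x * (denq x)%:~R = (numq x)%:~R.
Proof. by rewrite /Qalg_in /ratr divrK// Q_algebra_int_unit ?denq_neq0. Qed.

Lemma Qalg_in_is_zmod_morphism : zmod_morphism f.
Proof.
move=> x y; apply: (@ratr_Q_algebraP _ _
  (numq x * denq y - numq y * denq x) (denq x * denq y)).
- by rewrite mulf_neq0 ?denq_neq0.
- by rewrite rmorphB !rmorphM /= !numqE; ring.
- rewrite rmorphB !rmorphM /= -!Qalg_in_denq; ring.
Qed.

Lemma Qalg_in_is_monoid_morphism : monoid_morphism f.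
Proof.
split=> [|x y]; first by rewrite /Qalg_in (ratr_nat _ 1).
apply: (@ratr_Q_algebraP _ _ (numq x * numq y) (denq x * denq y)).
- by rewrite mulf_neq0 ?denq_neq0.
- by rewrite !rmorphM /= !numqE; ring.
- rewrite !rmorphM /= -!Qalg_in_denq; ring.
Qed.

HB.instance Definition _ := GRing.isZmodMorphism.Build rat A f
  Qalg_in_is_zmod_morphism.
HB.instance Definition _ := GRing.isMonoidMorphism.Build rat A f
  Qalg_in_is_monoid_morphism.

End RatAlgebra.

Lemma Q_algebra_morph (A B : comUnitRingType) (f : {rmorphism A -> B}) :
  is_Q_algebra A -> is_Q_algebra B.
Proof. by move=> A_Q k; rewrite -(rmorph_nat f) rmorph_unit. Qed.

Lemma Q_algebra_char0 (F : fieldType) :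
  (forall k, (k.+1%:R : F) != 0) -> is_Q_algebra F.
Proof. by move=> F0 k; rewrite unitfE. Qed.

Lemma morph_ratr (A B : comUnitRingType) (f : {rmorphism A -> B}) x :
  is_Q_algebra A -> f (@ratr A x) = @ratr B x.
Proof.
move=> A_Q; have B_Q := Q_algebra_morph f A_Q.
apply/esym/(ratr_Q_algebraP B_Q (denq_neq0 x) (esym (numqE x))).
by rewrite -(rmorph_int f) -rmorphM /= (Qalg_in_denq A_Q) rmorph_int.
Qed.

Lemma fraction_tofrac (D : idomainType) (x : {fraction D}) :
  exists a b : D, b != 0 /\ x = tofrac a / tofrac b.
Proof.
elim/quotW: x => r; exists \n_r, \d_r; split; first exact: denom_ratioP.
have d0 := denom_ratioP r.
apply: (canRL (mulfK _)); first by rewrite tofrac_eq0.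
unlock tofrac; rewrite -[LHS]FracField.pi_mul /FracField.mulf.
apply/eqmodP; rewrite /= FracField.equivfE.
by rewrite !numden_Ratio ?mulf_neq0 ?oner_neq0//; apply/eqP; ring.
Qed.

(** * The ring of integers of the l-adic numbers *)

Section QadicTheory.
Variables (l : nat) (l_prime : prime l).
Local Notation Zl := (Zadic l_prime).
Local Notation Ql := (Qadic l_prime).

HB.instance Definition _ := GRing.RMorphism.copy (@Zadic_val l l_prime)
  (@tofrac Zl).

Lemma Zadic_val_inj : injective (@Zadic_val l l_prime).
Proof. by move=> x y /eqP; rewrite /Zadic_val tofrac_eq => /eqP. Qed.

Definition Qint : {pred Ql} := fun x => `[< exists c : Zl, x = Zadic_val c >].

Lemma QintP x : reflect (exists c : Zl, x = Zadic_val c) (x \in Qint).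
Proof. exact: asboolP. Qed.

Lemma Qint_val c : Zadic_val c \in Qint.
Proof. by apply/QintP; exists c. Qed.

Lemma Qint_subring : subring_closed Qint.
Proof.
split=> [|_ _ /QintP[c ->] /QintP[d ->]|_ _ /QintP[c ->] /QintP[d ->]].
- by rewrite -(rmorph1 (@Zadic_val l l_prime)) Qint_val.
- by rewrite -rmorphB Qint_val.
- by rewrite -rmorphM Qint_val.
Qed.
HB.instance Definition _ := GRing.isSubringClosed.Build Ql Qint Qint_subring.

Lemma Zadic_val_eq0 c : (Zadic_val c == 0 :> Ql) = (c == 0).
Proof. exact: tofrac_eq0. Qed.

Lemma Qadic_nat_eq0 (m : nat) : ((m%:R : Ql) == 0) = (m == 0%N).
Proof.
by rewrite -(rmorph_nat (@Zadic_val l l_prime)) Zadic_val_eq0 Zadic_nat_eq0.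
Qed.

Lemma Qadic_Q_algebra : is_Q_algebra Ql.
Proof. by apply: Q_algebra_char0 => k; rewrite Qadic_nat_eq0. Qed.

Lemma Ql_l_neq0 : (l%:R : Ql) != 0.
Proof. by rewrite Qadic_nat_eq0 -lt0n prime_gt0. Qed.

Lemma Ql_lX_neq0 k : (l%:R : Ql) ^+ k != 0.
Proof. by rewrite expf_neq0 ?Ql_l_neq0. Qed.

Lemma Qint_lX k : (l%:R : Ql) ^+ k \in Qint.
Proof. by rewrite rpredX ?rpred_nat. Qed.

Lemma Qint_factor (x : Ql) : x \in Qint -> x != 0 ->
  exists k u, [/\ u \in Qint, u^-1 \in Qint, u != 0 & x = l%:R ^+ k * u].
Proof.
move=> /QintP[c ->]; rewrite Zadic_val_eq0 => /Zadic_factor[k [u uu ->]].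
exists k, (Zadic_val u); split; rewrite ?Qint_val//.
- by rewrite -rmorphV// Qint_val.
- by rewrite Zadic_val_eq0; apply: contraTneq uu => ->; rewrite unitr0.
- by rewrite rmorphM rmorphXn /= rmorph_nat.
Qed.

Lemma Qint_den (x : Ql) : exists k, l%:R ^+ k * x \in Qint.
Proof.
have [a [b [b0 ->]]] := fraction_tofrac x.
rewrite -[tofrac b]/(Zadic_val b).
have [|k [u [_ uV u0 ->]]] := Qint_factor (Qint_val b); first by rewrite Zadic_val_eq0.
exists k; rewrite invfM mulrCA mulVKf ?Ql_lX_neq0// mulrC rpredM//.
exact: Qint_val.
Qed.

Lemma Qint_lV k : (0 < k)%N -> (l%:R : Ql) ^- k \notin Qint.
Proof.
case: k => // k _; apply/QintP => -[c cE].
have : (l%:R : Zl) * (l%:R ^+ k * c) = 1.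
  apply: Zadic_val_inj; rewrite rmorph1 !rmorphM rmorphXn /= rmorph_nat mulrA -exprS.
  by rewrite -cE mulfV// Ql_lX_neq0.
move=> /(congr1 (fun z : Zl => z 1%N)); rewrite ZadicME Zadic_natE expr1 modzz.
by rewrite mul0r mod0z /= expr1 modz_small// ler01 /= ltz_nat prime_gt1.
Qed.

Lemma Qint_lX_cap0 (x : Ql) : (forall N, l%:R ^- N * x \in Qint) -> x = 0.
Proof.
move=> xN; apply: contra_notP (elimN idP (Qint_lV (ltn0Sn 0))) => /eqP x0.
have [|k [u [uI uV u0 xE]]] := Qint_factor _ x0.
  by have := xN 0%N; rewrite expr0 invr1 mul1r.
have := rpredM (xN k.+1) uV.
by rewrite xE exprS invfM -!mulrA mulKf ?Ql_lX_neq0// mulfV// mulr1 expr1.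
Qed.

(** An element of least valuation divides all the others. Applied to determinants, this selects a
    lattice of least index. *)
Lemma Qint_min_dvd (D : set Ql) : D !=set0 ->
  (forall x, D x -> x \in Qint /\ x != 0) ->
  exists2 d, D d & forall x, D x -> x / d \in Qint.
Proof.
move=> [x0 Dx0] DP.
pose v k := `[< exists2 x, D x & exists u, [/\ u \in Qint, u^-1 \in Qint,
  u != 0 & x = l%:R ^+ k * u] >].
have ex : exists k, v k.
  have [xI xn0] := DP _ Dx0; have [k uP] := Qint_factor xI xn0.
  by exists k; apply/asboolP; exists x0.
case: (ex_minnP ex) => k /asboolP[d Dd [u [uI uV u0 dE]]] kmin.
exists d => // x Dx; have [xI xn0] := DP _ Dx.
have [m [w [wI wV w0 xE]]] := Qint_factor xI xn0.
have km : (k <= m)%N by apply: kmin; apply/asboolP; exists x => //; exists w.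
rewrite xE dE invfM mulrACA rpredM//; last by rewrite rpredM.
by rewrite -(subnK km) exprD mulfK ?Ql_lX_neq0 ?Qint_lX.
Qed.

Lemma Qint_nat_factor (m : nat) : coprime l m -> (m%:R : Ql)^-1 \in Qint.
Proof.
move=> lm.
have mu : (m%:R : Zl) \is a GRing.unit.
  apply: Zadic_unit1; rewrite Zadic_natE expr1; apply/eqP => /dvdz_mod0P.
  by rewrite dvdzE /=; apply/negP; rewrite -prime_coprime.
by rewrite -(rmorph_nat (@Zadic_val l l_prime)) -rmorphV// Qint_val.
Qed.

Lemma logn_fact_le i : (logn l i`! <= i)%N.
Proof.
rewrite logn_fact//.
(* Legendre's sum is strengthened by its last quotient, which is at least twice the next one because
   [l >= 2]. *)
suff H K : (\sum_(1 <= k < K.+1) i %/ l ^ k + i %/ l ^ K <= i)%N.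
  by apply: leq_trans (H i); exact: leq_addr.
elim: K => [|K IHK]; first by rewrite big_geq// add0n expn0 divn1.
rewrite big_nat_recr//= -addnA; apply: leq_trans IHK; rewrite leq_add2l.
rewrite expnSr divnMA addnn -muln2.
apply: leq_trans (leq_trunc_div (i %/ l ^ K) l).
by rewrite leq_mul2l prime_gt1 ?orbT.
Qed.

(** This makes the coefficients of the exponential of [l * X] integral whenever [X] is. *)
Lemma Qint_lX_fact i : (l%:R : Ql) ^+ i / (i`!)%:R \in Qint.
Proof.
rewrite -(partnC l (fact_gt0 i)) p_part natrM natrX invfM mulrA rpredM//.
  by rewrite -{1}(subnK (logn_fact_le i)) exprD mulfK ?Ql_lX_neq0 ?Qint_lX.
by apply: Qint_nat_factor; rewrite prime_coprime// -p'natE// part_pnat.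
Qed.

Lemma Qint_series (c : nat -> Ql) : (forall i, c i \in Qint) ->
  exists2 s, s \in Qint & forall N,
    l%:R ^- N * (s - \sum_(i < N) l%:R ^+ i * c i) \in Qint.
Proof.
move=> cI; have [d dE] := choice (fun i => elimT (QintP (c i)) (cI i)).
have [s sE] := Zadic_series d.
exists (Zadic_val s); rewrite ?Qint_val// => N; have [r ->] := sE N.
rewrite rmorphD rmorph_sum /=.
under [X in _ + _ - X]eq_bigr do rewrite dE.
under eq_bigr do rewrite rmorphM rmorphXn /= rmorph_nat.
rewrite addrAC subrr add0r rmorphM rmorphXn /= rmorph_nat.
by rewrite mulKf ?Ql_lX_neq0// Qint_val.
Qed.

(** [r] reads the residue modulo [l^N]; the representative [z] takes the default value 0 outside
    [Qint], where nothing is claimed. *)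
Lemma Qint_residue N : exists (T : finType) (r : Ql -> T),
  forall x y, x \in Qint -> y \in Qint -> r x = r y -> l%:R ^- N * (x - y) \in Qint.
Proof.
pose z (x : Ql) : Zadic l_prime :=
  if pselect (exists c, x = Zadic_val c) is left ex then projT1 (cid ex) else 0.
have zE x : x \in Qint -> x = Zadic_val (z x).
  by move=> /QintP ex; rewrite /z; case: pselect => // ex'; exact: projT2 (cid ex').
exists 'I_(l ^ N).-1.+1, (fun x => inord `|z x N|%N) => x y xI yI rxy.
have zlt c : (`|Zadic_seq (z c) N| < (l ^ N).-1.+1)%N.
  rewrite prednK ?expn_gt0 ?prime_gt0// -ltz_nat gez0_abs.
    rewrite -[Posz (l ^ N)]natz natrX natz -(Zadic_modz (z c)) ltz_pmod//.
    exact: lz_gt0.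
  by rewrite -(Zadic_modz (z c)) modz_ge0// gt_eqF// lz_gt0.
have zge c : 0 <= Zadic_seq (z c) N.
  by rewrite -(Zadic_modz (z c)) modz_ge0// gt_eqF// lz_gt0.
have zxy : z x N = z y N.
  have := congr1 val rxy; rewrite /= !inordK// => /(congr1 Posz).
  by rewrite !gez0_abs.
have /Zadic_dvd[r rE] : (z x - z y) N = 0.
  by rewrite ZadicDE /= modzDmr zxy subrr mod0z.
rewrite (zE x)// (zE y)// -rmorphB rE rmorphM rmorphXn /= rmorph_nat.
by rewrite mulKf ?Ql_lX_neq0// Qint_val.
Qed.

End QadicTheory.
Arguments Qint {l l_prime}.

(** * Stable lattices modulo the centralizer *)

Lemma horner_char_poly (F : comNzRingType) n (A : 'M[F]_n) t :
  (char_poly A).[t] = \det (t%:M - A).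
Proof.
rewrite -[LHS]/(horner_eval t (char_poly A)) -det_map_mx; congr (\det _).
by apply/matrixP => i j; rewrite !mxE /= /horner_eval !hornerE hornerMn hornerX.
Qed.

Lemma invmx_mul (R : comUnitRingType) n (A B : 'M[R]_n) :
  A \in unitmx -> B \in unitmx -> invmx (A *m B) = invmx B *m invmx A.
Proof.
move=> Au Bu; have ABu : A *m B \in unitmx by rewrite unitmx_mul Au.
apply: (can_inj (mulKmx ABu)).
by rewrite mulmxV// -mulmxA (mulmxA B) mulmxV// mul1mx mulmxV.
Qed.

Lemma conj_setM (F : fieldType) n (A B : 'M[F]_n) U :
  A \in unitmx -> B \in unitmx ->
  conj_set A (conj_set B U) = conj_set (A *m B) U.
Proof.
move=> Au Bu; rewrite /conj_set image_comp; apply: eq_imagel => u _ /=.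
by rewrite invmx_mul// !mulmxA.
Qed.

Definition mx_span (F : fieldType) (m p : nat) (S : set 'M[F]_(m, p)) : set 'M[F]_(m, p) :=
  [set A | exists k (c : 'I_k -> F) (x : 'I_k -> 'M[F]_(m, p)),
     (forall i, S (x i)) /\ A = \sum_i c i *: x i].

Definition commutes_with (F : pzRingType) (m : nat) (S : set 'M[F]_m) (x : 'M[F]_m) :=
  forall u, S u -> x *m u = u *m x.

(** The properties of Zl inside Ql on which the lattice and exponential arguments rest: [lf_min_dvd]
    stands for the valuation, [lf_residue] for the finiteness of the residue rings, [lf_fact] and
    [lf_series] for the convergence of exponentials. *)
Record local_field (F : fieldType) (S : subringClosed F) (pi : F) : Prop :=
  LocalField {
  lf_nat : forall m : nat, ((m%:R : F) == 0) = (m == 0%N);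
  lf_pi_neq0 : pi != 0;
  lf_pi_int : pi \in S;
  lf_piV_int : forall k, (0 < k)%N -> pi ^- k \notin S;
  lf_den : forall x : F, exists k, pi ^+ k * x \in S;
  lf_cap0 : forall x : F, (forall N, pi ^- N * x \in S) -> x = 0;
  lf_min_dvd : forall D : set F, D !=set0 ->
    (forall x, D x -> x \in S /\ x != 0) ->
    exists2 d, D d & forall x, D x -> x / d \in S;
  lf_residue : forall N, exists (T : finType) (r : F -> T),
    forall x y, x \in S -> y \in S -> r x = r y -> pi ^- N * (x - y) \in S;
  lf_fact : forall i, pi ^+ i / i`!%:R \in S;
  lf_series : forall c : nat -> F, (forall i, c i \in S) ->
    exists2 s, s \in S & forall N, pi ^- N * (s - \sum_(i < N) pi ^+ i * c i) \in S
}.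

Section LocalField.
Variables (F : fieldType) (S : subringClosed F) (pi : F).
Hypothesis F_local : local_field S pi.

Let natF_neq0 := lf_nat F_local.
Let pi_neq0 := lf_pi_neq0 F_local.
Let pi_int := lf_pi_int F_local.
Let int_den := lf_den F_local.

Let piX_neq0 k : pi ^+ k != 0.
Proof. by rewrite expf_neq0. Qed.

Lemma int_den_le (x : F) k m : (k <= m)%N -> pi ^+ k * x \in S -> pi ^+ m * x \in S.
Proof. by move=> km xk; rewrite -(subnK km) exprD -mulrA rpredM ?rpredX. Qed.

Lemma int_den_fin (I : finType) (x : I -> F) : exists k, forall i, pi ^+ k * x i \in S.
Proof.
have [k kP] := choice (fun i => int_den (x i)).
by exists (\max_i k i)%N => i; apply: int_den_le (kP i); exact: leq_bigmax.
Qed.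

Lemma det_int n (A : 'M[F]_n) : A \is a mxOver S -> \det A \in S.
Proof.
move=> /mxOverP AI; rewrite /determinant rpred_sum// => s _.
by rewrite rpredM ?rpred_sign// rpred_prod.
Qed.

Lemma adj_int n (A : 'M[F]_n) : A \is a mxOver S -> \adj A \is a mxOver S.
Proof.
move=> /mxOverP AI; apply/mxOverP => i j; rewrite mxE rpredM ?rpred_sign//.
by apply: det_int; apply/mxOverP => p q; rewrite !mxE.
Qed.

(* Lagrange interpolation, with the denominators of the inverse Vandermonde matrix. *)
Lemma int_interpolation m : exists2 d : F, d != 0 &
  forall q : {poly F}, (size q <= m)%N ->
    (forall k : nat, q.[k%:R] \in S) -> forall i, d * q`_i \in S.
Proof.
pose V := Vandermonde m (\row_(j < m) (j%:R : F)).
have VI : V \is a mxOver S.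
  by apply/mxOverP => i j; rewrite !mxE rpredX ?rpred_nat.
exists (\det V).
  rewrite det_Vandermonde; apply/prodf_neq0 => i _; apply/prodf_neq0 => j ij.
  rewrite !mxE -natrB; last exact: ltnW.
  by rewrite natF_neq0 subn_eq0 -ltnNge.
move=> q sq qI i; have [im|mi] := ltnP i m; last first.
  by rewrite nth_default ?mulr0 ?rpred0// (leq_trans sq).
pose c := \row_(i < m) q`_i.
have cV : c *m V = \row_(j < m) q.[j%:R].
  apply/rowP => j; rewrite !mxE (horner_coef_wide _ sq).
  by apply: eq_bigr => p _; rewrite !mxE.
have := congr1 (fun A : 'rV_m => (A *m \adj V) 0 (Ordinal im)) cV.
rewrite /= -mulmxA mul_mx_adj mul_mx_scalar !mxE => ->.
rewrite rpred_sum// => p _; rewrite mxE rpredM//.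
by have /mxOverP := adj_int VI; apply.
Qed.

Lemma int_den_mx m n (A : 'M[F]_(m, n)) :
  exists k, pi ^+ k *: A \is a mxOver S.
Proof.
have [k kP] := int_den_fin (fun ij : 'I_m * 'I_n => A ij.1 ij.2).
by exists k; apply/mxOverP => i j; rewrite mxE; apply: (kP (i, j)).
Qed.

Lemma int_den_mx_fin (I : finType) m n (A : I -> 'M[F]_(m, n)) :
  exists k, forall i, pi ^+ k *: A i \is a mxOver S.
Proof.
have [k kP] := int_den_fin (fun ij : I * ('I_m * 'I_n) => A ij.1 ij.2.1 ij.2.2).
by exists k => p; apply/mxOverP => i j; rewrite mxE; apply: (kP (p, (i, j))).
Qed.

Variables (n : nat) (U : set 'M[F]_n).
Variables (I : finType) (a b : I -> 'M[F]_n).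
Hypothesis a_span : forall i, mx_span U (a i).
Hypothesis ba1 : \sum_i b i *m a i = 1%:M.
Hypothesis ab_comm : forall f, commutes_with U (\sum_i a i *m f *m b i).

(** [g] encodes the [U]-stable lattice [g^-1 S^n], and [g *m h] its translate by [h^-1]. The
    exponent [c] is independent of [g]: it adds up the denominators of the coefficients of the [a i]
    over [U] ([k1]), of the [b i] ([k2]) and of interpolation ([k3]). *)
Lemma stable_lattice_bound : exists c, forall g : 'M[F]_n, g \in unitmx ->
  (forall u, U u -> g *m u *m invmx g \is a mxOver S) ->
  exists h, [/\ h \in unitmx, commutes_with U h, g *m h \is a mxOver S
    & pi ^+ c *: invmx (g *m h) \is a mxOver S].
Proof.
have [k1 k1P] : exists k, forall g : 'M[F]_n,
    (forall u, U u -> g *m u *m invmx g \is a mxOver S) ->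
    forall i, pi ^+ k *: (g *m a i *m invmx g) \is a mxOver S.
  have ka i : exists k, forall g : 'M[F]_n,
    (forall u, U u -> g *m u *m invmx g \is a mxOver S) ->
    pi ^+ k *: (g *m a i *m invmx g) \is a mxOver S.
    have [m [c [u [uU ->]]]] := a_span i.
    have [k kP] := int_den_fin c; exists k => g gP.
    rewrite mulmx_sumr mulmx_suml scaler_sumr rpred_sum// => j _.
    by rewrite -scalemxAr -scalemxAl scalerA mxOverZ ?gP.
  have [k kP] := choice ka; exists (\max_i k i)%N => g gP i.
  apply/mxOverP => p q; rewrite mxE; apply: (@int_den_le _ (k i)).
    exact: leq_bigmax.
  by have /mxOverP/(_ p q) := kP i g gP; rewrite mxE.
have [k2 k2P] := int_den_mx_fin b.
have [d d0 dP] := int_interpolation n.+1.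
have [k3 k3P] := int_den d^-1.
exists (k3 + (k1 + k2))%N => g gu gU.
pose C h := [/\ h \in unitmx, commutes_with U h & g *m h \is a mxOver S].
(* Among the translates containing [S^n], take one whose determinant divides all the others, that
   is, whose index has least valuation. *)
have [||dh [h [hu hU hI] hE] hmin] :=
    @lf_min_dvd _ _ _ F_local [set \det (g *m h) | h in [set h | C h]].
- have [k kP] := int_den_mx g; pose h := (pi ^+ k : F)%:M : 'M[F]_n.
  suff Ch : C h by exists (\det (g *m h)); exists h.
  split; last by rewrite mul_mx_scalar.
    by rewrite unitmxE det_scalar unitfE expf_neq0// piX_neq0.
  by move=> u _; rewrite scalar_mxC.
- move=> _ [h [hu _ hI] <-]; split; first exact: det_int.
  by rewrite -unitfE -unitmxE unitmx_mul gu.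
rewrite -{dh}hE in hmin.
exists h; split=> //; set e := g *m h in hI hmin *.
have eu : e \in unitmx by rewrite unitmx_mul gu.
have eU u : U u -> e *m u *m invmx e = g *m u *m invmx g.
  move=> Uu; rewrite -[RHS](mulmxK eu); congr (_ *m invmx e).
  by rewrite /e -!mulmxA hU// !mulmxA mulmxKV.
have eP := k1P e (fun u Uu => etrans (congr1 (fun x => x \is a mxOver S) (eU u Uu)) (gU u Uu)).
(* If [x] is invertible then [h *m x] is another candidate, and minimality makes
   [det (e x) / det e = det x] integral. *)
have det_x x : commutes_with U x -> e *m x \is a mxOver S -> \det x \in S.
  move=> xU xI; have [->|x0] := eqVneq (\det x) 0; first exact: rpred0.
  suff : \det (e *m x) / \det e \in S.
    by rewrite det_mulmx mulrC mulKf// -unitfE -unitmxE.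
  apply: hmin; exists (h *m x); last by rewrite mulmxA.
  split; [by rewrite unitmx_mul hu unitmxE unitfE| |by rewrite mulmxA].
  by move=> u Uu; rewrite -mulmxA xU// !mulmxA hU.
apply/mxOverP => j p; rewrite mxE.
(* A rank one matrix whose trace is the entry of [e^-1] to be bounded. Averaging it with the [a i]
   and [b i] gives an [x] that commutes with [U] and has the same trace up to the factor
   [pi^(k1 + k2)], which makes [e *m x] integral. *)
pose f := invmx e *m delta_mx p j.
pose x := pi ^+ (k1 + k2) *: \sum_i a i *m f *m b i.
have xU : commutes_with U x.
  by move=> u Uu; rewrite /x -scalemxAl -scalemxAr ab_comm.
have xI : e *m x \is a mxOver S.
  rewrite /x -scalemxAr mulmx_sumr scaler_sumr rpred_sum// => i _.
  have -> : pi ^+ (k1 + k2) *: (e *m (a i *m f *m b i)) =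
      (pi ^+ k1 *: (e *m a i *m invmx e)) *m delta_mx p j *m (pi ^+ k2 *: b i).
    by rewrite exprD -scalerA -!scalemxAl -scalemxAr /f !mulmxA.
  rewrite mxOverM// mxOverM//; apply/mxOverP => p' q'.
  by rewrite mxE rpred_nat.
have trx : \tr x = pi ^+ (k1 + k2) * invmx e j p.
  rewrite /x linearZ /= raddf_sum /=; congr (_ * _).
  under eq_bigr do rewrite -mulmxA mxtrace_mulC -mulmxA mxtrace_mulC.
  rewrite -raddf_sum /= -mulmx_suml ba1 mul1mx /f mxtrace_mulC.
  rewrite /mxtrace (bigD1 p)//= mxE (bigD1 j)//= !mxE !eqxx mul1r.
  rewrite big1 ?addr0; last by move=> i ij; rewrite mxE (negPf ij) andbF mul0r.
  rewrite big1 ?addr0// => i ip; rewrite mxE big1// => i' _.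
  by rewrite mxE (negPf ip) mul0r.
have n0 : (0 < n)%N by apply: leq_trans (ltn_ord j).
(* The matrices [t - x], for natural [t], satisfy the same hypotheses as [x], so the characteristic
   polynomial has integral values there. Interpolation bounds its coefficient of degree [n.-1],
   which is minus the trace. *)
have := dP (char_poly x).
rewrite size_char_poly => /(_ (leqnn _)) q.
have {}q := q _ n.-1; rewrite char_poly_trace// in q.
rewrite exprD -mulrA -trx -[\tr x](mulKf d0) mulrA rpredM//.
rewrite -rpredN -mulrN; apply: q => t.
rewrite horner_char_poly; apply: det_x.
  by move=> u Uu; rewrite mulmxBl mulmxBr xU// scalar_mxC.
by rewrite mulmxBr rpredB// mul_mx_scalar mxOverZ ?rpred_nat.
Qed.

Variable P : 'M[F]_n.
Hypothesis P_unit : P \in unitmx.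

(* The stabilizer of the lattice [P S^n]. *)
Definition GL_stab : set 'M[F]_n := [set g | [/\ g \in unitmx,
  invmx P *m g *m P \is a mxOver S & invmx P *m invmx g *m P \is a mxOver S]].

(** By the bound, every orbit is given by some [e] with [e] and [pi^c e^-1] integral. If two such
    matrices agree modulo [pi^(c+1)], their quotients are integral, so they give the same orbit; and
    there are finitely many residues. *)
Lemma conjugates_finite :
  exists F : set (set 'M[F]_n),
    [/\ finite_set F, F `<=` conjugates_in GL_stab U &
        conjugates_in GL_stab U = \bigcup_(H in F) conj_orbit GL_stab H].
Proof.
have [c cP] := stable_lattice_bound.
have [T [r rP]] := lf_residue F_local c.+1.
pose good (e : 'M[F]_n) := [/\ e \in unitmx, e \is a mxOver S,
  pi ^+ c *: invmx e \is a mxOver S & conjugates_in GL_stab U (conj_set (P *m e) U)].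
pose res (e : 'M[F]_n) := [ffun ij : 'I_n * 'I_n => r (e ij.1 ij.2)].
(* One good matrix is chosen for each table of residues that occurs; the other tables receive the
   dummy value 0. *)
have [rep repP] : exists rep : {ffun 'I_n * 'I_n -> T} -> 'M[F]_n,
    forall e, good e -> good (rep (res e)) /\ res (rep (res e)) = res e.
  have ex t : exists e', forall e, good e -> res e = t -> good e' /\ res e' = t.
    have [[e [eg et]]|ne] := pselect (exists e, good e /\ res e = t).
      by exists e.
    by exists 0 => e eg et; case: ne; exists e.
  have [rep repP] := choice ex; exists rep => e eg; exact: (repP _ e eg erefl).
have K1 e e' : good e -> good e' -> res e = res e' -> e' *m invmx e \is a mxOver S.
  move=> [eu eI eV _] [eu' eI' _ _] rr.
  have -> : e' *m invmx e = 1%:M + pi *: (pi ^- c.+1 *: (e' - e)) *m (pi ^+ c *: invmx e).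
    rewrite -scalemxAl -scalemxAr -scalemxAl !scalerA ?mulrA -exprS mulfV ?piX_neq0//.
    by rewrite scale1r mulmxBl mulmxV// addrC subrK.
  apply: rpredD; first by rewrite mxOver_scalar ?rpred0 ?rpred1.
  rewrite mxOverM// mxOverZ//.
  apply/mxOverP => i j; rewrite !mxE rP ?(mxOverP _)//.
  by have /ffunP/(_ (i, j)) := rr; rewrite !ffunE.
exists [set conj_set (P *m rep t) U | t in [set t | good (rep t)]]; split.
- exact/finite_image/finite_finset.
- by move=> _ [t [_ _ _ tT] <-].
apply/seteqP; split=> [H [[alpha au HE] HG]|H].
  pose g := invmx P *m alpha.
  have gu : g \in unitmx by rewrite unitmx_mul unitmx_inv P_unit.
  have gV : invmx g = invmx alpha *m P.
    by rewrite /g invmx_mul ?unitmx_inv// invmxK.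
  have [u Uu|h [hu hU hI hV]] := cP g gu.
    have : H (alpha *m u *m invmx alpha) by rewrite HE; exists u.
    by move=> /HG[_ + _]; rewrite gV /g !mulmxA.
  pose e := g *m h.
  have eu : e \in unitmx by rewrite unitmx_mul gu.
  (* [P *m e] equals [alpha *m h], and [h] commutes with [U], so the conjugate is unchanged. *)
  have HE' : H = conj_set (P *m e) U.
    rewrite HE; apply: eq_imagel => u Uu.
    rewrite /e /g !mulmxA mulmxV// mul1mx.
    have -> : invmx (alpha *m h) = invmx h *m invmx alpha by rewrite invmx_mul.
    by rewrite !mulmxA -(mulmxA alpha h) hU// !mulmxA mulmxK.
  have eg : good e.
    by split=> //; rewrite -HE'; split=> //; exists alpha.
  have [rg rr] := repP e eg; set e' := rep (res e) in rg rr.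
  have [e'u _ _ _] := rg.
  exists (conj_set (P *m e') U); first by exists (res e).
  exists (P *m e *m invmx (P *m e')).
    have E : invmx (P *m e') = invmx e' *m invmx P by rewrite invmx_mul.
    have E' : invmx (P *m e *m invmx (P *m e')) = P *m e' *m (invmx e *m invmx P).
      rewrite invmx_mul ?unitmx_inv ?[P *m _ \in _]unitmx_mul ?P_unit//.
      by rewrite invmxK invmx_mul.
    have Peu : P *m e \in unitmx by rewrite unitmx_mul P_unit.
    have Pe'u : P *m e' \in unitmx by rewrite unitmx_mul P_unit.
    split; first by rewrite unitmx_mul unitmx_inv Peu.
    - rewrite E !mulmxA mulVmx// mul1mx -mulmxA mulVmx// mulmx1.
      by apply: K1.
    - rewrite E' !mulmxA mulVmx// mul1mx -mulmxA mulVmx// mulmx1.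
      by apply: K1.
  have Peu : P *m e \in unitmx by rewrite unitmx_mul P_unit.
  have Pe'u : P *m e' \in unitmx by rewrite unitmx_mul P_unit.
  by rewrite HE' conj_setM ?mulmxKV// unitmx_mul unitmx_inv Peu.
move=> [_ [t [tu _ _ [_ tT]] <-] [g [gu gI gV] <-]]; split.
  by exists (g *m (P *m rep t)); rewrite ?conj_setM ?unitmx_mul ?gu ?P_unit.
move=> _ [x /tT[xu xI xV] <-]; split; first by rewrite !unitmx_mul gu xu unitmx_inv.
- have -> : invmx P *m (g *m x *m invmx g) *m P =
    (invmx P *m g *m P) *m (invmx P *m x *m P) *m (invmx P *m invmx g *m P).
    by rewrite !mulmxA !mulmxK.
  by apply: mxOverM gV; apply: mxOverM gI _.
- have -> : invmx P *m invmx (g *m x *m invmx g) *m P =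
    (invmx P *m g *m P) *m (invmx P *m invmx x *m P) *m (invmx P *m invmx g *m P).
    rewrite !invmx_mul ?unitmx_mul ?gu ?xu ?unitmx_inv// invmxK.
    by rewrite !mulmxA !mulmxK.
  by apply: mxOverM gV; apply: mxOverM gI _.
Qed.
End LocalField.
Lemma Qadic_local_field l (l_prime : prime l) :
  @local_field (Qadic l_prime) (@Qint l l_prime) l%:R.
Proof.
split.
- exact: Qadic_nat_eq0.
- exact: Ql_l_neq0.
- exact: (Qint_lX l_prime 1).
- exact: Qint_lV.
- exact: Qint_den.
- exact: Qint_lX_cap0.
- exact: Qint_min_dvd.
- exact: Qint_residue.
- exact: Qint_lX_fact.
- exact: Qint_series.
Qed.

(** * Dual numbers *)

Section DualNumbers.
Variable A : comUnitRingType.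

Record dual : Type := Dual { dual_val : A; dual_eps : A }.

HB.instance Definition _ := gen_eqMixin dual.
HB.instance Definition _ := gen_choiceMixin dual.

Lemma dual_eq (x y : dual) :
  dual_val x = dual_val y -> dual_eps x = dual_eps y -> x = y.
Proof. by case: x y => [a b] [c d] /= -> ->. Qed.

Definition dual_zero := Dual 0 0.
Definition dual_one := Dual 1 0.
Definition dual_opp x := Dual (- dual_val x) (- dual_eps x).
Definition dual_add x y :=
  Dual (dual_val x + dual_val y) (dual_eps x + dual_eps y).
Definition dual_mul x y := Dual (dual_val x * dual_val y)
  (dual_val x * dual_eps y + dual_eps x * dual_val y).

Lemma dual_addA : associative dual_add.
Proof. by move=> x y z; apply: dual_eq => /=; ring. Qed.
Lemma dual_addC : commutative dual_add.
Proof. by move=> x y; apply: dual_eq => /=; ring. Qed.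
Lemma dual_add0 : left_id dual_zero dual_add.
Proof. by move=> x; apply: dual_eq => /=; ring. Qed.
Lemma dual_addN : left_inverse dual_zero dual_opp dual_add.
Proof. by move=> x; apply: dual_eq => /=; ring. Qed.
HB.instance Definition _ := GRing.isZmodule.Build dual
  dual_addA dual_addC dual_add0 dual_addN.

Lemma dual_mulA : associative dual_mul.
Proof. by move=> x y z; apply: dual_eq => /=; ring. Qed.
Lemma dual_mulC : commutative dual_mul.
Proof. by move=> x y; apply: dual_eq => /=; ring. Qed.
Lemma dual_mul1 : left_id dual_one dual_mul.
Proof. by move=> x; apply: dual_eq => /=; ring. Qed.
Lemma dual_mulD : left_distributive dual_mul dual_add.
Proof. by move=> x y z; apply: dual_eq => /=; ring. Qed.
Lemma dual_one_neq0 : dual_one != dual_zero.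
Proof. by apply/eqP => /(congr1 dual_val)/eqP; rewrite oner_eq0. Qed.
HB.instance Definition _ := GRing.Zmodule_isComNzRing.Build dual
  dual_mulA dual_mulC dual_mul1 dual_mulD dual_one_neq0.

Definition dual_unit : {pred dual} := fun x => dual_val x \is a GRing.unit.
Definition dual_inv (x : dual) : dual :=
  if dual_val x \is a GRing.unit
  then Dual (dual_val x)^-1 (- dual_eps x * dual_val x ^- 2) else x.

Lemma dual_mulVx : {in dual_unit, left_inverse 1 dual_inv *%R}.
Proof.
move=> [x y]; rewrite unfold_in /dual_unit /= => ux.
rewrite /dual_inv /= ux; apply: dual_eq => /=; first exact: mulVr.
by rewrite -exprVn expr2 !mulNr -!mulrA mulVr// mulr1 [x^-1 * y]mulrC subrr.
Qed.
Lemma dual_unitPl (x y : dual) : y * x = 1 -> dual_unit x.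
Proof.
by move=> /(congr1 dual_val) /= yx; apply/unitrPr; exists (dual_val y); rewrite mulrC.
Qed.
Lemma dual_inv_out : {in [predC dual_unit], dual_inv =1 id}.
Proof. by move=> x; rewrite inE /= /dual_inv => /negPf; rewrite unfold_in => ->. Qed.
HB.instance Definition _ := GRing.ComNzRing_hasMulInverse.Build dual
  dual_mulVx dual_unitPl dual_inv_out.

Definition dual_in (x : A) : dual := Dual x 0.

Lemma dual_in_zmod_morphism : zmod_morphism dual_in.
Proof. by move=> x y; apply: dual_eq => /=; ring. Qed.
Lemma dual_in_monoid_morphism : monoid_morphism dual_in.
Proof. by split=> // x y; apply: dual_eq => /=; ring. Qed.
HB.instance Definition _ := GRing.isZmodMorphism.Build A dual dual_in
  dual_in_zmod_morphism.
HB.instance Definition _ := GRing.isMonoidMorphism.Build A dual dual_in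
  dual_in_monoid_morphism.

Lemma dualM a b c d : Dual a b * Dual c d = Dual (a * c) (a * d + b * c).
Proof. by []. Qed.

Lemma dualD a b c d : Dual a b + Dual c d = Dual (a + c) (b + d).
Proof. by []. Qed.

Lemma dual_unitE (x : dual) : (x \is a GRing.unit) = (dual_val x \is a GRing.unit).
Proof. by []. Qed.

Lemma dualX (a b : A) k : Dual a b ^+ k = Dual (a ^+ k) (b * a ^+ k.-1 *+ k).
Proof.
elim: k => [|k IHk]; first by rewrite !expr0 mulr0n.
rewrite exprS IHk dualM exprS; congr Dual.
case: k {IHk} => [|k] /=; first by rewrite mulr0n mulr0 add0r mulr1n.
by rewrite [a * _]mulrC mulrnAl -mulrA -exprSr -mulrSr.
Qed.

Lemma horner_dual (p : {poly A}) (a b : A) :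
  (map_poly dual_in p).[Dual a b] = Dual p.[a] (b * p^`().[a]).
Proof.
elim/poly_ind: p => [|p c IHp].
  by rewrite rmorph0 deriv0 !horner0 mulr0.
rewrite derivD derivM derivX mulr1 derivC addr0 rmorphD rmorphM /= map_polyX map_polyC /=.
by rewrite !hornerE IHp dualM dualD; congr Dual; ring.
Qed.

Lemma sum_dual I (r : seq I) (P : pred I) (f g : I -> A) :
  \sum_(i <- r | P i) Dual (f i) (g i) =
  Dual (\sum_(i <- r | P i) f i) (\sum_(i <- r | P i) g i).
Proof. by elim/big_rec3: _ => // i x y z _ ->. Qed.

Definition dual_mx m n (X Y : 'M[A]_(m, n)) : 'M[dual]_(m, n) :=
  \matrix_(i, j) Dual (X i j) (Y i j).

Lemma dual_mx_in m n (X : 'M[A]_(m, n)) : map_mx dual_in X = dual_mx X 0.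
Proof. by apply/matrixP => i j; rewrite !mxE. Qed.

Lemma dual_mxM m n p (X Y : 'M[A]_(m, n)) (X' Y' : 'M[A]_(n, p)) :
  dual_mx X Y *m dual_mx X' Y' = dual_mx (X *m X') (X *m Y' + Y *m X').
Proof.
apply/matrixP => i j; rewrite !mxE -big_split -sum_dual; apply: eq_bigr => k _.
by rewrite !mxE.
Qed.

Lemma dual_mx1 n : dual_mx (1%:M : 'M_n) 0 = 1%:M.
Proof. by rewrite -dual_mx_in map_mx1. Qed.

Lemma dual_mx_inj m n (X Y X' Y' : 'M[A]_(m, n)) :
  dual_mx X Y = dual_mx X' Y' -> X = X' /\ Y = Y'.
Proof.
move=> /matrixP e; split; apply/matrixP => i j; have := e i j; rewrite !mxE;
  by case.
Qed.

Lemma dual_mx_unit n (X : 'M[A]_n) : dual_mx 1%:M X \in unitmx.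
Proof.
suff /mulmx1_unit[] : dual_mx 1%:M X *m dual_mx 1%:M (- X) = 1%:M by [].
by rewrite dual_mxM !mul1mx mulmx1 addNr dual_mx1.
Qed.

End DualNumbers.

(** * Evaluation of polynomials and first-order Taylor expansion *)

Lemma mpoly_ring_ind n (R : nzRingType) (K : {mpoly R[n]} -> Prop) :
  (forall c, K c%:MP) -> (forall i, K 'X_i) ->
  (forall p q, K p -> K q -> K (p + q)) -> (forall p q, K p -> K q -> K (p * q)) ->
  forall p, K p.
Proof.
move=> KC KX KD KM.
have K1 : K 1 by rewrite -mpolyC1.
elim/mpolyind => [|c m p _ _ Kp]; first by rewrite -mpolyC0.
apply: KD Kp; rewrite -mul_mpolyC; apply: (KM) => //; rewrite mpolyXE_id.
apply: (big_ind K) => // i _; elim: (m i) => [|k IHk]; first by rewrite expr0.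
by rewrite exprS; apply: KM.
Qed.

Lemma mmap_ratr_morph n (A B : comUnitRingType) (f : {rmorphism A -> B})
    (h : 'I_n -> A) P : is_Q_algebra A ->
  f (mmap ratr h P) = mmap ratr (f \o h) P.
Proof.
move=> A_Q; rewrite /mmap rmorph_sum; apply: eq_bigr => m _.
rewrite rmorphM /= morph_ratr//; congr (_ * _).
by rewrite /mmap1 rmorph_prod; apply: eq_bigr => i _; rewrite rmorphXn.
Qed.

Section Taylor.
Variables (A : comUnitRingType) (A_Q : is_Q_algebra A) (n : nat).

Lemma dual_Q_algebra : is_Q_algebra (dual A).
Proof. exact: Q_algebra_morph (@dual_in A) A_Q. Qed.

(** Both sides are compatible with sums and, by the Leibniz rule, with products, so constants and
    variables suffice. *)
Lemma mmap_dual (v w : 'I_n -> A) (P : {mpoly rat[n]}) :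
  mmap ratr (fun k => Dual (v k) (w k)) P =
  Dual (mmap ratr v P) (\sum_k w k * mmap ratr v P^`M(k)).
Proof.
pose F := mmap (Qalg_in dual_Q_algebra) (fun k => Dual (v k) (w k)).
pose G := mmap (Qalg_in A_Q) v.
have [FD FM] : {morph F : p q / p + q} /\ {morph F : p q / p * q}.
  by split=> p q; rewrite /F (rmorphD, rmorphM).
have [GD GM] : {morph G : p q / p + q} /\ {morph G : p q / p * q}.
  by split=> p q; rewrite /G (rmorphD, rmorphM).
rewrite -[LHS]/(F P) -[mmap ratr v P]/(G P).
under eq_bigr do rewrite -[mmap ratr v _]/(G _).
elim/mpoly_ring_ind: P => [c|i|p q IHp IHq|p q IHp IHq].
- rewrite /F /G !mmapC big1 => [|k _]; last by rewrite mderivC rmorph0 mulr0.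
  by rewrite -[LHS](morph_ratr (@dual_in A)).
- rewrite /F /G !mmapX !mmap1U (bigD1 i)//= mderivX mnm1E eqxx scale1r.
  rewrite big1 => [|k ki]; last first.
    by rewrite mderivX mnm1E eq_sym (negPf ki) scale0r rmorph0 mulr0.
  have -> : (U_(i) - U_(i) = 0)%MM.
    by apply/mnmP => k; rewrite mnmBE subnn mnm0E.
  by rewrite mpolyX0 rmorph1 mulr1 addr0.
- rewrite FD GD IHp IHq dualD; congr Dual.
  by rewrite -big_split; apply: eq_bigr => k _; rewrite mderivD GD mulrDr.
- rewrite FM GM IHp IHq dualM; congr Dual.
  rewrite mulr_sumr mulr_suml -big_split; apply: eq_bigr => k _.
  by rewrite /= mderivM GD !GM; ring.
Qed.

End Taylor.

(** * Formal exponentials in an algebraic group *)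

Lemma mxvec_dual_mx (A : comUnitRingType) m n (X Y : 'M[A]_(m, n)) k :
  mxvec (dual_mx X Y) 0 k = Dual (mxvec X 0 k) (mxvec Y 0 k).
Proof. by case/mxvec_indexP: k => i j; rewrite !mxvecE mxE. Qed.

Lemma mxvec_map (A B : Type) (f : A -> B) m n (X : 'M[A]_(m, n)) k :
  mxvec (map_mx f X) 0 k = f (mxvec X 0 k).
Proof. by case/mxvec_indexP: k => i j; rewrite !mxvecE mxE. Qed.

Section LieAlgebra.
Variables (n : nat) (M : Q_subgroup n).

(** The tangent space at the identity: the common kernel of the differentials of the equations of
    [M]. *)
Definition Lie (A : comUnitRingType) : set 'M[A]_n :=
  [set X | forall P, Q_subgroup_eqs M P ->
     \sum_k mxvec X 0 k *
       mmap ratr (fun k => mxvec (1%:M : 'M[A]_n) 0 k) P^`M(k) = 0].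

Lemma pts_morph (A B : comUnitRingType) (f : {rmorphism A -> B}) g :
  is_Q_algebra A -> Q_subgroup_pts M A g -> Q_subgroup_pts M B (map_mx f g).
Proof.
move=> A_Q [gu gP]; split=> [|P EP].
  by rewrite unitmxE det_map_mx rmorph_unit// -unitmxE.
rewrite -(rmorph0 f) -(gP P EP) mmap_ratr_morph//; congr mmap.
by apply: funext => k; rewrite mxvec_map.
Qed.

Lemma Lie_morph (A B : comUnitRingType) (f : {rmorphism A -> B}) X :
  is_Q_algebra A -> @Lie A X -> @Lie B (map_mx f X).
Proof.
move=> A_Q XL P EP; rewrite -[RHS](rmorph0 f) -(XL P EP) rmorph_sum.
apply: eq_bigr => k _; rewrite rmorphM mmap_ratr_morph//= mxvec_map.
congr (_ * mmap _ _ _); apply: funext => k' /=.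
by rewrite -(mxvec_map f) map_mx1.
Qed.

Lemma Lie_dualP (A : comUnitRingType) X : is_Q_algebra A ->
  @Lie A X <-> Q_subgroup_pts M (dual A) (dual_mx 1%:M X).
Proof.
move=> A_Q.
have E P : mmap ratr (fun k => mxvec (dual_mx 1%:M X) 0 k) P =
  Dual (mmap ratr (fun k => mxvec (1%:M : 'M[A]_n) 0 k) P)
   (\sum_k mxvec X 0 k * mmap ratr (fun k => mxvec (1%:M : 'M[A]_n) 0 k) P^`M(k)).
  rewrite -mmap_dual//; congr mmap; apply: funext => k; exact: mxvec_dual_mx.
split=> [XL|[_ XP] P EP].
  split=> [|P EP]; first exact: dual_mx_unit.
  by rewrite E XL//; have [_ ->] := Q_subgroup1 M A_Q.
by have := congr1 (@dual_eps A) (XP P EP); rewrite E.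
Qed.

End LieAlgebra.

(* [tau N] is a sum of [N] independent infinitesimals of square zero scaled by
   [a]; in characteristic zero it generates F[t]/(t^(N+1)), and the product
   [texp N] of the [1 + eps_i Y] is the truncated exponential of [tau N / a * Y].
   In this way M(F[t]/(t^(N+1))) is reached from the Lie algebra by products. *)
Section IteratedDualNumbers.
Variables (F : fieldType) (F_Q : is_Q_algebra F) (a : F) (a_neq0 : a != 0).

Fixpoint iterdual (N : nat) : comUnitRingType :=
  if N is N'.+1 then dual (iterdual N') else F.

Fixpoint iterdual_in (N : nat) : {rmorphism F -> iterdual N} :=
  if N is N'.+1 return {rmorphism F -> iterdual N}
  then (@dual_in (iterdual N') \o iterdual_in N' : {rmorphism F -> dual _})
  else idfun.

Fixpoint tau (N : nat) : iterdual N :=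
  if N is N'.+1 return iterdual N
  then Dual (tau N') (iterdual_in N' a) else 0.

Lemma iterdual_Q_algebra N : is_Q_algebra (iterdual N).
Proof. exact: Q_algebra_morph (iterdual_in N) F_Q. Qed.

Lemma tau_nilpotent N : tau N ^+ N.+1 = 0.
Proof.
elim: N => [|N IHN]; first by rewrite expr1.
by rewrite [LHS]dualX /= exprS IHN mulr0 mulr0 mul0rn.
Qed.

(** The infinitesimal part of [p] at [tau N.+1] is [a] times the value of its derivative at [tau N].
    Induction therefore applies to the derivative, and characteristic zero recovers the coefficients
    of [p]. *)
Lemma horner_tau_eq0 N (p : {poly F}) :
  (map_poly (iterdual_in N) p).[tau N] = 0 -> forall i, (i <= N)%N -> p`_i = 0.
Proof.
elim: N p => [|N IHN] p.
  by rewrite /= map_poly_id// horner_coef0 => p0 i; rewrite leqn0 => /eqP->.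
rewrite /= map_poly_comp horner_dual => /[dup] /(congr1 (@dual_val _)) /= p0.
move=> /(congr1 (@dual_eps _)) /= p1.
have {}p1 : (map_poly (iterdual_in N) p^`()).[tau N] = 0.
  have ua : iterdual_in N a \is a GRing.unit by rewrite rmorph_unit// unitfE.
  by apply: (mulrI ua); rewrite mulr0 -[RHS]p1 deriv_map.
case=> [|i] iN; first exact: IHN p0 _ _.
have := IHN _ p1 i iN; rewrite coef_deriv => /eqP; rewrite -mulr_natr mulf_eq0.
by move=> /orP[/eqP//|]; have := F_Q i; rewrite unitfE => /negPf->.
Qed.

Lemma horner_tau N (p : {poly F}) : (map_poly (iterdual_in N) p).[tau N] =
  \sum_(i < N.+1) iterdual_in N p`_i * tau N ^+ i.
Proof.
rewrite -[in LHS](poly_take_drop N.+1 p) rmorphD rmorphM /= map_polyXn.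
rewrite hornerD hornerM hornerXn tau_nilpotent mulr0 addr0.
rewrite (@horner_coef_wide _ N.+1); last first.
  by rewrite (leq_trans (size_poly _ _))// size_take_poly.
by apply: eq_bigr => i _; rewrite coef_map coef_take_poly ltn_ord.
Qed.

Variables (n : nat) (M : Q_subgroup n) (Y : 'M[F]_n).
Hypothesis Y_Lie : @Lie n M F Y.

(** Coefficient of [t^i] in the exponential of [(t / a) Y]; its sum at [t = a] is the exponential of
    [Y]. *)
Definition exp_coef (i : nat) : 'M[F]_n := (a ^+ i * i`!%:R)^-1 *: Y ^+ i.

Fixpoint texp (N : nat) : 'M[iterdual N]_n :=
  if N is N'.+1 return 'M[iterdual N]_n
  then map_mx (@dual_in _) (texp N') *m
       dual_mx 1%:M (map_mx (iterdual_in N') Y)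
  else 1%:M.

Lemma texp_pts N : Q_subgroup_pts M (iterdual N) (texp N).
Proof.
elim: N => [|N IHN]; first exact: Q_subgroup1.
have N_Q := iterdual_Q_algebra N.
apply: Q_subgroupM; first exact: iterdual_Q_algebra N.+1.
  exact: pts_morph.
by apply/Lie_dualP => //; exact: Lie_morph.
Qed.

Lemma exp_coefS i : (i.+1%:R * a) *: exp_coef i.+1 = exp_coef i *m Y.
Proof.
rewrite /exp_coef scalerA -scalemxAl [Y ^+ _.+1]exprSr; congr (_ *: _).
rewrite factS natrM exprS; have := F_Q i; rewrite unitfE => i0.
have -> : a * a ^+ i * (i.+1%:R * i`!%:R) = (i.+1%:R * a) * (a ^+ i * i`!%:R).
  by rewrite mulrACA [a * _]mulrC -!mulrA.
by rewrite invfM mulrA mulfV ?mul1r// mulf_neq0.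
Qed.

(** Since [tau N.+1] is [tau N] plus [a] times a new infinitesimal, the infinitesimal part of the
    sum is [a] times its formal derivative, which [exp_coefS] turns into the sum times [Y]. *)
Lemma texpE N : texp N =
  \sum_(i < N.+1) tau N ^+ i *: map_mx (iterdual_in N) (exp_coef i).
Proof.
elim: N => [|N IHN].
  rewrite big_ord1 expr0 scale1r /exp_coef expr0 fact0 mulr1 invr1 scale1r.
  by rewrite [RHS]map_mx1.
pose Z := exp_coef.
have E (S : 'M[iterdual N]_n) :
  S = \sum_(i < N.+1) tau N ^+ i *: map_mx (iterdual_in N) (Z i) ->
  \sum_(i < N.+2) tau N.+1 ^+ i *: map_mx (iterdual_in N.+1) (Z i) =
  dual_mx S (S *m map_mx (iterdual_in N) Y).
  move=> SE; apply/matrixP => p q; rewrite summxE mxE.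
  have T i : (tau N.+1 ^+ i *: map_mx (iterdual_in N.+1) (Z i)) p q =
      Dual (tau N ^+ i * iterdual_in N (Z i p q))
           (iterdual_in N a * tau N ^+ i.-1 *+ i * iterdual_in N (Z i p q)).
    rewrite mxE [X in X * _]dualX mxE; apply: dual_eq => //=.
    by rewrite mulr0 add0r.
  under eq_bigr do rewrite T.
  rewrite sum_dual; congr Dual.
    rewrite big_ord_recr /= tau_nilpotent mul0r addr0 SE summxE.
    by apply: eq_bigr => i _; rewrite !mxE.
  rewrite big_ord_recl /= mulr0n mul0r add0r.
  rewrite SE mulmx_suml summxE; apply: eq_bigr => i _.
  rewrite /bump /= add1n -scalemxAl -map_mxM -exp_coefS !mxE.
  by rewrite !rmorphM rmorph_nat /= /Z; ring.
by rewrite [LHS]/= dual_mx_in dual_mxM mulmx1 mul0mx addr0 -E.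
Qed.

(* Substituting [tau N] in the coordinates of a matrix that agrees with [exp]
   up to order [N] gives a point of [M] over [iterdual N]; hence the equations
   of [M] vanish to order [N] on it. *)
Lemma exp_eqs_coef N (v : 'M[{poly F}]_n) :
  (forall i j k, (k <= N)%N -> (v i j)`_k = exp_coef k i j) ->
  forall P, Q_subgroup_eqs M P -> forall k, (k <= N)%N ->
    (mmap ratr (fun i => mxvec v 0 i) P)`_k = 0.
Proof.
move=> vE P EP; apply: horner_tau_eq0.
pose f := fun p => (map_poly (iterdual_in N) p).[tau N].
have fB : zmod_morphism f by move=> p q; rewrite /f rmorphB /= hornerD hornerN.
have fM : monoid_morphism f.
  by split=> [|p q]; rewrite /f ?rmorph1 ?hornerC// rmorphM /= hornerM.
pose fB' := GRing.isZmodMorphism.Build _ _ f fB.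
pose fM' := GRing.isMonoidMorphism.Build _ _ f fM.
pose f' : {rmorphism {poly F} -> iterdual N} := HB.pack f fB' fM'.
rewrite -[LHS]/(f' _) mmap_ratr_morph; last exact: Q_algebra_morph (@polyC F) F_Q.
have [_ e] := texp_pts N; rewrite -[RHS](e P EP); congr mmap; apply: funext => i.
rewrite /= /f horner_tau texpE; case/mxvec_indexP: i => i j.
rewrite !mxvecE summxE; apply: eq_bigr => k _.
rewrite vE; last by rewrite -ltnS.
by rewrite [RHS]mxE [X in _ = _ * X]mxE mulrC.
Qed.

End IteratedDualNumbers.

(** * The l-adic exponential *)

(** Ranks are bounded by [m], so some finite family taken from [S] has maximal rank, and adjoining a
    further member of [S] cannot enlarge its row space. *)
Lemma rows_generating (F : fieldType) m (S : set 'rV[F]_m) :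
  exists k (B : 'M[F]_(k, m)), (forall i, S (row i B)) /\
    forall x, S x -> (x <= B)%MS.
Proof.
pose p r := `[< exists k (B : 'M[F]_(k, m)), (forall i, S (row i B)) /\ \rank B = r >].
have ex : exists r, p r.
  by exists 0%N; apply/asboolP; exists 0%N, 0; split=> [[]//|]; rewrite mxrank0.
have ub r : p r -> (r <= m)%N by move=> /asboolP[k [B [_ <-]]]; exact: rank_leq_col.
case: (ex_maxnP ex ub) => r /asboolP[k [B [BS Br]]] rmax.
exists k, B; split=> // x Sx.
have BB : (B <= col_mx B x)%MS by rewrite -addsmxE addsmxSl.
have xB : (x <= col_mx B x)%MS by rewrite -addsmxE addsmxSr.
apply: submx_trans xB _; rewrite -(geq_leqif (mxrank_leqif_sup BB)) Br.
apply: rmax; apply/asboolP; exists (k + 1)%N, (col_mx B x); split=> // i.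
rewrite -(splitK i); case: (split i) => j /=.
  by rewrite rowKu.
by rewrite rowKd row_id.
Qed.

Lemma mx_spanP (F : fieldType) m p (U : set 'M[F]_(m, p)) :
  exists k (b : 'I_k -> 'M[F]_(m, p)), (forall i, U (b i)) /\
  forall x, mx_span U x <-> (mxvec x <= \matrix_i mxvec (b i))%MS.
Proof.
have [k [B [BU BP]]] := rows_generating (mxvec @` U).
have /choice[b bP] : forall i, exists x, U x /\ mxvec x = row i B.
  by move=> i; have [x Ux xE] := BU i; exists x.
exists k, b; split=> [i|x]; first by have [] := bP i.
have -> : \matrix_i mxvec (b i) = B.
  by apply/row_matrixP => i; rewrite rowK; have [] := bP i.
split=> [[j [c [y [yU ->]]]]|/submxP[c cE]].
  rewrite linear_sum summx_sub// => i _; rewrite linearZ scalemx_sub//.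
  by apply: BP; exists (y i).
exists k, (fun i => c 0 i), b; split=> [i|]; first by have [] := bP i.
apply: (can_inj mxvecK); rewrite cE mulmx_sum_row linear_sum.
by apply: eq_bigr => i _; rewrite linearZ /=; have [_ ->] := bP i.
Qed.

Section Span.
Variables (F : fieldType) (m p : nat) (U : set 'M[F]_(m, p)).

Lemma mx_span_sub x : U x -> mx_span U x.
Proof.
move=> Ux; exists 1%N, (fun=> 1), (fun=> x); split=> //.
by rewrite big_ord1 scale1r.
Qed.

Lemma mx_span_lin a x y : mx_span U x -> mx_span U y -> mx_span U (a *: x + y).
Proof.
have [k [b [_ bP]]] := mx_spanP U; rewrite !bP => xb yb.
by rewrite linearP addmx_sub// scalemx_sub.
Qed.

Lemma mx_span0 : mx_span U 0.
Proof. by have [k [b [_ bP]]] := mx_spanP U; rewrite bP linear0 sub0mx. Qed.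

Lemma mx_spanZ a x : mx_span U x -> mx_span U (a *: x).
Proof. by move=> xU; rewrite -[_ *: _]addr0; apply: mx_span_lin => //; exact: mx_span0. Qed.

Lemma mx_span_sum (I : finType) (c : I -> F) (x : I -> 'M[F]_(m, p)) :
  (forall i, mx_span U (x i)) -> mx_span U (\sum_i c i *: x i).
Proof.
move=> xU; apply: (big_ind (mx_span U)) => [|y z yU zU|i _]; first exact: mx_span0.
  by rewrite -[y]scale1r; apply: mx_span_lin.
exact: mx_spanZ.
Qed.

(** The linear form is a column of the cokernel of a finite generating family. *)
Lemma mx_span_separated x : ~ mx_span U x ->
  exists f : 'cV[F]_(m * p), (forall u, U u -> mxvec u *m f = 0) /\ mxvec x *m f != 0.
Proof.
move=> xU; have [k [b [_ bP]]] := mx_spanP U.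
have xB : mxvec x *m cokermx (\matrix_i mxvec (b i)) != 0.
  by apply/negP => x0; apply: xU; apply/bP; rewrite submxE.
have [j xj] : exists j, (mxvec x *m cokermx (\matrix_i mxvec (b i))) 0 j != 0.
  apply: contrapT => /forallNP nj; move/negP: xB; apply; apply/eqP/rowP => j.
  by rewrite [RHS]mxE; apply/eqP; have /negP := nj j; rewrite negbK.
exists (col j (cokermx (\matrix_i mxvec (b i)))); split=> [u Uu|].
  have := mx_span_sub Uu; rewrite bP submxE => /eqP u0.
  by rewrite colE mulmxA -colE u0; apply/colP => i; rewrite !mxE.
apply/eqP => e; move/eqP: xj; apply.
by move: e; rewrite colE mulmxA -colE => /colP/(_ 0); rewrite mxE [RHS]mxE.
Qed.

End Span.

Lemma mx_span_mul (F : fieldType) n (U : set 'M[F]_n) :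
  (forall u v, U u -> U v -> U (u *m v)) ->
  forall x y, mx_span U x -> mx_span U y -> mx_span U (x *m y).
Proof.
move=> UM _ _ [j [c [u [uU ->]]]] [k [d [v [vU ->]]]].
rewrite mulmx_suml; under eq_bigr do rewrite -scalemxAl mulmx_sumr.
apply: mx_span_sum => i; under eq_bigr do rewrite -scalemxAr.
by apply: mx_span_sum => i'; apply/mx_span_sub/UM.
Qed.

Lemma expmxZ (R : comPzRingType) n (a : R) (X : 'M[R]_n) i :
  (a *: X) ^+ i = a ^+ i *: X ^+ i.
Proof.
elim: i => [|i IHi]; first by rewrite !expr0 scale1r.
by rewrite exprS IHi -[LHS]scalemxAl -scalemxAr scalerA -exprS [X ^+ _.+1]exprS.
Qed.

(** * Convergent exponentials in an algebraic group over a local field *)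

Section LocalExponential.
Variables (F : fieldType) (S : subringClosed F) (pi : F).
Hypothesis F_local : local_field S pi.
Let pi_neq0 := lf_pi_neq0 F_local.
Let pi_int := lf_pi_int F_local.

Lemma local_field_Q_algebra : is_Q_algebra F.
Proof. by apply: Q_algebra_char0 => k; rewrite (lf_nat F_local). Qed.
Let F_Q := local_field_Q_algebra.

Let piX_neq0 k : pi ^+ k != 0.
Proof. by rewrite expf_neq0. Qed.

Lemma int_horner_coef0 (q : {poly F}) N : q \is a polyOver S ->
  (forall i, (i < N)%N -> q`_i = 0) -> pi ^- N * q.[pi] \in S.
Proof.
move=> qS q0; rewrite -(poly_take_drop N q).
have -> : take_poly N q = 0.
  by apply/polyP => i; rewrite coef_take_poly coef0; case: ifP => // /q0.
rewrite add0r hornerM hornerXn [_ * pi ^+ N]mulrC mulKf//.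
apply: rpred_horner => //; apply/polyOverP => i.
by rewrite coef_drop_poly (polyOverP qS).
Qed.

Lemma int_den_seq (T : eqType) (f : T -> F) (s : seq T) :
  exists c, forall x, x \in s -> pi ^+ c * f x \in S.
Proof.
elim: s => [|x s [c cP]]; first by exists 0%N.
have [d dP] := lf_den F_local (f x); exists (maxn c d) => y.
rewrite inE => /predU1P[->|ys].
  by apply: (int_den_le F_local _ dP); exact: leq_maxr.
by apply: (int_den_le F_local _ (cP _ ys)); exact: leq_maxl.
Qed.

Lemma mmap_ratr_int m (P : {mpoly rat[m]}) : exists c,
  forall v : 'I_m -> {poly F}, (forall i, v i \is a polyOver S) ->
  pi ^+ c *: mmap ratr v P \is a polyOver S.
Proof.
have [c cP] := int_den_seq (fun x => ratr P@_x) (msupp P).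
exists c => v vS; rewrite /mmap scaler_sumr big_seq rpred_sum// => x xP.
rewrite -(morph_ratr (@polyC F))//= mul_polyC scalerA.
apply: polyOverZ; first exact: cP.
by apply: rpred_prod => i _; apply: rpredX.
Qed.

Variables (n : nat) (M : Q_subgroup n).

(** [G] is the exponential of [pi^(k+2) Y0], summed entry by entry; its terms of degree at least two
    are divisible by [pi^(2k)]. *)
Lemma exp_point k (Y0 : 'M[F]_n) : Y0 \is a mxOver S ->
  Lie M (pi ^+ (k + 2) *: Y0) ->
  exists2 G, Q_subgroup_pts M F G &
    pi ^- (2 * k) *: (G - 1%:M - pi ^+ (k + 2) *: Y0) \is a mxOver S.
Proof.
set Y := _ *: Y0 => YS YL.
(* Of the two extra factors [pi^i] in [Y^i], one cancels the [a^i] of [exp_coef] with [a = pi], the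
   other absorbs the factorial. *)
have ecE i : exp_coef pi Y i = (pi ^+ (k * i) * (pi ^+ i / i`!%:R)) *: Y0 ^+ i.
  rewrite /exp_coef /Y expmxZ scalerA; congr (_ *: _).
  rewrite -exprM mulnDl exprD mul2n -addnn exprD invfM [LHS]mulrC !mulrA.
  by rewrite mulfK.
have Y0X i : Y0 ^+ i \is a mxOver S.
  elim: i => [|i IHi]; first by rewrite expr0 mxOver_scalar ?rpred0 ?rpred1.
  by rewrite exprS; apply: mxOverM.
have ecS i p q : exp_coef pi Y i p q \in S.
  by rewrite ecE mxE rpredM ?(mxOverP (Y0X i))// rpredM ?rpredX ?(lf_fact F_local).
have /choice[g gP] : forall pq : 'I_n * 'I_n, exists g, g \in S /\
    forall N, pi ^- N * (g - \sum_(i < N) pi ^+ i * exp_coef pi Y i pq.1 pq.2) \in S.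
  by move=> [p q]; have [s sS sP] := lf_series F_local (fun i => ecS i p q); exists s.
pose G := \matrix_(p, q) g (p, q).
pose R N p q := pi ^- N.+1 * (g (p, q) - \sum_(i < N.+1) pi ^+ i * exp_coef pi Y i p q).
(* The truncated exponential is corrected in degree [N.+1] so that its value at [pi] is exactly [G].
   An equation of [M] vanishes on [v N] to order [N], hence its value at [G] is divisible, up to a
   fixed denominator, by every [pi^N]. *)
pose v N : 'M[{poly F}]_n := \matrix_(p, q)
  (\poly_(i < N.+1) exp_coef pi Y i p q + R N p q *: 'X^(N.+1)).
have vS N p q : v N p q \is a polyOver S.
  rewrite mxE rpredD//; first by apply: polyOver_poly => i _; exact: ecS.
  by rewrite polyOverZ ?rpredX ?polyOverX//; have [_ /(_ N.+1)] := gP (p, q).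
have vG N p q : (v N p q).[pi] = G p q.
  rewrite !mxE hornerD hornerZ horner_poly hornerXn [R _ _ _ * _]mulrC mulVKf//.
  rewrite addrC; apply: (canLR (subrK _)); congr (_ - _).
  by apply: eq_bigr => i _; rewrite mulrC.
have vE N p q i : (i <= N)%N -> (v N p q)`_i = exp_coef pi Y i p q.
  move=> iN; rewrite mxE coefD coef_poly ltnS iN coefZ coefXn.
  by rewrite ltn_eqF ?ltnS// mulr0 addr0.
exists G.
  split.
    rewrite unitmxE unitfE; apply/eqP => G0.
    (* The polynomial [d] has integral coefficients and constant term 1; if it vanished at [pi],
       then [pi^-1] would be integral. *)
    pose d := \det (v 0%N).
    have dS : d \is a polyOver S.
      rewrite /d /determinant rpred_sum// => s _.
      by rewrite rpredM ?rpred_sign// rpred_prod.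
    have dpi : d.[pi] = 0.
      rewrite -[LHS]/(horner_eval pi d) -det_map_mx -G0; congr (\det _).
      by apply/matrixP => p q; rewrite [LHS]mxE; exact: vG.
    have d0 : d`_0 = 1.
      rewrite -horner_coef0 -[LHS]/(horner_eval 0 d) -det_map_mx -(det1 F n).
      congr (\det _); apply/matrixP => p q.
      rewrite [LHS]mxE -[LHS]/((v 0%N p q).[0]) horner_coef0 vE// /exp_coef expr0 fact0 mulr1 invr1.
      by rewrite scale1r expr0.
    have : pi ^- 1 * (d - 1).[pi] \in S.
      apply: int_horner_coef0; first by rewrite rpredB ?rpred1.
      by case=> // _; rewrite coefB d0 coef1 subrr.
    rewrite hornerD dpi hornerN hornerC sub0r mulrN1 rpredN.
    by apply/negP; exact: lf_piV_int.
  move=> P EP; have [c cP] := mmap_ratr_int P.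
  apply: (mulfI (piX_neq0 c)); rewrite mulr0; apply: (lf_cap0 F_local) => N.
  have qS := cP (fun i => mxvec (v N) 0 i).
  have {}qS : pi ^+ c *: mmap ratr (fun i => mxvec (v N) 0 i) P \is a polyOver S.
    by apply: qS => i; case/mxvec_indexP: i => p q; rewrite mxvecE.
  have : pi ^- N * (pi ^+ c *: mmap ratr (fun i => mxvec (v N) 0 i) P).[pi] \in S.
    apply: int_horner_coef0 => // i iN.
    rewrite coefZ (exp_eqs_coef F_Q pi_neq0 YL _ EP (ltnW iN)) ?mulr0//.
    exact: vE.
  suff -> : (pi ^+ c *: mmap ratr (fun i => mxvec (v N) 0 i) P).[pi] =
      pi ^+ c * mmap ratr (fun i => mxvec G 0 i) P by [].
  rewrite hornerZ; congr (_ * _).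
  rewrite -[LHS]/(horner_eval pi _) mmap_ratr_morph; last first.
    exact: Q_algebra_morph (@polyC F) F_Q.
  congr mmap; apply: funext => i /=.
  by case/mxvec_indexP: i => p q; rewrite !mxvecE; exact: vG.
have e0 : exp_coef pi Y 0 = 1%:M.
  by rewrite /exp_coef expr0 fact0 mulr1 invr1 scale1r expr0.
have e1 : pi *: exp_coef pi Y 1 = Y.
  by have := exp_coefS F_Q pi_neq0 Y 0; rewrite mul1r e0 mul1mx.
apply/mxOverP => p q; rewrite mxE.
have [_ /(_ (2 + 2 * k)%N)] := gP (p, q).
rewrite big_split_ord big_ord_recl big_ord1 /= expr0 mul1r expr1.
set t := \sum_(i < 2 * k) _ => tS.
have subE (A B : 'M[F]_n) : (A - B) p q = A p q - B p q by rewrite !mxE.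
have YE : Y p q = pi * exp_coef pi Y 1 p q by rewrite -[in LHS]e1 mxE.
have GE : G p q = g (p, q) by rewrite mxE.
have -> : (G - 1%:M - Y) p q = g (p, q) - (exp_coef pi Y 0 p q +
    pi * exp_coef pi Y 1 p q + t) + t.
  by rewrite !subE GE YE e0; ring.
rewrite mulrDr rpredD//.
  set z := g _ - _ in tS *.
  have -> : pi ^- (2 * k) * z = pi ^+ 2 * (pi ^- (2 + 2 * k) * z).
    by rewrite (exprD pi 2 (2 * k)) invfM -(mulrA (pi ^- 2)) mulVKf.
  by rewrite rpredM ?rpredX.
rewrite /t mulr_sumr rpred_sum// => i _.
rewrite ecE mxE mulnDr (exprD pi (k * 2)) (mulnC k 2); set x := pi ^+ (2 * k); set y := Y0 ^+ _.
have x0 : x != 0 by exact: piX_neq0.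
rewrite -!(mulrA x) [_ * (x * _)]mulrCA mulKf// rpredM ?rpredX//.
by rewrite rpredM ?(mxOverP (Y0X _))// rpredM ?rpredX// (lf_fact F_local).
Qed.

(** Otherwise some linear form [f] vanishes on [U] but not at [X]. Applied to a point
    [1 + pi^(k+c+2) X + pi^(2k) W] of [U] with [W] integral, it shows that [f(X)] is divisible by
    arbitrarily high powers of [pi]. *)
Lemma Lie_sub_span (U : set 'M[F]_n) : U 1%:M ->
  (exists N, forall g, Q_subgroup_pts M F g ->
    pi ^- N *: (g - 1%:M) \is a mxOver S -> U g) ->
  forall X, Lie M X -> mx_span U X.
Proof.
move=> U1 [N UN] X XL; apply: contrapT => /mx_span_separated[f [fU fX]].
have [c cP] := int_den_mx F_local X.
have [m mP] := int_den_mx F_local f.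
move/negP: fX; apply; apply/eqP/colP => o; rewrite ord1 [RHS]mxE {o}.
set x := (mxvec X *m f) 0 0.
pose x' := pi ^+ (m + c + 2) * x.
suff x'0 : x' = 0 by apply: (mulfI (piX_neq0 (m + c + 2))); rewrite mulr0.
apply: (lf_cap0 F_local) => K.
(* [N] brings [G] close enough to 1 to lie in [U], and [K] is the precision to which [x'] is shown
   to vanish. *)
pose k := (N + K)%N.
have kX : pi ^+ (k + 2) *: (pi ^+ c *: X) = pi ^+ (k + c + 2) *: X.
  by rewrite scalerA -exprD addnAC.
have [|G GM GS] := @exp_point k _ cP.
  rewrite kX => P EP; under eq_bigr do rewrite linearZ mxE -mulrA.
  by rewrite -mulr_sumr XL ?mulr0.
have UG : U G.
  apply: UN => //.
  have -> : G - 1%:M = pi ^+ (2 * k) *: (pi ^- (2 * k) *: (G - 1%:M -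
      pi ^+ (k + 2) *: (pi ^+ c *: X))) + pi ^+ (k + 2) *: (pi ^+ c *: X).
    by rewrite scalerKV ?unitfE// subrK.
  have hS j (A : 'M[F]_n) : (N <= j)%N -> A \is a mxOver S ->
      pi ^- N *: (pi ^+ j *: A) \is a mxOver S.
    move=> Nj AS; rewrite scalerA mxOverZ//.
    by rewrite -(subnKC Nj) exprD mulKf// rpredX.
  by rewrite scalerDr rpredD// hS// /k; lia.
set W := _ *: _ in GS.
have WE : G = 1%:M + pi ^+ (k + c + 2) *: X + pi ^+ (2 * k) *: W.
  rewrite scalerKV ?unitfE// kX; set A := _ *: X.
  by rewrite -[_ - _ - _]addrA -opprD addrCA subrr addr0.
clearbody W; have := congr1 (fun A => (mxvec A *m f) 0 0) WE.
rewrite fU// !linearD !linearZ !mulmxDl fU// -!scalemxAl add0r.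
rewrite [LHS]mxE [RHS]mxE [X in _ = X + _]mxE [X in _ = _ + X]mxE -/x.
move=> /(congr1 (fun y => pi ^+ m * y)); rewrite mulr0 mulrDr.
set w := _ 0 0 => /esym/eqP; rewrite addr_eq0 => /eqP e.
have wS : pi ^+ m * w \in S.
  have -> : pi ^+ m * w = (mxvec W *m (pi ^+ m *: f)) 0 0.
    by rewrite -scalemxAr [RHS]mxE.
  suff : mxvec W *m (pi ^+ m *: f) \is a mxOver S by move/mxOverP.
  apply: mxOverM mP; apply/mxOverP => i j; rewrite ord1.
  by case/mxvec_indexP: j => p q; rewrite mxvecE (mxOverP GS).
have -> : pi ^- K * x' = - (pi ^+ N * (pi ^+ m * w)).
  have k2 : (2 * k = k + K + N)%N by rewrite /k; lia.
  apply: (mulfI (piX_neq0 (k + K))).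
  rewrite {1}exprD -mulrA mulVKf// /x'.
  transitivity (pi ^+ m * (pi ^+ (k + c + 2) * x)); first by rewrite !exprD; ring.
  by rewrite e k2 !exprD; ring.
by rewrite rpredN rpredM ?rpredX.
Qed.
End LocalExponential.

(** * Regular trace forms *)

Section PositiveDefinite.
Variable R : realFieldType.

Definition posdef n (P : 'M[R]_n) :=
  P^T = P /\ forall x : 'cV_n, x != 0 -> 0 < (x^T *m P *m x) 0 0.

Lemma posdef_unit n (P : 'M[R]_n) : posdef P -> P \in unitmx.
Proof.
move=> [PT P0]; rewrite -row_free_unit -kermx_eq0; apply/eqP/row_matrixP => i.
rewrite row0; apply/eqP; apply: contraT => /[dup] x0.
rewrite -trmx_eq0 => /P0; rewrite trmxK -row_mul mulmx_ker row0 mul0mx mxE ltxx.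
by [].
Qed.

(** Completing the square: the Schur complement [C] of the first pivot is again positive definite,
    and the induction continues with it. *)
Lemma posdef_diag n (P : 'M[R]_n) : posdef P -> exists (S : 'M_n) (d : 'rV_n),
  [/\ S \in unitmx, forall i, 0 < d 0 i & P = S^T *m diag_mx d *m S].
Proof.
elim: n P => [|n IHn] P [PT P0].
  by exists 1%:M, 0; split; [exact: unitmx1|case|apply/matrixP => -[]].
pose p := P 0 0; pose q := @ursubmx _ 1 n 1 n P; pose P' := @drsubmx _ 1 n 1 n P.
have PE : P = @block_mx _ 1 n 1 n p%:M q q^T P'.
  have ulE : @ulsubmx _ 1 n 1 n P = p%:M.
    rewrite [LHS]mx11_scalar; congr _%:M; rewrite !mxE; congr (P _ _); exact: val_inj.
  have dlE : @dlsubmx _ 1 n 1 n P = q^T by rewrite /q trmx_ursub PT.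
  by rewrite -ulE -dlE; apply/esym/(@submxK _ 1 n 1 n).
have p0 : 0 < p.
  have := P0 (delta_mx 0 0); rewrite trmx_delta -rowE -colE !mxE; apply.
  by apply/eqP => /matrixP/(_ 0 0); rewrite !mxE/= => /eqP; rewrite oner_eq0.
pose S1 := @block_mx _ 1 n 1 n 1%:M (p^-1 *: q) 0 1%:M.
pose C := P' - p^-1 *: (q^T *m q).
have PS : P = S1^T *m @block_mx _ 1 n 1 n p%:M 0 0 C *m S1.
  rewrite /S1 tr_block_mx !mulmx_block trmx0 !trmx1 !mul1mx !mul0mx !mulmx0 !mulmx1.
  have qT : (p^-1 *: q)^T *m p%:M = q^T.
    by rewrite linearZ mul_mx_scalar scalerA mulfV ?gt_eqF// scale1r.
  rewrite !addr0 !add0r qT mul_scalar_mx scalerA mulfV ?gt_eqF// scale1r.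
  by rewrite -scalemxAr PE /C [_ + (P' - _)]addrC subrK.
have S1u : S1 \in unitmx by rewrite unitmxE det_ublock !det1 mulr1 unitr1.
have Cpos : posdef C.
  split.
    rewrite /C linearB linearZ /= trmx_mul trmxK; congr (_ - _).
    by rewrite /P' trmx_drsub PT.
  move=> y y0; pose x := invmx S1 *m col_mx (0 : 'cV_1) y.
  have x0 : x != 0.
    apply: contraNneq y0 => /(congr1 (mulmx S1)); rewrite mulKVmx// mulmx0.
    by move=> /(congr1 (@dsubmx _ 1 n 1)); rewrite col_mxKd => ->; rewrite linear0.
  have := P0 x x0; rewrite PS.
  have -> : x^T *m (S1^T *m block_mx p%:M 0 0 C *m S1) *m x =
     (S1 *m x)^T *m block_mx p%:M 0 0 C *m (S1 *m x) by rewrite (trmx_mul S1 x) !mulmxA.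
  rewrite /x mulKVmx// tr_col_mx mul_row_block mul_row_col.
  by rewrite trmx0 !mul0mx !mulmx0 !add0r.
have [S' [d' [S'u d'0 CE]]] := IHn C Cpos.
exists (@block_mx _ 1 n 1 n 1%:M 0 0 S' *m S1), (row_mx (p%:M : 'M_1) d'); split.
- by rewrite unitmx_mul S1u andbT unitmxE (det_ublock (1%:M : 'M[R]_1)) det1 mul1r -unitmxE.
- move=> i; rewrite -(@splitK 1 n i); case: (@split 1 n i) => j /=.
    by rewrite (row_mxEl (p%:M : 'M_1)) mxE ord1.
  by rewrite (row_mxEr (p%:M : 'M_1)).
- rewrite PS trmx_mul -!mulmxA; congr (_ *m _); rewrite !mulmxA; congr (_ *m _).
  set D := diag_mx _.
  have -> : D = @block_mx _ 1 n 1 n p%:M 0 0 (diag_mx d').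
    rewrite /D [LHS](@diag_mx_row _ n 1 p%:M d'); congr (@block_mx _ 1 n 1 n _ _ _ _).
    by apply/matrixP => i j; rewrite !mxE !ord1.
  have e : (@block_mx _ 1 n 1 n 1%:M 0 0 S')^T *m
      @block_mx _ 1 n 1 n p%:M 0 0 (diag_mx d') *m @block_mx _ 1 n 1 n 1%:M 0 0 S' =
      @block_mx _ 1 n 1 n p%:M 0 0 C.
    rewrite tr_block_mx !mulmx_block !trmx0 trmx1.
    by rewrite !mul0mx !mulmx0 !mulmx1 !mul1mx !addr0 !add0r -CE mul0mx.
  by rewrite -[LHS]e.
Qed.

(** [L'] is the adjoint of [L] for [P]. In coordinates where [P] is diagonal, the trace is a sum of
    squares with the positive weights [d i / d j]. *)
Lemma posdef_trace n (P L L' : 'M[R]_n) : posdef P ->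
  P *m L' = L^T *m P -> L != 0 -> 0 < \tr (L *m L').
Proof.
move=> Ppos LL' L0; have Pu := posdef_unit Ppos.
have [S [d [Su d0 PE]]] := posdef_diag Ppos.
pose Y := S *m L *m invmx S; pose Z := S *m L' *m invmx S.
have ZY : diag_mx d *m Z = Y^T *m diag_mx d.
  have STu : S^T \in unitmx by rewrite unitmx_tr.
  apply: (can_inj (mulKmx STu)); apply: (can_inj (mulmxK Su)).
  rewrite /Z /Y !trmx_mul trmx_inv !mulmxA mulmxKV// -PE LL'.
  rewrite mulmxV// mul1mx. by rewrite PE -!mulmxA.
have -> : \tr (L *m L') = \tr (Y *m Z).
  by rewrite /Y /Z !mulmxA mulmxKV// [RHS]mxtrace_mulC !mulmxA mulVmx// mul1mx.
have ZE i j : Z i j = d 0 j * Y j i / d 0 i.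
  have := congr1 (fun A : 'M_n => A i j) ZY.
  rewrite mul_diag_mx mul_mx_diag mxE [RHS]mxE [Y^T _ _]mxE => e.
  by apply: (canRL (mulfK _)); rewrite ?gt_eqF// mulrC e mulrC.
have Y0 : Y != 0.
  apply: contraNneq L0 => /(congr1 (fun A => invmx S *m A *m S)).
  by rewrite /Y !mulmxA mulVmx// mul1mx mulmxKV// mulmx0 mul0mx => ->.
have trE : \tr (Y *m Z) = \sum_i \sum_j Y i j ^+ 2 * (d 0 i / d 0 j).
  apply: eq_bigr => i _; rewrite mxE; apply: eq_bigr => j _; rewrite ZE.
  by rewrite expr2; ring.
have ge0 i j : 0 <= Y i j ^+ 2 * (d 0 i / d 0 j).
  by rewrite mulr_ge0 ?sqr_ge0// divr_ge0// ltW.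
rewrite trE lt_def sumr_ge0 ?andbT => [|i _]; last exact: sumr_ge0.
apply: contra Y0 => /eqP s0; apply/eqP/matrixP => i j; rewrite [RHS]mxE.
have e1 := psumr_eq0P (fun i _ => sumr_ge0 _ (fun j _ => ge0 i j)) s0 (i := i) isT.
have /eqP := psumr_eq0P (fun j _ => ge0 i j) e1 (i := j) isT.
by rewrite !mulf_eq0 invr_eq0 !(gt_eqF (d0 _)) !orbF orbb => /eqP.
Qed.

End PositiveDefinite.

(** * The regular representation and its Casimir element *)

Section RegularTrace.
Variables (n d : nat).

(** [L] is the left regular representation: column [j] of [L i] holds coordinates of
    [a i *m a j]. *)
Definition structure_constants (F : comPzRingType) (a : 'I_d -> 'M[F]_n)
  (L : 'I_d -> 'M[F]_d) := forall i j, a i *m a j = \sum_p L i p j *: a p.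

Definition lin_indep (F : fieldType) (a : 'I_d -> 'M[F]_n) :=
  forall v : 'I_d -> F, \sum_i v i *: a i = 0 -> forall i, v i = 0.

Definition regular_gram (F : comPzRingType) (L : 'I_d -> 'M[F]_d) : 'M[F]_d :=
  \matrix_(i, j) \tr (L i *m L j).

Lemma structure_constants_mul (F : fieldType) (a : 'I_d -> 'M[F]_n) L :
  lin_indep a -> structure_constants a L ->
  forall i j, L i *m L j = \sum_p L i p j *: L p.
Proof.
move=> a_free aL i j; apply/matrixP => q k.
have e : a i *m (a j *m a k) = (a i *m a j) *m a k by rewrite mulmxA.
apply/eqP; rewrite -subr_eq0; apply/eqP.
apply: (a_free (fun q => (L i *m L j) q k - (\sum_p L i p j *: L p) q k)).
under eq_bigr do rewrite scalerBl.
rewrite big_split /= sumrN; apply/eqP; rewrite subr_eq0; apply/eqP.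
transitivity (a i *m (a j *m a k)); [rewrite aL mulmx_sumr|rewrite e aL mulmx_suml].
  under [RHS]eq_bigr do rewrite -scalemxAr aL scaler_sumr.
  rewrite exchange_big; apply: eq_bigr => p _ /=.
  rewrite mxE scaler_suml; apply: eq_bigr => r _.
  by rewrite scalerA mulrC.
under [LHS]eq_bigr do rewrite -scalemxAl aL scaler_sumr.
rewrite exchange_big; apply: eq_bigr => p _ /=.
rewrite summxE scaler_suml; apply: eq_bigr => r _.
by rewrite mxE scalerA.
Qed.

Section Positivity.
Variables (R : realFieldType) (a : 'I_d -> 'M[R]_n) (L : 'I_d -> 'M[R]_d).
Variables (u : 'I_d -> R) (Q : 'M[R]_n) (s : 'I_d -> 'I_d -> R).
Hypothesis a_free : lin_indep a.
Hypothesis aL : structure_constants a L.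
Hypothesis u1 : \sum_i u i *: a i = 1%:M.
Hypothesis Qpos : posdef Q.
Hypothesis Qs : forall i, Q *m (\sum_j s i j *: a j) = (a i)^T *m Q.

Local Notation elt v := (\sum_i v i *: a i).
(** The adjoint for [Q], an involution that preserves the span of [a] by [Qs]. *)
Let star (x : 'M[R]_n) := invmx Q *m x^T *m Q.

Let Qu : Q \in unitmx := posdef_unit Qpos.

Let starM x y : star (x *m y) = star y *m star x.
Proof. by rewrite /star trmx_mul !mulmxA mulmxK. Qed.

Let star_sum (I : finType) (c : I -> R) (x : I -> 'M[R]_n) :
  star (\sum_i c i *: x i) = \sum_i c i *: star (x i).
Proof.
rewrite /star linear_sum mulmx_sumr mulmx_suml; apply: eq_bigr => i _.
by rewrite linearZ /= -scalemxAr -scalemxAl.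
Qed.

Let star_a i : star (a i) = \sum_j s i j *: a j.
Proof. by apply: (can_inj (mulKmx Qu)); rewrite Qs /star !mulmxA mulmxV// mul1mx. Qed.

Let starK x : star (star x) = x.
Proof.
have [QT _] := Qpos.
by rewrite /star !trmx_mul trmx_inv QT trmxK !mulmxA mulVmx// mul1mx mulmxKV.
Qed.

Let tr_star x : x != 0 -> 0 < \tr (x *m star x).
Proof.
by apply: (posdef_trace Qpos); rewrite /star !mulmxA mulmxV// mul1mx.
Qed.

Let gram : 'M[R]_d := \matrix_(i, j) \tr (a i *m star (a j)).

Let tr_gram v w : \tr (elt v *m star (elt w)) =
  \sum_i \sum_j v i * gram i j * w j.
Proof.
rewrite star_sum mulmx_suml raddf_sum; apply: eq_bigr => i _ /=.
rewrite mulmx_sumr raddf_sum; apply: eq_bigr => j _ /=.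
by rewrite -scalemxAl -scalemxAr !linearZ /= mxE; ring.
Qed.

Let gram_posdef : posdef gram.
Proof.
split.
  apply/matrixP => i j; rewrite !mxE -mxtrace_tr trmx_mul mxtrace_mulC /star.
  have [QT _] := Qpos.
  rewrite !trmx_mul trmx_inv trmxK QT !mulmxA mxtrace_mulC.
  by rewrite !mulmxA [LHS]mxtrace_mulC !mulmxA.
move=> x x0.
have -> : (x^T *m gram *m x) 0 0 = \tr (elt (x^~ 0) *m star (elt (x^~ 0))).
  rewrite tr_gram mxE exchange_big; apply: eq_bigr => j _.
  rewrite mxE mulr_suml; apply: eq_bigr => i _.
  by rewrite [x^T _ _]mxE.
apply: tr_star; apply: contraNneq x0 => /a_free x0.
by apply/eqP/colP => i; rewrite x0 mxE.
Qed.

(** For the scalar product [tr (y (star z))], left multiplication by [star x] is the adjoint of left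
    multiplication by [x], so their product has positive trace unless [x] acts as zero, that is,
    unless [x = 0]. On the kernel of the trace form this trace vanishes. *)
Lemma regular_gram_inj (v : 'rV_d) : v *m regular_gram L = 0 -> v = 0.
Proof.
move=> vG; apply: contra_eq vG => v0.
pose Lm (v : 'I_d -> R) := \sum_i v i *: L i.
have eltL w j : elt w *m a j = \sum_p Lm w p j *: a p.
  rewrite mulmx_suml; under eq_bigr do rewrite -scalemxAl aL scaler_sumr.
  rewrite exchange_big; apply: eq_bigr => p _ /=.
  rewrite summxE scaler_suml; apply: eq_bigr => i _.
  by rewrite mxE scalerA.
pose w j := \sum_k v 0 k * s k j.
have wE : elt w = star (elt (v 0)).
  rewrite star_sum; under [RHS]eq_bigr do rewrite star_a scaler_sumr.
  rewrite exchange_big; apply: eq_bigr => j _ /=.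
  by rewrite scaler_suml; apply: eq_bigr => k _; rewrite scalerA.
have Lm0 : Lm (v 0) != 0.
  apply: contraNneq v0 => L0; apply/eqP/rowP => k; rewrite mxE.
  apply: a_free k; rewrite -[LHS]mulmx1 -u1 mulmx_sumr big1// => j _.
  by rewrite -scalemxAr eltL big1 ?scaler0// => p _; rewrite L0 mxE scale0r.
have adj : gram *m Lm w = (Lm (v 0))^T *m gram.
  apply/matrixP => i j; rewrite mxE [RHS]mxE.
  transitivity (\tr (a i *m (star (a j) *m elt (v 0)))).
    have -> : star (a j) *m elt (v 0) = star (elt w *m a j).
      by rewrite starM wE starK.
    rewrite eltL star_sum mulmx_sumr raddf_sum; apply: eq_bigr => p _ /=.
    by rewrite -scalemxAr linearZ /= mxE mulrC.
  rewrite mulmxA mxtrace_mulC mulmxA eltL mulmx_suml raddf_sum.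
  apply: eq_bigr => p _ /=.
  by rewrite -scalemxAl linearZ /= [(Lm _)^T _ _]mxE mxE.
apply/eqP => vG; have := posdef_trace gram_posdef adj Lm0.
suff -> : \tr (Lm (v 0) *m Lm w) = \sum_j (v *m regular_gram L) 0 j * w j.
  by rewrite vG big1 ?ltxx// => j _; rewrite mxE mul0r.
rewrite /Lm mulmx_sumr raddf_sum; apply: eq_bigr => j _ /=.
rewrite mulmx_suml raddf_sum mxE mulr_suml; apply: eq_bigr => i _ /=.
by rewrite -scalemxAl -scalemxAr !linearZ /= mxE; ring.
Qed.

End Positivity.

(* A separability idempotent of the algebra spanned by [a], as the Casimir
   element of its regular trace form. *)
Lemma casimir_idempotent (F : fieldType) (a : 'I_d -> 'M[F]_n) (L : 'I_d -> 'M[F]_d)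
    (u : 'I_d -> F) :
  lin_indep a -> structure_constants a L -> \sum_i u i *: a i = 1%:M ->
  regular_gram L \in unitmx ->
  exists c : 'M[F]_d, \sum_i \sum_j c i j *: (a j *m a i) = 1%:M /\
    forall k f, a k *m (\sum_i \sum_j c i j *: (a i *m f *m a j)) =
                (\sum_i \sum_j c i j *: (a i *m f *m a j)) *m a k.
Proof.
move=> a_free aL u1 Gu; pose G := regular_gram L; pose c := invmx G.
have LM := structure_constants_mul a_free aL.
have GT : G^T = G by apply/matrixP => i j; rewrite !mxE mxtrace_mulC.
have cT : c^T = c by rewrite /c trmx_inv GT.
(* Right multiplication by [a k]. By invariance of the trace form it is adjoint to left
   multiplication, so the inverse Gram matrix [c] intertwines [L k] with its transpose. *)
pose Rk k : 'M[F]_d := \matrix_(p, j) L j p k.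
have GLE k j i : (G *m L k) j i = \tr (L j *m (L k *m L i)).
  rewrite LM mulmx_sumr raddf_sum mxE; apply: eq_bigr => p _ /=.
  by rewrite -scalemxAr linearZ /= mxE mulrC.
have GL k : G *m L k = (Rk k)^T *m G.
  apply/matrixP => j i; rewrite GLE mulmxA LM mulmx_suml raddf_sum mxE.
  apply: eq_bigr => p _ /=.
  by rewrite -scalemxAl linearZ /= !mxE.
have cR k : L k *m c = c *m (Rk k)^T.
  by apply: (can_inj (mulKmx Gu)); rewrite !mulmxA mulmxV// mul1mx GL mulmxK.
exists c; split=> [|k f].
  rewrite exchange_big.
  have cC i j : c i j = c j i by rewrite -[in LHS]cT mxE.
  under eq_bigr do under eq_bigr do rewrite cC.
  pose w q := \sum_i \sum_j c i j * L i q j.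
  have wE : \sum_i \sum_j c i j *: (a i *m a j) = \sum_q w q *: a q.
    under eq_bigr do under eq_bigr do rewrite aL scaler_sumr.
    under eq_bigr do rewrite exchange_big.
    rewrite exchange_big; apply: eq_bigr => q _ /=.
    rewrite /w scaler_suml; apply: eq_bigr => i _.
    by rewrite scaler_suml; apply: eq_bigr => j _; rewrite scalerA.
  have L1 : \sum_p u p *: L p = 1%:M.
    apply/matrixP => q i; apply/eqP; rewrite -subr_eq0; apply/eqP.
    apply: (a_free (fun q => (\sum_p u p *: L p) q i - 1%:M q i)).
    under eq_bigr do rewrite scalerBl.
    rewrite big_split /= sumrN; apply/eqP; rewrite subr_eq0; apply/eqP.
    transitivity (a i).
      rewrite -[RHS]mul1mx -u1 mulmx_suml.
      under [RHS]eq_bigr do rewrite -scalemxAl aL scaler_sumr.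
      rewrite [RHS]exchange_big; apply: eq_bigr => p _ /=.
      rewrite summxE scaler_suml; apply: eq_bigr => r _.
      by rewrite mxE scalerA.
    rewrite (bigD1 i)//= mxE eqxx scale1r big1 ?addr0// => p pi.
    by rewrite mxE (negPf pi) scale0r.
  suff -> : \sum_i \sum_j c i j *: (a i *m a j) = \sum_q u q *: a q by [].
  rewrite wE; suff wu : \row_q w q = \row_q u q.
    by apply: eq_bigr => q _; have /rowP/(_ q) := wu; rewrite !mxE => ->.
  (* Paired with [a k] under the trace form, both elements give [tr (L k)]: [w] because [c] is
     inverse to [G], and [u] because it represents 1. *)
  apply: (can_inj (mulmxK Gu)); apply/rowP => k; rewrite mxE [RHS]mxE.
  transitivity (\tr (L k)).
    transitivity (\sum_i \sum_j c i j * \tr (L i *m L j *m L k)).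
      under eq_bigr do rewrite mxE /w mulr_suml.
      rewrite exchange_big; apply: eq_bigr => i _ /=.
      under eq_bigr do rewrite mulr_suml.
      rewrite exchange_big; apply: eq_bigr => j _ /=.
      rewrite LM mulmx_suml raddf_sum mulr_sumr; apply: eq_bigr => q _ /=.
      by rewrite -scalemxAl linearZ /= mxE mulrA.
    apply: eq_bigr => i _.
    have -> : L k i i = (c *m (G *m L k)) i i by rewrite mulKmx.
    rewrite mxE; apply: eq_bigr => j _; rewrite GLE; congr (_ * _).
    by rewrite -mulmxA mxtrace_mulC mulmxA.
  rewrite -[L k]mul1mx -L1 mulmx_suml raddf_sum; apply: eq_bigr => j _ /=.
  by rewrite -scalemxAl linearZ /= !mxE.
transitivity (\sum_p \sum_j (L k *m c) p j *: (a p *m f *m a j)).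
  rewrite mulmx_sumr.
  transitivity (\sum_i \sum_j \sum_p (c i j * L k p i) *: (a p *m f *m a j)).
    apply: eq_bigr => i _; rewrite mulmx_sumr; apply: eq_bigr => j _.
    rewrite -scalemxAr !mulmxA aL !mulmx_suml scaler_sumr.
    by apply: eq_bigr => p _; rewrite -!scalemxAl scalerA.
  under eq_bigr do rewrite exchange_big.
  rewrite exchange_big; apply: eq_bigr => p _ /=.
  rewrite exchange_big; apply: eq_bigr => j _ /=.
  rewrite mxE scaler_suml; apply: eq_bigr => i _.
  by rewrite mulrC.
rewrite cR mulmx_suml; apply: eq_bigr => i _.
rewrite mulmx_suml.
under [RHS]eq_bigr do rewrite -scalemxAl -mulmxA aL mulmx_sumr scaler_sumr.
rewrite [RHS]exchange_big; apply: eq_bigr => p _ /=.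
rewrite mxE scaler_suml; apply: eq_bigr => j _.
by rewrite -scalemxAr scalerA !mxE.
Qed.

End RegularTrace.

(** * Representations of the Deligne torus *)

Lemma mmap_morph (C : nzRingType) (A B : comNzRingType) m (g : {rmorphism A -> B})
    (f : {rmorphism C -> A}) (h : 'I_m -> A) P :
  g (mmap f h P) = mmap (g \o f) (g \o h) P.
Proof.
rewrite /mmap rmorph_sum; apply: eq_bigr => x _; rewrite rmorphM; congr (_ * _).
by rewrite /mmap1 rmorph_prod; apply: eq_bigr => i _; rewrite rmorphXn.
Qed.

Lemma dual_expz (A : comUnitRingType) (b : A) (k : int) :
  Dual 1 b ^ k = Dual 1 (k%:~R * b).
Proof.
have X j : Dual 1 b ^+ j = Dual 1 (j%:R * b).
  by rewrite dualX !expr1n mulr1 mulr_natl.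
case: k => j; first by rewrite -exprnP X.
rewrite NegzE -exprnN X; apply: (@mulrI _ (Dual 1 (j.+1%:R * b))).
  by rewrite dual_unitE unitr1.
rewrite mulrV ?dual_unitE ?unitr1// dualM mulr1 mul1r mulr1 mulrNz mulNr.
by congr Dual; exact/esym/addNr.
Qed.

Section DeligneTorusRep.
Variables (R : realType) (n : nat) (s : S_rep R n) (m : int).
Hypothesis s_pure : forall (A : comUnitRingType) (phi : {rmorphism R -> A}) (t : A),
  t \is a GRing.unit -> S_act s phi (t, 0) = (t ^ (- m))%:M.
Local Notation num := (S_rep_num s).
Local Notation den := (S_rep_den s).

(** The numerator of [s] on the line [1 + t i]; the denominator [(1 + t^2)^den] is kept apart. *)
Definition curve : 'M[{poly R}]_n :=
  map_mx (mmap (@polyC R) (tnth [tuple 1; 'X])) num.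

Lemma S_act_curve (A : comUnitRingType) (phi : {rmorphism R -> A}) t :
  S_act s phi (1, t) =
  (1 + t ^+ 2) ^- den *: map_mx (fun q => (map_poly phi q).[t]) curve.
Proof.
rewrite /S_act /Seval /Snorm /= expr1n; congr (_ *: _).
apply/matrixP => i j; rewrite !mxE.
have ct : commr_rmorph phi t by move=> x; exact: mulrC.
rewrite -[RHS]/(horner_morph ct _) mmap_morph; congr (mmap _ _ _).
  by apply: funext => x /=; rewrite horner_morphC.
apply: funext; case=> [[|[|//]] k] /=; rewrite /tnth /=.
  by rewrite rmorph1.
by rewrite horner_morphX.
Qed.

Definition curve_coef k : 'M[R]_n := map_mx (fun q : {poly R} => q`_k) curve.

Lemma curve_coef0 : curve_coef 0 = 1%:M.
Proof.
have := S_rep1 s idfun; rewrite -[LHS]/(S_act s idfun (1, 0)) S_act_curve.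
rewrite expr0n addr0 expr1n invr1 scale1r => <-.
by apply/matrixP => i j; rewrite [RHS]mxE map_poly_id// horner_coef0 mxE.
Qed.

Lemma S_actM (A : comUnitRingType) (phi : {rmorphism R -> A}) z w :
  Spoint z -> Spoint w ->
  S_act s phi (Smul z w) = S_act s phi z *m S_act s phi w.
Proof. exact: S_repM. Qed.

(** The derivative of [s] at 1 in the direction [i]; to first order the denominator is 1. *)
Definition S_lie : 'M[R]_n := curve_coef 1.

Lemma S_act_dual (A : comUnitRingType) (phi : {rmorphism R -> A}) :
  S_act s (@dual_in A \o phi : {rmorphism R -> dual A}) (1, Dual 0 1) =
  dual_mx 1%:M (map_mx phi S_lie).
Proof.
have e2 : Dual 0 1 ^+ 2 = 0 :> dual A.
  by rewrite expr2 dualM; apply: dual_eq => /=; ring.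
rewrite S_act_curve e2 addr0 expr1n invr1 scale1r.
apply/matrixP => i j; rewrite mxE [RHS]mxE map_poly_comp horner_dual mul1r.
congr Dual.
  have c0 : (curve i j)`_0 = (i == j)%:R.
    by have /matrixP/(_ i j) := curve_coef0; rewrite [LHS]mxE [RHS]mxE.
  rewrite horner_coef0 coef_map c0 [RHS]mxE.
  by case: (i == j); [exact: rmorph1|exact: rmorph0].
by rewrite horner_coef0 deriv_map coef_map coef_deriv mulr1n !mxE.
Qed.

(* The differential equation of [s] in the direction of [i], restricted to
   [1 + t i], from the multiplicativity of [s] over the dual numbers:
   [(1 + t i) (1 + eps (t + i)) = 1 + (t + eps (1 + t^2)) i]. *)
Lemma curve_ode_field (K : fieldType) (phi : {rmorphism R -> K}) t : 1 + t ^+ 2 != 0 ->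
  (1 + t ^+ 2) *: map_mx (fun q => (map_poly phi q^`()).[t]) curve =
  ((2 * den)%:R - m%:~R) * t *: map_mx (fun q => (map_poly phi q).[t]) curve +
  map_mx (fun q => (map_poly phi q).[t]) curve *m map_mx phi S_lie.
Proof.
move=> t0; set ev := fun q => (map_poly phi q).[t].
pose psi : {rmorphism R -> dual K} := @dual_in K \o phi.
pose z : dual K * dual K := (1, Dual t 0).
(* [1 + eps (t + i)] is the product of [w1], where purity yields the weight, and [w2], where the
   derivative [S_lie] appears. *)
pose w1 : dual K * dual K := (Dual 1 t, 0).
pose w2 : dual K * dual K := (1, Dual 0 1).
have zS : Spoint z.
  rewrite /Spoint /= /Snorm /= expr1n dualX dual_unitE /= unitfE.
  exact: t0.
have w1S : Spoint w1.
  rewrite /Spoint /= /Snorm /= expr0n addr0 dualX dual_unitE /= expr1n.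
  exact: unitr1.
have w2S : Spoint w2.
  rewrite /Spoint /= /Snorm /= expr1n dualX dual_unitE /= expr0n addr0.
  exact: unitr1.
have w12 : Smul w1 w2 = (Dual 1 t, Dual 0 1).
  by rewrite /Smul /w1 /w2 /=; congr (_, _); apply: dual_eq => /=; ring.
have wS : Spoint (Dual 1 t, Dual 0 1).
  rewrite /Spoint /= /Snorm /= !dualX !dual_unitE /= expr1n expr0n addr0.
  exact: unitr1.
have zw : Smul z (Dual 1 t, Dual 0 1) = (1, Dual t (1 + t ^+ 2)).
  by rewrite /Smul /z /=; congr (_, _); apply: dual_eq => /=; ring.
have := S_actM psi zS wS; rewrite zw -w12 S_actM// S_act_dual.
rewrite s_pure ?dual_unitE ?unitr1// dual_expz !S_act_curve.
set N := 1 + Dual t (1 + t ^+ 2) ^+ 2; set N' := 1 + Dual t 0 ^+ 2.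
have NE : N = N' * Dual 1 (2 * t).
  by rewrite /N /N' !dualX; apply: dual_eq => /=; rewrite ?expr1; ring.
have N'u : N' \is a GRing.unit.
  by rewrite /N' dualX dual_unitE /= unitfE.
have N2u : Dual 1 (2 * t) \is a GRing.unit by rewrite dual_unitE unitr1.
have evD b : map_mx (fun q => (map_poly psi q).[Dual t b]) curve =
    dual_mx (map_mx ev curve)
      (b *: map_mx (fun q => (map_poly phi q^`()).[t]) curve).
  apply/matrixP => i j; rewrite mxE [RHS]mxE map_poly_comp horner_dual.
  by rewrite !mxE deriv_map.
rewrite !evD scale0r => /(congr1 (fun A => N ^+ den *: A)).
have Nu : N \is a GRing.unit by rewrite NE unitrM N'u.
rewrite scalerA mulrV ?unitrX// scale1r NE exprMn -scalemxAl scalerA mulrAC.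
rewrite mulrV ?unitrX// mul1r mul_scalar_mx.
have XE : Dual 1 (2 * t) ^+ den = Dual 1 ((2 * den)%:R * t).
  by rewrite exprnP dual_expz /= natrM; congr Dual; ring.
rewrite XE -!mul_scalar_mx.
have scD (b : K) : (Dual 1 b)%:M = dual_mx 1%:M b%:M :> 'M_n.
  apply/matrixP => i j; rewrite !mxE; case: eqP => // _.
rewrite !scD !dual_mxM => /dual_mx_inj[_].
rewrite ?mul1mx ?mul0mx ?mulmx0 ?mulmx1 ?addr0 ?add0r !mul_scalar_mx => ->.
rewrite mulmxDr mul_mx_scalar -addrA addrC -scalerDl.
by congr (_ *: _ + _); rewrite mulrNz; ring.
Qed.

Lemma map_poly_tofracX (q : {poly R}) :
  (map_poly (@tofrac {poly R} \o @polyC R) q).[tofrac 'X] = tofrac q.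
Proof.
rewrite map_poly_comp horner_map; congr tofrac.
by have := comp_polyXr q; rewrite /comp_poly.
Qed.

(** The equation over fields is taken at the generic point [t = 'X] of the fraction field, where
    [1 + t^2] is nonzero. *)
Lemma curve_ode i j :
  (1 + 'X^2) * (curve i j)^`() =
  ((2 * den)%:R - m%:~R) * 'X * curve i j + \sum_k curve i k * (S_lie k j)%:P.
Proof.
pose phi : {rmorphism R -> {fraction {poly R}}} := @tofrac {poly R} \o @polyC R.
have X0 : 1 + tofrac 'X ^+ 2 != 0 :> {fraction {poly R}}.
  rewrite -tofracXn -tofrac1 -tofracD tofrac_eq0; apply/eqP => /(congr1 (coefp 0)).
  rewrite /= coefD coef1 coefXn addr0 coef0 => /eqP; exact/negP/oner_neq0.
have := curve_ode_field phi X0 => /matrixP/(_ i j); rewrite !mxE !map_poly_tofracX.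
under [X in _ = _ + X]eq_bigr do rewrite !mxE map_poly_tofracX.
move=> e; apply/eqP; rewrite -tofrac_eq; apply/eqP.
rewrite tofracM tofracD tofrac1 tofracXn e tofracD !tofracM; congr (_ * _ * _ + _).
  by rewrite tofracB rmorph_nat rmorph_int.
rewrite rmorph_sum; apply: eq_bigr => k _; by rewrite rmorphM /= !mxE.
Qed.

(** The coefficient of degree [k.+1] in [curve_ode]; the term ['X^2] times the derivative
    contributes [- k%:R]. *)
Lemma curve_coef_rec k : (k.+2)%:R *: curve_coef k.+2 =
  ((2 * den)%:R - m%:~R - k%:R) *: curve_coef k + curve_coef k.+1 *m S_lie.
Proof.
apply/matrixP => i j.
have pE p : curve_coef p i j = (curve i j)`_p by rewrite mxE.
have -> : (k.+2%:R *: curve_coef k.+2) i j = (curve i j)`_k.+2 *+ k.+2.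
  by rewrite mxE pE mulr_natl.
rewrite [RHS]mxE.
have -> : (curve_coef k.+1 *m S_lie) i j =
    (\sum_p curve i p * (S_lie p j)%:P)`_k.+1.
  rewrite mxE coef_sum; apply: eq_bigr => p _.
  by rewrite coefMC; congr (_ * _); rewrite mxE.
set c := (2 * den)%:R - m%:~R.
have cE : (2 * den)%:R - m%:~R = c%:P :> {poly R}.
  by rewrite rmorphB /= polyC_natr rmorph_int.
have := congr1 (fun q : {poly R} => q`_k.+1) (curve_ode i j).
rewrite /= [in RHS]coefD => /(canLR (addKr _)) <-.
rewrite cE [(1 + _) * _]mulrDl mul1r [X in _ = _ + (_ + X)]coefD coefXnM coef_deriv.
rewrite -mulrA coefCM coefXM /=.
have -> : ((c - k%:R) *: curve_coef k) i j = (c - k%:R) * (curve i j)`_k.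
  by rewrite mxE pE.
case: k => [|k] /=; first by rewrite subr0 addr0; ring.
rewrite subn2 /= coef_deriv -mulr_natl; ring.
Qed.

Lemma curve_coef1 : curve_coef 1 = curve_coef 0 *m S_lie.
Proof. by rewrite curve_coef0 mul1mx. Qed.

Lemma curve_coef_closed (K : set 'M[R]_n) : K 1%:M ->
  (forall a x y, K x -> K y -> K (a *: x + y)) ->
  (forall x, K x -> K (x *m S_lie)) -> forall k, K (curve_coef k).
Proof.
move=> K1 KD KS.
have K0 : K 0 by have := KD (-1) _ _ K1 K1; rewrite scaleN1r addNr.
suff H k : K (curve_coef k) /\ K (curve_coef k.+1) by move=> k; have [] := H k.
elim: k => [|k [Kk Kk1]].
  by rewrite curve_coef1 curve_coef0; split=> //; exact: KS.
split=> //; have k0 : (k.+2%:R : R) != 0 by rewrite pnatr_eq0.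
rewrite -[curve_coef k.+2]scale1r -(mulVf k0) -scalerA curve_coef_rec.
by rewrite -[_ *: _]addr0; apply: (KD) => //; apply: KD => //; exact: KS.
Qed.

Lemma S_act_curve_coef (A : comUnitRingType) (phi : {rmorphism R -> A}) t :
  S_act s phi (1, t) = (1 + t ^+ 2) ^- den *:
    \sum_(k < \max_i \max_j size (curve i j)) t ^+ k *: map_mx phi (curve_coef k).
Proof.
rewrite S_act_curve; congr (_ *: _); apply/matrixP => i j.
rewrite summxE mxE; set N := \max_i _.
have sN : (size (map_poly phi (curve i j)) <= N)%N.
  apply: leq_trans (size_poly _ _) _.
  by apply: leq_trans (leq_bigmax i); exact: (leq_bigmax j).
rewrite (horner_coef_wide _ sN); apply: eq_bigr => k _.
by rewrite !mxE coef_map mulrC.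
Qed.

(** From [(1 + i)^2 = 2 i], the Weil operator is the square of [s(1 + i)] up to a scalar, and
    [s(1 + i)] lies on the curve at [t = 1]. *)
Lemma S_act_i_closed (K : set 'M[R]_n) : K 1%:M ->
  (forall a x y, K x -> K y -> K (a *: x + y)) ->
  (forall x y, K x -> K y -> K (x *m y)) -> K S_lie -> K (S_act s idfun (0, 1)).
Proof.
move=> K1 KD KM KS.
have K0 : K 0 by have := KD (-1) _ _ K1 K1; rewrite scaleN1r addNr.
have KZ a x : K x -> K (a *: x) by move=> Kx; rewrite -[_ *: _]addr0; apply: KD.
have K11 : K (S_act s idfun (1, 1)).
  rewrite S_act_curve_coef; apply: (KZ); apply: (big_ind K) => // [x y Kx Ky|k _].
    by rewrite -[x]scale1r; apply: KD.
  apply: KZ; rewrite map_mx_id//; apply: curve_coef_closed => // x Kx; exact: KM.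
have u (x y : R) : x ^+ 2 + y ^+ 2 != 0 -> Spoint (x, y).
  by move=> xy; rewrite /Spoint /= /Snorm /= unitfE.
have two : (2 : R) != 0 by rewrite pnatr_eq0.
have p11 : Spoint ((1, 1) : R * R) by apply: u; rewrite !expr1n.
have p20 : Spoint ((2, 0) : R * R) by apply: u; rewrite expr0n addr0 expf_neq0.
have p01 : Spoint ((0, 1) : R * R) by apply: u; rewrite expr0n add0r expr1n oner_neq0.
have : S_act s idfun (Smul (1, 1) (1, 1)) = S_act s idfun (Smul (2, 0) (0, 1)).
  by congr (S_act s _); rewrite /Smul /=; congr (_, _); ring.
rewrite !S_actM// s_pure ?unitfE// mul_scalar_mx => e.
have -> : S_act s idfun (0, 1) = 2 ^ m *: (S_act s idfun (1, 1) *m S_act s idfun (1, 1)).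
  by rewrite e scalerA -expfzDr// subrr expr0z scale1r.
by apply: KZ; apply: KM.
Qed.

(** Write [x + y i = x (1 + (y / x) i)]: the first factor acts by a scalar, the second lies on the
    curve. *)
Lemma S_act_commute_field (c : 'M[R]_n) (K : fieldType) (phi : {rmorphism R -> K}) x y :
  c *m S_lie = S_lie *m c -> x != 0 -> x ^+ 2 + y ^+ 2 != 0 ->
  map_mx phi c *m S_act s phi (x, y) = S_act s phi (x, y) *m map_mx phi c.
Proof.
move=> cS x0 xy.
have zE : (x, y) = Smul (x, 0) (1, y / x).
  by rewrite /Smul /= !mulr1 !mul0r subr0 addr0 mulrCA mulfV// mulr1.
have p1 : Spoint (x, 0) by rewrite /Spoint /= /Snorm /= unitfE expr0n addr0 expf_neq0.
have p2 : Spoint (1, y / x).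
  rewrite /Spoint /= /Snorm /= unitfE expr1n exprMn exprVn.
  apply: contraNneq xy => /(congr1 ( *%R (x ^+ 2))).
  by rewrite mulr0 mulrDr mulr1 mulrCA mulfV ?expf_neq0// mulr1 => ->.
have cc k : c *m curve_coef k = curve_coef k *m c.
  apply: (@curve_coef_closed (fun d => c *m d = d *m c)); rewrite ?mulmx1 ?mul1mx//.
    by move=> a d d' e e'; rewrite mulmxDr mulmxDl -scalemxAr -scalemxAl e e'.
  by move=> d e; rewrite mulmxA e -!mulmxA cS.
rewrite zE S_actM// s_pure ?unitfE// mul_scalar_mx -scalemxAr -scalemxAl.
congr (_ *: _); rewrite S_act_curve_coef -scalemxAr -scalemxAl; congr (_ *: _).
rewrite mulmx_sumr mulmx_suml; apply: eq_bigr => k _.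
by rewrite -scalemxAr -scalemxAl -!map_mxM cc.
Qed.

(* Commutation is checked at the generic point of the Deligne torus. *)
Lemma S_act_commute (c : 'M[R]_n) (A : comUnitRingType) (phi : {rmorphism R -> A}) z :
  c *m S_lie = S_lie *m c ->
  map_mx phi c *m S_act s phi z = S_act s phi z *m map_mx phi c.
Proof.
move=> cS; pose P := {mpoly R[2]}.
pose x : P := 'X_(@Ordinal 2 0 isT); pose y : P := 'X_(@Ordinal 2 1 isT).
pose f : {rmorphism R -> {fraction P}} := @tofrac P \o @mpolyC 2 R.
have ev (p : P) : mmap (@mpolyC 2 R) (tnth [tuple x; y]) p = p.
  elim/mpoly_ring_ind: p => [a|i|p q e e'|p q e e'].
  - by rewrite mmapC.
  - rewrite mmapX mmap1U; case: i => [[|[|//]] k]; rewrite /tnth /=;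
      by congr 'X_ _; exact: val_inj.
  - by rewrite rmorphD /= e e'.
  - by rewrite rmorphM /= e e'.
have xy0 : x ^+ 2 + y ^+ 2 != 0.
  apply/eqP => /(congr1 (meval (tnth [tuple 1 : R; 0]))).
  rewrite rmorphD !rmorphXn /= !mevalXU /= /tnth /= expr1n expr0n addr0 meval0.
  exact/eqP/oner_neq0.
have x0 : x != 0.
  apply/eqP => /(congr1 (meval (tnth [tuple 1 : R; 0]))).
  rewrite /= !mevalXU /= /tnth /= meval0; exact/eqP/oner_neq0.
have := @S_act_commute_field c _ f (tofrac x) (tofrac y) cS.
rewrite -!tofracXn -tofracD !tofrac_eq0 => /(_ x0 xy0).
have numE : S_act s f (tofrac x, tofrac y) =
    Snorm (tofrac x, tofrac y) ^- den *: map_mx (@tofrac P) num.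
  rewrite /S_act /Seval; congr (_ *: _); apply/matrixP => i j; rewrite !mxE.
  rewrite -{2}[num i j]ev mmap_morph; congr (mmap _ _ _).
  by apply: funext => -[[|[|//]] k]; rewrite /tnth.
have N0 : Snorm (tofrac x, tofrac y) ^- den != 0.
  by rewrite invr_eq0 expf_neq0// /Snorm /= -!tofracXn -tofracD tofrac_eq0.
rewrite numE -scalemxAr -scalemxAl => /(scalerI N0).
have -> : map_mx f c = map_mx (@tofrac P) (map_mx (@mpolyC 2 R) c).
  by rewrite -map_mx_comp.
rewrite -!map_mxM => e.
have {}e : map_mx (@mpolyC 2 R) c *m num = num *m map_mx (@mpolyC 2 R) c.
  apply/matrixP => i j; have /matrixP/(_ i j) := e; rewrite mxE [RHS]mxE.
  by move=> /eqP; rewrite tofrac_eq => /eqP.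
have := congr1 (map_mx (mmap phi (tnth [tuple z.1; z.2]))) e.
rewrite !map_mxM; have -> : map_mx (mmap phi (tnth [tuple z.1; z.2]))
    (map_mx (@mpolyC 2 R) c) = map_mx phi c.
  by apply/matrixP => i j; rewrite !mxE mmapC.
by move=> e'; rewrite /S_act /Seval -scalemxAr -scalemxAl e'.
Qed.

End DeligneTorusRep.

(** * Centralizers and similitudes *)

Section GenericMatrix.
Variable n : nat.

Definition generic_mx : 'M[{mpoly rat[n * n]}]_n :=
  \matrix_(i, j) 'X_(mxvec_index i j).

Definition const_mpoly_mx (c : 'M[rat]_n) : 'M[{mpoly rat[n * n]}]_n :=
  map_mx (@mpolyC _ _) c.

Section Eval.
Variables (A : comUnitRingType) (A_Q : is_Q_algebra A) (g : 'M[A]_n).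

Definition eval_entries : {rmorphism {mpoly rat[n * n]} -> A} :=
  mmap (Qalg_in A_Q) (fun k => mxvec g 0 k).

Lemma eval_generic_mx : map_mx eval_entries generic_mx = g.
Proof.
by apply/matrixP => i j; rewrite !mxE /eval_entries /= mmapX mmap1U mxvecE.
Qed.

Lemma eval_const_mpoly_mx c : map_mx eval_entries (const_mpoly_mx c) = map_mx ratr c.
Proof. by apply/matrixP => i j; rewrite !mxE /eval_entries /= mmapC. Qed.

End Eval.

Lemma map_ratr_morph (A B : comUnitRingType) (f : {rmorphism A -> B}) (c : 'M[rat]_n) :
  is_Q_algebra A -> map_mx f (map_mx ratr c) = map_mx ratr c.
Proof. by move=> A_Q; apply/matrixP => i j; rewrite !mxE morph_ratr. Qed.

Section Centralizer.
Variable c : 'M[rat]_n.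

Definition centralizer_eqs : set {mpoly rat[n * n]} :=
  [set P | exists i j, P = (generic_mx *m const_mpoly_mx c -
                            const_mpoly_mx c *m generic_mx) i j].

Lemma centralizer_eqsP (A : comUnitRingType) (g : 'M[A]_n) : is_Q_algebra A ->
  GLn_zeros centralizer_eqs A g <->
  g \in unitmx /\ g *m map_mx ratr c = map_mx ratr c *m g.
Proof.
move=> A_Q; have E i j : mmap ratr (fun k => mxvec g 0 k)
    ((generic_mx *m const_mpoly_mx c - const_mpoly_mx c *m generic_mx) i j) =
    (g *m map_mx ratr c - map_mx ratr c *m g) i j.
  have /matrixP/(_ i j) : map_mx (eval_entries A_Q g)
      (generic_mx *m const_mpoly_mx c - const_mpoly_mx c *m generic_mx) =
      g *m map_mx ratr c - map_mx ratr c *m g.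
    by rewrite map_mxB !map_mxM eval_generic_mx eval_const_mpoly_mx.
  by rewrite mxE => <-.
split=> [[gu gP]|[gu gc]]; split=> //.
  apply/eqP; rewrite -subr_eq0; apply/eqP/matrixP => i j; rewrite -E [RHS]mxE.
  by apply: gP; exists i, j.
by move=> _ [i [j ->]]; rewrite E gc subrr mxE.
Qed.

Lemma comm_invmx (A : comUnitRingType) (g d : 'M[A]_n) : g \in unitmx ->
  g *m d = d *m g -> invmx g *m d = d *m invmx g.
Proof.
move=> gu e; apply: (can_inj (mulKmx gu)); apply: (can_inj (mulmxK gu)).
by rewrite !mulmxA mulmxV// mul1mx -!mulmxA mulVmx// mulmx1.
Qed.

Definition centralizer : Q_subgroup n.
Proof.
exists centralizer_eqs => [A|A g h|A g] A_Q; rewrite !centralizer_eqsP//.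
- by rewrite unitmx1 mul1mx mulmx1.
- move=> [gu gc] [hu hc]; rewrite unitmx_mul gu; split=> //.
  by rewrite -mulmxA hc mulmxA gc mulmxA.
- by move=> [gu gc]; rewrite unitmx_inv; split=> //; exact: comm_invmx.
Defined.

End Centralizer.

Section Similitudes.
Variables (Psi : 'M[rat]_n) (k0 l0 : 'I_n).
Hypothesis Psi_neq0 : Psi k0 l0 != 0.

Let gram_mx := generic_mx^T *m const_mpoly_mx Psi *m generic_mx.

(** The multiplier is eliminated by comparison with the nonzero entry at [(k0, l0)], leaving
    polynomial equations in the matrix entries. *)
Definition similitude_eqs : set {mpoly rat[n * n]} :=
  [set P | exists i j, P = gram_mx i j * (Psi k0 l0)%:MP -
                           gram_mx k0 l0 * (Psi i j)%:MP].

Lemma similitude_eqsP (A : comUnitRingType) (g : 'M[A]_n) : is_Q_algebra A ->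
  GLn_zeros similitude_eqs A g <-> g \in unitmx /\ exists nu,
    g^T *m map_mx ratr Psi *m g = nu *: map_mx ratr Psi.
Proof.
move=> A_Q; pose G := g^T *m map_mx ratr Psi *m g.
have uP : (ratr (Psi k0 l0) : A) \is a GRing.unit.
  by rewrite -[ratr _]/(Qalg_in A_Q _) rmorph_unit// unitfE.
have E0 i j : eval_entries A_Q g (gram_mx i j) = G i j.
  have /matrixP/(_ i j) : map_mx (eval_entries A_Q g) gram_mx = G.
    by rewrite !map_mxM -map_trmx eval_generic_mx eval_const_mpoly_mx.
  by rewrite mxE => <-.
have E i j : mmap ratr (fun k => mxvec g 0 k)
    (gram_mx i j * (Psi k0 l0)%:MP - gram_mx k0 l0 * (Psi i j)%:MP) =
    G i j * ratr (Psi k0 l0) - G k0 l0 * ratr (Psi i j).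
  rewrite -[LHS]/(eval_entries A_Q g _) rmorphB !rmorphM !E0 /eval_entries /=.
  by rewrite !mmapC.
split=> [[gu gP]|[gu [nu gc]]]; split=> //.
  exists (G k0 l0 / ratr (Psi k0 l0)); apply/matrixP => i j.
  have /eqP := gP _ (ex_intro _ i (ex_intro _ j erefl)); rewrite E subr_eq0 => /eqP e.
  by rewrite [RHS]mxE [X in _ = _ * X]mxE mulrAC -e mulrK.
move=> _ [i [j ->]]; rewrite E /G gc !mxE; ring.
Qed.

Definition similitudes : Q_subgroup n.
Proof.
exists similitude_eqs => [A|A g h|A g] A_Q; rewrite !similitude_eqsP//.
- by rewrite unitmx1; split=> //; exists 1; rewrite trmx1 mul1mx mulmx1 scale1r.
- move=> [gu [nu gc]] [hu [mu hc]]; rewrite unitmx_mul gu; split=> //.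
  exists (mu * nu); rewrite trmx_mul.
  transitivity (h^T *m (g^T *m map_mx ratr Psi *m g) *m h); first by rewrite !mulmxA.
  by rewrite gc -scalemxAr -scalemxAl hc scalerA mulrC.
- move=> [gu [nu gc]]; rewrite unitmx_inv; split=> //.
  have e : map_mx ratr Psi = nu *: ((invmx g)^T *m map_mx ratr Psi *m invmx g) :> 'M[A]_n.
    have gTu : g^T \in unitmx by rewrite unitmx_tr.
    rewrite scalemxAl scalemxAr -gc trmx_inv.
    by rewrite !mulmxA mulVmx// mul1mx mulmxK.
  have uP : (ratr (Psi k0 l0) : A) \is a GRing.unit.
    by rewrite -[ratr _]/(Qalg_in A_Q _) rmorph_unit// unitfE.
  (* [A] need not be a field; [nu] is a unit because it divides the unit [ratr (Psi k0 l0)]. *)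
  have nuu : nu \is a GRing.unit.
    have /(congr1 (fun B : 'M[A]_n => B k0 l0)) := e.
    by rewrite mxE [RHS]mxE => e'; move: uP; rewrite e' unitrM => /andP[].
  by exists nu^-1; rewrite [in RHS]e scalerA mulVr// scale1r.
Defined.

End Similitudes.
End GenericMatrix.

(** * Consequences of the minimality of the Mumford-Tate group *)

Lemma numField_Q_algebra (F : numFieldType) : is_Q_algebra F.
Proof. by apply: Q_algebra_char0 => k; rewrite pnatr_eq0. Qed.

(** [Lie] is the solution space of a linear system with rational coefficients, which a finite
    subsystem already generates, and kernels commute with field extension. *)
Lemma Lie_base_change n (M : Q_subgroup n) (F : fieldType) (H : 'M[F]_n) :
  is_Q_algebra F -> @Lie n M F H ->
  mx_span [set map_mx ratr X | X in @Lie n M rat] H.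
Proof.
move=> F_Q HL; have rat_Q := numField_Q_algebra rat.
pose f : {rmorphism rat -> F} := Qalg_in F_Q.
pose grad (P : {mpoly rat[n * n]}) : 'rV[rat]_(n * n) :=
  \row_k mmap ratr (fun k => mxvec (1%:M : 'M[rat]_n) 0 k) P^`M(k).
have [k [B [BP BE]]] := rows_generating (grad @` Q_subgroup_eqs M).
have fgrad P j : f (grad P 0 j) = mmap ratr (fun k => mxvec (1%:M : 'M[F]_n) 0 k) P^`M(j).
  rewrite mxE mmap_ratr_morph//; congr mmap; apply: funext => j' /=.
  by rewrite -(mxvec_map f) map_mx1.
have HB : mxvec H *m map_mx f B^T = 0.
  apply/rowP => i; rewrite mxE [RHS]mxE; have [P EP PE] := BP i.
  rewrite -[RHS](HL P EP); apply: eq_bigr => j _.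
  by rewrite mxE -fgrad PE !mxE.
have /submxP[r rE] : (mxvec H <= map_mx f (kermx B^T))%MS.
  by rewrite map_kermx; apply/sub_kermxP.
pose K := kermx B^T.
have KL i : @Lie n M rat (vec_mx (row i K)).
  move=> P EP; rewrite vec_mxK.
  have KB : row i K *m B^T = 0 by rewrite -row_mul mulmx_ker row0.
  have /BE/submxP[d dE] : (grad @` Q_subgroup_eqs M) (grad P) by exists P.
  have : row i K *m (grad P)^T = 0 by rewrite dE trmx_mul mulmxA KB mul0mx.
  move=> /matrixP/(_ 0 0); rewrite mxE [RHS]mxE => {2}<-.
  by apply: eq_bigr => j _; rewrite [(grad P)^T _ _]mxE [grad P _ _]mxE.
exists (n * n)%N, (fun i => r 0 i), (fun i => map_mx ratr (vec_mx (row i K))).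
split=> [i|]; first by exists (vec_mx (row i K)).
apply: (can_inj mxvecK); rewrite rE mulmx_sum_row linear_sum.
apply: eq_bigr => i _; rewrite linearZ /=; congr (_ *: _).
by rewrite -[RHS](map_mxvec f) vec_mxK map_row.
Qed.

Section MumfordTate.
Variables (R : realType) (V : vectType rat) (VZ : set V) (hs : polarised_HS R VZ).
Variables (M : Q_subgroup (vdim V)) (M_MT : is_Mumford_Tate (HS_rep hs) M).
Local Notation s := (HS_rep hs).
Local Notation n := (vdim V).
Let R_Q : is_Q_algebra R := numField_Q_algebra R.

Lemma S_act_unit (A : comUnitRingType) (phi : {rmorphism R -> A}) z :
  Spoint z -> S_act s phi z \in unitmx.
Proof.
move=> zS; pose N := Snorm z.
pose w : A * A := (z.1 / N, - z.2 / N).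
have NE : N = z.1 ^+ 2 + z.2 ^+ 2 by [].
have zw : Smul z w = (1, 0).
  rewrite /Smul /w /=; congr (_, _); last by ring.
  by rewrite -[RHS](divrr zS) -/N; rewrite [in X in _ = X / _]NE; ring.
have wS : Spoint w.
  rewrite /Spoint /= /Snorm /=.
  have -> : (z.1 / N) ^+ 2 + (- z.2 / N) ^+ 2 = N * N^-1 ^+ 2.
    by rewrite [in X in _ = X * _]NE; ring.
  by rewrite unitrM unitrX ?unitrV// andbT.
suff /mulmx1_unit[] : S_act s phi z *m S_act s phi w = 1%:M by [].
by rewrite -S_actM// zw; exact: S_rep1.
Qed.

Lemma S_lie_Lie : @Lie n M R (S_lie s).
Proof.
apply/Lie_dualP; first exact: R_Q.
have := S_act_dual s (A := R) idfun; rewrite map_mx_id// => <-.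
apply: (M_MT.1); rewrite /Spoint /= /Snorm /= expr1n expr2 dualM dual_unitE /=.
by rewrite mul0r addr0 unitr1.
Qed.

(** By minimality it is enough that [s] factors through the centralizer of [c]. This follows from
    commutation with [S_lie], which is a real combination of rational elements of the Lie
    algebra. *)
Lemma Mumford_Tate_commute (c : 'M[rat]_n) :
  (forall X, @Lie n M rat X -> X *m c = c *m X) ->
  forall (A : comUnitRingType) g, is_Q_algebra A -> Q_subgroup_pts M A g ->
    g *m map_mx ratr c = map_mx ratr c *m g.
Proof.
move=> cL A g A_Q gM.
suff sc : S_factors_through s (centralizer c).
  have := M_MT.2 _ sc A A_Q g gM.
  by move=> /(@centralizer_eqsP _ _ _ _ A_Q)[].
move=> B phi z zS; have B_Q := Q_algebra_morph phi R_Q.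
apply/(@centralizer_eqsP _ _ _ _ B_Q); split; first exact: S_act_unit.
rewrite -(map_ratr_morph phi c R_Q); apply/esym.
apply: (@S_act_commute R n s (HS_weight hs) (@HS_pure _ _ _ hs)).
have [k [r [Y [YL ->]]]] := Lie_base_change R_Q S_lie_Lie.
rewrite mulmx_sumr mulmx_suml; apply: eq_bigr => i _.
have [Z ZL <-] := YL i.
by rewrite -scalemxAr -scalemxAl -!map_mxM cL.
Qed.

Definition form_mx : 'M[rat]_n := bc_form rat (HS_form hs).

Lemma bc_form_ratr (A : comUnitRingType) :
  bc_form A (HS_form hs) = map_mx ratr form_mx.
Proof.
apply/matrixP => i j; rewrite !mxE; congr ratr.
exact: (@fmorph_eq_rat rat idfun).
Qed.

Local Notation J := (S_act s idfun (0, 1)).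
Local Notation Q := (map_mx ratr form_mx *m J).

Lemma weil_posdef : posdef (Q : 'M[R]_n).
Proof.
split=> [|x x0]; first by have := HS_form_sym hs; rewrite /= bc_form_ratr.
by have := HS_form_pos hs x0; rewrite /= bc_form_ratr.
Qed.

Lemma form_mx_unit : form_mx \in unitmx.
Proof.
have := posdef_unit weil_posdef; rewrite unitmx_mul => /andP[+ _].
by rewrite map_unitmx.
Qed.

(** The Deligne torus multiplies the polarisation by a power of the norm, and minimality transfers
    this to [M]. Positive dimension supplies a nonzero entry of the form. *)
Lemma Mumford_Tate_similitude : (0 < n)%N ->
  forall (A : comUnitRingType) g, is_Q_algebra A -> Q_subgroup_pts M A g ->
    exists nu, g^T *m map_mx ratr form_mx *m g = nu *: map_mx ratr form_mx.
Proof.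
move=> n0 A g A_Q gM.
have [k0 [l0 kl]] : exists k0 l0, form_mx k0 l0 != 0.
  apply: contrapT => /forallNP nz.
  have : form_mx = 0.
    apply/matrixP => i j; rewrite [RHS]mxE; apply/eqP; apply: contrapT => /negP f0.
    by apply: (nz i); exists j.
  move=> f0; have := mulmxV form_mx_unit; rewrite f0 mul0mx.
  by move=> /matrixP/(_ (Ordinal n0) (Ordinal n0)); rewrite !mxE eqxx.
suff ss : S_factors_through s (similitudes kl).
  have := M_MT.2 _ ss A A_Q g gM.
  by move=> /(similitude_eqsP kl _ A_Q)[].
move=> B phi z zS; have B_Q := Q_algebra_morph phi R_Q.
apply/(similitude_eqsP kl _ B_Q); split; first exact: S_act_unit.
exists (Snorm z ^ (- HS_weight hs)).
by have := HS_form_equivariant hs phi zS; rewrite bc_form_ratr.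
Qed.

Lemma weil_square : J *m J = (-1) ^ (- HS_weight hs) *: 1%:M.
Proof.
have p01 : Spoint ((0, 1) : R * R).
  by rewrite /Spoint /= /Snorm /= expr0n add0r expr1n unitr1.
rewrite -S_actM//; have -> : Smul (0, 1) (0, 1) = (-1, 0) :> R * R.
  by rewrite /Smul /=; congr (_, _); ring.
by rewrite (@HS_pure _ _ _ hs) ?unitrN1// scalemx1.
Qed.

End MumfordTate.

Lemma subspace_basis (F : fieldType) m p (B : set 'M[F]_(m, p)) :
  B 0 -> (forall c x y, B x -> B y -> B (c *: x + y)) ->
  exists k (a : 'I_k -> 'M[F]_(m, p)), [/\ row_free (\matrix_i mxvec (a i)),
    forall i, B (a i) & forall x, B x -> exists v : 'I_k -> F, x = \sum_i v i *: a i].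
Proof.
move=> B0 BD; have [k [C [CB CP]]] := rows_generating (mxvec @` B).
have sB x : (mxvec x <= C)%MS -> B x.
  move=> /submxP[c cE].
  have -> : x = \sum_i c 0 i *: vec_mx (row i C).
    apply: (can_inj mxvecK); rewrite cE mulmx_sum_row linear_sum.
    by apply: eq_bigr => i _; rewrite linearZ /= vec_mxK.
  apply: (big_rec B) => // i y _ By; apply: (BD) => //.
  by have [z Bz <-] := CB i; rewrite mxvecK.
pose a i := vec_mx (row i (row_base C)) : 'M[F]_(m, p).
have aE : \matrix_i mxvec (a i) = row_base C.
  by apply/row_matrixP => i; rewrite rowK vec_mxK.
exists (\rank C), a; rewrite aE row_base_free; split=> // [i|x Bx].
  apply: sB; rewrite vec_mxK; apply: submx_trans (row_sub i _) _.
  by rewrite eq_row_base.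
have /submxP[c cE] : (mxvec x <= row_base C)%MS.
  by rewrite eq_row_base; apply: CP; exists x.
exists (fun i => c 0 i); apply: (can_inj mxvecK).
rewrite cE mulmx_sum_row linear_sum; apply: eq_bigr => i _.
by rewrite linearZ /= vec_mxK.
Qed.

Lemma row_free_lin_indep (F : fieldType) n d (a : 'I_d -> 'M[F]_n) :
  row_free (\matrix_i mxvec (a i)) -> lin_indep a.
Proof.
move=> a_free v v0 i; pose w := \row_i v i.
suff : w = 0 by move=> /rowP/(_ i); rewrite !mxE.
apply/eqP; rewrite -(mulmx_free_eq0 w a_free) mulmx_sum_row; apply/eqP.
transitivity (mxvec (\sum_i v i *: a i)); last by rewrite v0 linear0.
by rewrite linear_sum; apply: eq_bigr => j _; rewrite rowK linearZ mxE.
Qed.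

(** * The separability idempotent of the span of [U] *)

Section CasimirElement.
Variables (R : realType) (V : vectType rat) (VZ : set V) (hs : polarised_HS R VZ).
Variables (M : Q_subgroup (vdim V)) (M_MT : is_Mumford_Tate (HS_rep hs) M).
Local Notation s := (HS_rep hs).
Local Notation n := (vdim V).
Local Notation J := (S_act s idfun (0, 1)).
Variables (F : fieldType) (F_Q : is_Q_algebra F) (U : set 'M[F]_n).
Hypothesis U1 : U 1%:M.
Hypothesis UM : forall u v, U u -> U v -> U (u *m v).
Hypothesis UV : forall u, U u -> exists2 v, U v & u *m v = 1%:M.
Hypothesis U_MT : U `<=` Q_subgroup_pts M F.
Hypothesis U_Lie : forall X, @Lie n M F X -> mx_span U X.

Local Notation f := (Qalg_in F_Q).
Local Notation psi := (form_mx hs).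

(** This rational algebra links the two sides: it is defined through [F], and its trace form is
    studied over the reals. *)
Let B : set 'M[rat]_n := [set x | mx_span U (map_mx ratr x)].

Let B_lin c x y : B x -> B y -> B (c *: x + y).
Proof.
move=> Bx By; rewrite /B /= -[map_mx _ _]/(map_mx f _) map_mxD map_mxZ.
exact: mx_span_lin.
Qed.

Let B0 : B 0.
Proof. by rewrite /B /= -[map_mx _ _]/(map_mx f _) map_mx0; exact: mx_span0. Qed.

Let B1 : B 1%:M.
Proof. by rewrite /B /= -[map_mx _ _]/(map_mx f _) map_mx1; exact: mx_span_sub. Qed.

Let B_mul x y : B x -> B y -> B (x *m y).
Proof.
move=> Bx By; rewrite /B /= -[map_mx _ _]/(map_mx f _) map_mxM.
exact: mx_span_mul.
Qed.

Let B_Lie X : @Lie n M rat X -> B X.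
Proof. by move=> XL; apply: U_Lie; exact: (@Lie_morph _ _ _ _ f _ (numField_Q_algebra rat)). Qed.

(** For a similitude [u] with multiplier [nu], the adjoint for [psi] is [nu u^-1], and [U] contains
    [u^-1]. *)
Let B_adj (n_gt0 : (0 < n)%N) x : B x -> B (invmx psi *m x^T *m psi).
Proof.
move=> [k [c [u [uU xE]]]]; rewrite /B /= -[map_mx _ _]/(map_mx f _) !map_mxM.
rewrite -map_trmx [map_mx f x]xE linear_sum mulmx_sumr mulmx_suml.
under eq_bigr do rewrite linearZ /= -scalemxAr -scalemxAl.
apply: mx_span_sum => i; have [v Uv uv] := UV (uU i).
have [nu e] := Mumford_Tate_similitude M_MT n_gt0 F_Q (U_MT (uU i)).
have -> : map_mx f (invmx psi) *m (u i)^T *m map_mx f psi = nu *: v.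
  have pu : map_mx f psi \in unitmx by rewrite map_unitmx form_mx_unit.
  rewrite map_invmx; apply: (can_inj (mulKmx pu)).
  rewrite !mulmxA mulmxV// mul1mx -scalemxAr scalemxAl -e.
  by rewrite -!mulmxA uv mulmx1.
exact/mx_spanZ/mx_span_sub.
Qed.

Lemma casimir_element : exists (I : finType) (a b : I -> 'M[F]_n),
  [/\ forall i, mx_span U (a i), \sum_i b i *m a i = 1%:M &
      forall g, commutes_with U (\sum_i a i *m g *m b i)].
Proof.
(* In dimension 0 all matrices coincide and the empty family works; otherwise [B_adj] is
   available. *)
have [n0|n_gt0] := posnP n.
  have n0E (x y : 'M[F]_n) : x = y.
    by apply/matrixP => i; have := ltn_ord i; rewrite [X in (_ < X)%N]n0.
  by exists void, (fun=> 0), (fun=> 0); split=> // g u _; exact: n0E.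
have [d [a [a_free aB aP]]] := subspace_basis B0 B_lin.
have [u uE] := aP _ B1.
have /choice[L' L'E] : forall ij : 'I_d * 'I_d, exists v : 'I_d -> rat,
    a ij.1 *m a ij.2 = \sum_p v p *: a p.
  by move=> [i j]; apply: aP; apply: B_mul.
pose L i : 'M[rat]_d := \matrix_(p, j) L' (i, j) p.
have aL : structure_constants a L.
  move=> i j; rewrite (L'E (i, j)); apply: eq_bigr => p _.
  by rewrite mxE.
pose fR : {rmorphism rat -> R} := ratr.
pose aR i := map_mx fR (a i); pose LR i := map_mx fR (L i).
have mapsum (G : fieldType) (h : {rmorphism rat -> G}) (v : 'I_d -> rat) :
    map_mx h (\sum_i v i *: a i) = \sum_i h (v i) *: map_mx h (a i).
  by rewrite raddf_sum; apply: eq_bigr => i _; rewrite /= map_mxZ.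
have aRL : structure_constants aR LR.
  by move=> i j; rewrite -map_mxM aL mapsum; apply: eq_bigr => p _; rewrite [LR _ _ _]mxE.
have aR_free : lin_indep aR.
  apply: row_free_lin_indep; have := a_free; rewrite -(row_free_map fR).
  congr (row_free _); apply/row_matrixP => i.
  by rewrite -map_row !rowK map_mxvec.
have uR : \sum_i fR (u i) *: aR i = 1%:M by rewrite -mapsum -uE map_mx1.
pose K : set 'M[R]_n := [set x | exists v : 'I_d -> R, x = \sum_i v i *: aR i].
have KB x : B x -> K (map_mx ratr x).
  by move=> /aP[v ->]; exists (fun i => fR (v i)); rewrite -mapsum.
have K1 : K 1%:M by exists (fun i => fR (u i)); rewrite uR.
have Klin c x y : K x -> K y -> K (c *: x + y).
  move=> [v ->] [w ->]; exists (fun i => c * v i + w i).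
  rewrite scaler_sumr -big_split; apply: eq_bigr => i _ /=.
  by rewrite scalerDl scalerA.
have K0 : K 0 by exists (fun=> 0); rewrite big1// => i _; rewrite scale0r.
have KZ c x : K x -> K (c *: x).
  by move=> Kx; rewrite -[_ *: _]addr0; apply: Klin.
have Ksum (I : finType) (c : I -> R) (x : I -> 'M[R]_n) : (forall i, K (x i)) ->
    K (\sum_i c i *: x i).
  by move=> Kx; apply: (big_rec K) => // i y _ Ky; apply: Klin.
have Kmul x y : K x -> K y -> K (x *m y).
  move=> [v ->] [w ->]; rewrite mulmx_suml.
  under eq_bigr do rewrite -scalemxAl mulmx_sumr.
  apply: (Ksum) => i; under eq_bigr do rewrite -scalemxAr.
  by apply: Ksum => j; rewrite -map_mxM; apply: KB; apply: B_mul.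
have Ks : K (S_lie s).
  have [k [c [y [yL ->]]]] := Lie_base_change (numField_Q_algebra R) (S_lie_Lie M_MT).
  by apply: Ksum => i; have [X XL <-] := yL i; apply/KB/B_Lie.
have KJ : K J.
  by apply: (S_act_i_closed (@HS_pure _ _ _ hs)).
(* The adjoint of [a i] for [psi J] is [J^-1 D J], with [D] its adjoint for [psi]. As [J^2] is the
   scalar [e], the inverse of [J] is [e^-1 J], so the adjoint stays in [K]. *)
have /choice[t tE] : forall i, exists v : 'I_d -> R,
    map_mx ratr psi *m J *m (\sum_j v j *: aR j) = (aR i)^T *m (map_mx ratr psi *m J).
  move=> i; pose D := invmx psi *m (a i)^T *m psi.
  pose e : R := (-1) ^ (- HS_weight hs).
  have e0 : e != 0 by rewrite expfz_neq0// oppr_eq0 oner_neq0.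
  have [v vE] : K (e^-1 *: (J *m map_mx ratr D *m J)).
    by apply: (KZ); apply: (Kmul) => //; apply: (Kmul) => //; apply/KB/B_adj.
  exists v; rewrite -vE -scalemxAr -!mulmxA (mulmxA J J) weil_square -/e.
  rewrite -scalemxAl mul1mx -scalemxAr scalerA mulVf// scale1r !mulmxA.
  congr (_ *m _); rewrite -map_mxM /D !mulmxA mulmxV ?form_mx_unit// mul1mx map_mxM.
  by rewrite map_trmx.
have Gu : regular_gram L \in unitmx.
  (* Invertibility of a rational matrix can be tested over the reals, where positivity applies. *)
  have -> : (regular_gram L \in unitmx) = (regular_gram LR \in unitmx).
    rewrite -(map_unitmx fR); suff -> : map_mx fR (regular_gram L) = regular_gram LR by [].
    apply/matrixP => i j.
    by rewrite !mxE -map_mxM trace_map_mx.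
  rewrite -row_free_unit -kermx_eq0; apply/eqP/row_matrixP => i.
  rewrite row0; apply: (regular_gram_inj aR_free aRL uR (weil_posdef hs) tE).
  by rewrite -row_mul mulmx_ker row0.
have [c [c1 cC]] := casimir_idempotent (row_free_lin_indep a_free) aL (esym uE) Gu.
pose a' (ij : 'I_d * 'I_d) := f (c ij.1 ij.2) *: map_mx f (a ij.1).
pose b' (ij : 'I_d * 'I_d) := map_mx f (a ij.2).
exists ('I_d * 'I_d)%type, a', b'; split.
- by move=> [i j]; apply: mx_spanZ; exact: aB.
- rewrite -[RHS](map_mx1 f) -c1 raddf_sum.
  rewrite -(pair_big xpredT xpredT (fun i j => b' (i, j) *m a' (i, j))) /=.
  apply: eq_bigr => i _; rewrite raddf_sum; apply: eq_bigr => j _ /=.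
  by rewrite map_mxZ map_mxM -scalemxAr.
move=> g.
(* [Mumford_Tate_commute] concerns rational matrices, so [g] is expanded in elementary matrices,
   whose averages [y k l] are rational. *)
pose y k l := \sum_i \sum_j c i j *: (a i *m delta_mx k l *m a j).
have yE : \sum_i a' i *m g *m b' i = \sum_k \sum_l g k l *: map_mx f (y k l).
  transitivity (\sum_i \sum_k \sum_l g k l *: (a' i *m delta_mx k l *m b' i)).
    apply: eq_bigr => ij _; rewrite {1}(matrix_sum_delta g) mulmx_sumr mulmx_suml.
    apply: eq_bigr => k _; rewrite mulmx_sumr mulmx_suml; apply: eq_bigr => l _.
    by rewrite -scalemxAr -scalemxAl.
  rewrite exchange_big; apply: eq_bigr => k _; rewrite exchange_big.
  apply: eq_bigr => l _; rewrite -scaler_sumr; congr (_ *: _).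
  rewrite -(pair_big xpredT xpredT (fun i j => a' (i, j) *m delta_mx k l *m b' (i, j))) /=.
  rewrite raddf_sum; apply: eq_bigr => i _; rewrite raddf_sum; apply: eq_bigr => j _ /=.
  by rewrite map_mxZ !map_mxM map_delta_mx -!scalemxAl.
have yU k l : commutes_with U (map_mx f (y k l)).
  move=> v Uv; apply/esym.
  apply: (Mumford_Tate_commute M_MT _ F_Q (U_MT Uv)) => X /B_Lie/aP[w ->].
  rewrite mulmx_suml mulmx_sumr; apply: eq_bigr => i _.
  by rewrite -scalemxAl -scalemxAr cC.
move=> v Uv; rewrite yE mulmx_suml mulmx_sumr; apply: eq_bigr => k _.
rewrite mulmx_suml mulmx_sumr; apply: eq_bigr => l _.
by rewrite -scalemxAl -scalemxAr yU.
Qed.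

End CasimirElement.

(** * The lattice and the topology *)

Lemma GL_stabP (F : fieldType) (S : subringClosed F) n (P : 'M[F]_n)
    (Lam : set 'cV[F]_n) : P \in unitmx ->
  (forall w, Lam w <-> exists2 x, x \is a mxOver S & w = P *m x) ->
  forall g, GL_stab S P g <-> g \in unitmx /\ [set g *m x | x in Lam] = Lam.
Proof.
move=> Pu LamP g.
have colS (A : 'M[F]_n) : (forall j, col j A \is a mxOver S) -> A \is a mxOver S.
  move=> AS; apply/mxOverP => i j; have /mxOverP/(_ i 0) := AS j.
  by rewrite mxE.
have col_mul (A : 'M[F]_n) j : col j (A *m P) = A *m col j P by rewrite !colE mulmxA.
have colP j : Lam (col j P).
  apply/LamP; exists (delta_mx j 0); last by rewrite colE.
  by apply/mxOverP => i k; rewrite mxE rpred_nat.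
split=> [[gu gI gV]|[gu gL]]; split=> //.
- apply/seteqP; split=> [_ [_ /LamP[x xS ->] <-]|_ /LamP[x xS ->]].
    apply/LamP; exists (invmx P *m g *m P *m x); first exact: mxOverM.
    by rewrite !mulmxA mulmxV// mul1mx.
  exists (P *m (invmx P *m invmx g *m P *m x)).
    by apply/LamP; eexists; [|reflexivity]; exact: mxOverM.
  by rewrite !mulmxA mulmxK// mulmxV// mul1mx.
- apply: colS => j; rewrite col_mul.
  have : Lam (g *m col j P) by rewrite -gL; exists (col j P).
  by move=> /LamP[x xS e]; rewrite -mulmxA e mulmxA mulVmx// mul1mx.
- apply: colS => j; rewrite col_mul.
  have : [set g *m x | x in Lam] (col j P) by rewrite gL.
  move=> [_ /LamP[x xS ->] <-].
  by rewrite -!mulmxA mulKmx// mulKmx.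
Qed.

Section LatticeBasis.
Variables (l : nat) (l_prime : prime l) (V : vectType rat).
Local Notation Ql := (Qadic l_prime).
Local Notation n := (vdim V).
Local Notation e := (vbasis (fullv : {vspace V})).
Local Notation f := (Qalg_in (Qadic_Q_algebra l_prime)).
Variable b : n.-tuple V.
Hypothesis b_basis : basis_of fullv b.

Definition lattice_mx : 'M[rat]_n := (\matrix_(i < n) rVof e b`_i)^T.

Lemma lattice_mx_unit : lattice_mx \in unitmx.
Proof.
rewrite unitmx_tr -row_free_unit -kermx_eq0; apply/eqP/row_matrixP => i.
rewrite row0; set v := row i _.
have : v *m (\matrix_(i < n) rVof e b`_i) = 0 by rewrite -row_mul mulmx_ker row0.
rewrite mulmx_sum_row; under eq_bigr do rewrite rowK -linearZ.
rewrite -linear_sum => /(congr1 (vecof e)); rewrite rVofK ?linear0 => [v0|].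
  have /freeP bf := basis_free b_basis.
  by apply/rowP => j; rewrite [RHS]mxE; apply: (bf (fun j => v 0 j)).
exact: vbasisP.
Qed.

Lemma bc_vec_lattice (m : 'I_n -> int) :
  bc_vec Ql (\sum_(i < n) b`_i *~ m i) = map_mx ratr lattice_mx *m \col_i (m i)%:~R.
Proof.
rewrite /bc_vec -[map_mx _ _]/(map_mx f _) -[map_mx _ lattice_mx]/(map_mx f _).
have -> : rVof e (\sum_(i < n) b`_i *~ m i) = (\row_i (m i)%:~R) *m \matrix_(i < n) rVof e b`_i.
  rewrite mulmx_sum_row linear_sum; apply: eq_bigr => i _.
  by rewrite rowK -scaler_int linearZ mxE.
rewrite map_trmx trmx_mul map_mxM; congr (_ *m _).
by apply/matrixP => i j; rewrite !mxE rmorph_int.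
Qed.

Lemma lattice_lP (VZ : set V) :
  VZ = [set v : V | exists c : 'I_n -> int, v = \sum_(i < n) b`_i *~ c i] ->
  forall w, @lattice_l l l_prime V VZ w <->
    exists2 x, x \is a mxOver (@Qint l l_prime) & w = map_mx ratr lattice_mx *m x.
Proof.
move=> VZE w; split=> [[k [c [x [xV ->]]]]|[x xS ->]].
  have /choice[m mE] : forall i, exists m : 'I_n -> int,
      x i = map_mx ratr lattice_mx *m \col_j (m j)%:~R.
    move=> i; have [v + <-] := xV i; rewrite VZE => -[m ->].
    by exists m; exact: bc_vec_lattice.
  exists (\sum_i Zadic_val (c i) *: \col_j (m i j)%:~R).
    rewrite rpred_sum// => i _; apply: mxOverZ; first exact: Qint_val.
    by apply/mxOverP => p q; rewrite mxE rpred_int.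
  rewrite mulmx_sumr; apply: eq_bigr => i _; rewrite mE scalemxAr.
  by [].
have /choice[c cE] : forall i, exists c, x i 0 = Zadic_val c.
  by move=> i; apply/QintP; have /mxOverP := xS; apply.
exists n, c, (fun i => bc_vec Ql b`_i); split=> [i|].
  exists b`_i => //; rewrite VZE; exists (fun j => (j == i)%:R).
  rewrite (bigD1 i)//= eqxx mulr1z big1 ?addr0// => j ji.
  by rewrite (negPf ji) mulr0z.
have -> : x = \sum_i Zadic_val (c i) *: delta_mx i 0.
  apply/colP => i; rewrite summxE (bigD1 i)//= !mxE !eqxx mulr1 big1 ?addr0//.
  by move=> j ji; rewrite !mxE eq_sym (negPf ji) mulr0.
rewrite mulmx_sumr; apply: eq_bigr => i _; rewrite -scalemxAr; congr (_ *: _).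
rewrite -colE /bc_vec; apply/colP => j; rewrite !mxE.
by [].
Qed.

End LatticeBasis.

Lemma int_divX_le (F : fieldType) (S : subringClosed F) (pi z : F) k m :
  pi != 0 -> pi \in S -> (k <= m)%N -> pi ^- m * z \in S -> pi ^- k * z \in S.
Proof.
move=> pi0 piS km zS; rewrite -(subnK km) exprD in zS.
suff -> : pi ^- k * z = pi ^+ (m - k) * ((pi ^+ (m - k) * pi ^+ k)^-1 * z).
  by rewrite rpredM ?rpredX.
by rewrite invfM mulrA mulVKf// expf_neq0.
Qed.

(** The topology on matrices is entrywise: take the largest of the precisions required by the
    entries. *)
Lemma Qadic_mx_nbhs l (l_prime : prime l) n (O : set 'M[Qadic l_prime]_n) x :
  open O -> O x -> exists N, forall g,
    l%:R ^- N *: (g - x) \is a mxOver (@Qint l l_prime) -> O g.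
Proof.
move=> Oo Ox; have : nbhs x O by exact: open_nbhs_nbhs.
move=> [P Px PO].
have /choice[N NP] : forall ij : 'I_n * 'I_n, exists N, forall y,
    l%:R ^- N * (y - x ij.1 ij.2) \in @Qint l l_prime -> P ij.1 ij.2 y.
  move=> [i j]; have := Px i j; rewrite -nbhs_entourageE => -[E [N _ NE] EP].
  exists N => y /QintP[c cE]; apply: EP; apply/xsectionP; apply: NE.
  exists (- c).
  have -> : Zadic_val (- c) = - (l%:R ^- N * (y - x i j)) by rewrite cE rmorphN.
  by rewrite /= mulrN mulVKf ?Ql_lX_neq0// opprB.
exists (\max_ij N ij)%N => g gS; apply: PO => i j; apply: (NP (i, j)).
apply: (@int_divX_le _ _ _ _ (N (i, j)) (\max_ij N ij)%N).
- exact: Ql_l_neq0.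
- exact: (Qint_lX l_prime 1).
- exact: (leq_bigmax (i, j)).
- by have /mxOverP/(_ i j) := gS; rewrite !mxE.
Qed.

(** * Finiteness of the orbits of conjugates of the Galois image *)

Unset Implicit Arguments.

Theorem proposition5p8
  (R : realType) (l : nat) (l_prime : prime l)
  (L : fieldExtType rat) (Lbar : closedFieldType)
  (iota : {rmorphism L -> Lbar}) (iota_alg : forall x, algebraicOver iota x)
  (V : vectType rat) (X : integral_structure R l_prime iota V)
  (M : Q_subgroup (vdim V)) (M_MT : is_Mumford_Tate (HS_rep (ILS_HS X)) M) :
  let Ul : set 'M[Qadic l_prime]_(vdim V) := range (ILS_rho X) in
  let GLl := GL_lattice_l l_prime (ILS_lattice X) in
  let T := conjugates_in GLl Ul in
  Ul `<=` Q_subgroup_pts M (Qadic l_prime) ->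
  relatively_open Ul (Q_subgroup_pts M (Qadic l_prime)) ->
  exists F : set (set 'M[Qadic l_prime]_(vdim V)),
    [/\ finite_set F, F `<=` T & T = \bigcup_(H in F) conj_orbit GLl H].
Proof.
move=> Ul GLl T UM [O O_open UE].
have U1 : Ul 1%:M by exists 1%g; rewrite ?ILS_rho1.
have Umul u v : Ul u -> Ul v -> Ul (u *m v).
  by move=> [g _ <-] [h _ <-]; exists (g * h)%g; rewrite ?ILS_rhoM.
have UV u : Ul u -> exists2 v, Ul v & u *m v = 1%:M.
  move=> [g _ <-]; exists (ILS_rho X g^-1%g); first by exists g^-1%g.
  by rewrite -ILS_rhoM mulgV ILS_rho1.
have ULie Y : Lie M Y -> mx_span Ul Y.
  apply: (Lie_sub_span (Qadic_local_field l_prime)) => //.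
  (* Openness of [Ul] in the group of points of [M] provides the congruence neighbourhood of 1
     needed for exponentials. *)
  have [|N NO] := Qadic_mx_nbhs O_open (x := 1%:M).
    by move: U1; rewrite UE => -[].
  by exists N => g gM gN; rewrite UE; split=> //; exact: NO.
have [I [a [b [aU ba1 abU]]]] :=
  casimir_element M_MT (Qadic_Q_algebra l_prime) U1 Umul UV UM ULie.
have [e [e_basis VZE]] := ILS_latticeP X.
pose P := map_mx (Qalg_in (Qadic_Q_algebra l_prime)) (lattice_mx e).
have Pu : P \in unitmx by rewrite map_unitmx lattice_mx_unit.
(* The columns of [P] are a Zl-basis of the l-adic lattice, so [GLl] is the stabilizer of
   [P Zl^n]. *)
have GLE : GLl = GL_stab (@Qint l l_prime) P.
  by apply/seteqP; split=> g /(GL_stabP Pu (lattice_lP VZE)).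
rewrite /T GLE.
exact: (conjugates_finite (Qadic_local_field l_prime) aU ba1 abU Pu).
Qed.
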